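(* Consider the ODE–PDE system (for $t>0$, $\xi\in(0,1)$) $$\dot X(t)=A_1X(t)+G_1(\mathscr{K}_1z(\cdot,t))+G_1\Theta\Sigma(v(X(t),U(t)))(\mathscr{K}_2z(\cdot,t))+G_1h_1(v(X(t),U(t))),$$ $$\partial_tz(\xi,t)+\Lambda\partial_\xi z(\xi,t)=\Theta\Sigma(v(X(t),U(t)))z(\xi,t)+h_2(v(X(t),U(t))),\qquad z(0,t)=0,$$ where $\Sigma\in C^1(\mathbb{R}^{n_z};\mathbb{R}^{n_z\times n_z})$, $h_1,h_2\in C^1(\mathbb{R}^{n_z};\mathbb{R}^{n_z})$, $h_2$ is invertible, and $U\in C^1(\mathbb{R}_{\geq0};\mathbb{R}^{n_U})$. Suppose Assumption (A1) (forward completeness and boundedness) and Assumption (A2) (detectability) hold. Let $(X,z)\in C^1(\mathbb{R}_{\geq0};\mathcal{X})\cap C^0(\mathbb{R}_{\geq0};\mathscr{D}(\mathscr{A}))$ be a classical solution of this system, let $\hat\theta$ be generated by the adaptive law, $(\hat X,\hat z)$ by the observer, both described in the context, and let the observer error $(\tilde X,\tilde z)\triangleq(X-\hat X,z-\hat z)$ be a classical solution, $(\tilde X,\tilde z)\in C^1(\mathbb{R}_{\geq0};\mathcal{X})\cap C^0(\mathbb{R}_{\geq0};\mathscr{D}(\mathscr{A}))$. Then $(\tilde X,\tilde z)\in L^\infty(\mathbb{R}_{\geq0};\mathcal{Y})$. Moreover, if the filtered regressor $\varphi\in L^\infty(\mathbb{R}_{\geq0};\mathbb{R}^{n_z})$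 is persistently exciting, then $\|(\tilde X(t),\tilde z(\cdot,t))\|_{\mathcal{Y}}\to0$ exponentially fast as $t\to\infty$.
   Context: $n_X,n_z,n_U$ are positive integers. $\mathcal{X}\triangleq\mathbb{R}^{n_X}\times L^2((0,1);\mathbb{R}^{n_z})$ with norm $\|(Z,\zeta)\|_{\mathcal{X}}^2=\|Z\|_2^2+\|\zeta\|_{L^2}^2$; $\mathcal{Y}\triangleq\mathbb{R}^{n_X}\times H^1((0,1);\mathbb{R}^{n_z})$ with norm $\|(Z,\zeta)\|_{\mathcal{Y}}^2=\|Z\|_2^2+\|\zeta\|_{H^1}^2$; $\mathscr{D}(\mathscr{A})\triangleq\{(Z,\zeta)\in\mathcal{Y}:\zeta(0)=0\}$. Constant matrices: $A_1\in\mathbb{R}^{n_X\times n_X}$, $A_2\in\mathbb{R}^{n_z\times n_X}$, $G_1\in\mathbb{R}^{n_X\times n_z}$, $G_2\in\mathbb{R}^{n_z\times n_U}$; $v(X,U)\triangleq A_2X+G_2U$. $\Lambda=\mathrm{diag}\{\lambda_i\}$ with $\lambda_i>0$; $\Theta=\mathrm{diag}\{\theta_1,\dots,\theta_{n_z}\}$ with $\theta_i>0$ unknown. $\mathscr{K}_1\zeta\triangleq\int_0^1K_1(\xi)\zeta(\xi)d\xi+K_2\zeta(1)$, $\mathscr{K}_2\zeta\triangleq\int_0^1K_3(\xi)\zeta(\xi)d\xi$, with $K_1,K_3\in C^0([0,1];\mathbb{R}^{n_z\times n_z})$, $K_2\in\mathbb{R}^{n_z\times n_z}$. Assumption (A1):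 the system is forward complete (solutions exist for all $t\geq0$), $(X,z)\in L^\infty(\mathbb{R}_{\geq0};\mathcal{X})$ for mild solutions, $(X,z)\in L^\infty(\mathbb{R}_{\geq0};\mathcal{Y})$ for classical solutions, and $U\in L^\infty(\mathbb{R}_{\geq0};\mathbb{R}^{n_U})$. Assumption (A2): the pair $(A_1,A_2)$ is detectable. Measurements: $Y_1(t)=h_2(v(X(t),U(t)))$ and $Y_2(t)=\Theta\Lambda\Sigma(h_2^{-1}(Y_1(t)))\Lambda^{-1}Y_1(t)+\dot Y_1(t)$. Adaptive law: with $1_{n_z}=(1,\dots,1)^T$, set $Z_1=1_{n_z}^TY_1$, $Z_2=1_{n_z}^TY_2$, $\phi(t)=-\Lambda\Sigma(h_2^{-1}(Y_1(t)))\Lambda^{-1}Y_1(t)$; filters $\dot\zeta_1=-\varrho(\zeta_1-Z_1)$, $\dot\zeta_2=-\varrho\zeta_2+Z_2$, $\dot\varphi=-\varrho\varphi+\phi$ with $\varrho>0$, and $\zeta\triangleq\zeta_1+\zeta_2$; then $\dot{\hat\theta}=-\Gamma(R\hat\theta+Q)$, $\dot R=-\psi R+\varphi\varphi^T/(1+\|\varphi\|_2^2)$, $\dot Q=-\psi Q-(Z_1-\zeta)\varphi/(1+\|\varphi\|_2^2)$, with $\Gamma$ symmetric positive definite and $\psi>0$. Set $\hat\Theta(t)=\mathrm{diag}\{\hat\theta_1(t),\dots,\hat\theta_{n_z}(t)\}$. Observer: $L_1\in\mathbb{R}^{n_X\times n_z}$ is a constant matrix chosen so that $A_1+L_1A_2$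 is Hurwitz, $\hat Y_1(t)=h_2(A_2\hat X(t)+G_2U(t))$, and $\dot{\hat X}=A_1\hat X+G_1(\mathscr{K}_1\hat z)+G_1\hat\Theta\Sigma(h_2^{-1}(Y_1))(\mathscr{K}_2\hat z)+G_1h_1(h_2^{-1}(Y_1))-L_1(h_2^{-1}(Y_1)-h_2^{-1}(\hat Y_1))$, $\partial_t\hat z+\Lambda\partial_\xi\hat z=\hat\Theta\Sigma(h_2^{-1}(Y_1))\hat z+Y_1$, $\hat z(0,t)=0$. Persistent excitation: $\varphi$ is PE if there exist $T_0,\alpha_0>0$ with $\int_t^{t+T_0}\varphi(s)\varphi(s)^Tds\succeq\alpha_0 I_{n_z}$ for all $t\geq0$. *)

(* Defs.v *)
From HB Require Import structures.
From mathcomp Require Import all_boot all_order all_algebra.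
From mathcomp Require Import all_classical all_reals all_analysis.
Set Implicit Arguments. Unset Strict Implicit. Unset Printing Implicit Defensive.
Import Order.TTheory GRing.Theory Num.Theory.
Import numFieldNormedType.Exports.
Local Open Scope classical_set_scope.
Local Open Scope ring_scope.

Definition I01 {R : realType} : set R := `[0%R, 1%R].

Definition mnorm2 {R : realType} {m n : nat} (A : 'M[R]_(m, n)) : R :=
  \sum_(i < m) \sum_(j < n) A i j ^+ 2.
Definition mnorm {R : realType} {m n : nat} (A : 'M[R]_(m, n)) : R :=
  Num.sqrt (mnorm2 A).

Definition mint {R : realType} {m n : nat} (a b : R) (F : R -> 'M[R]_(m, n))
  : 'M[R]_(m, n) :=
  \matrix_(i, j) (\int[@lebesgue_measure R]_(x in `[a, b]) F x i j).

Definition isL2 {R : realType} {n : nat} (f : R -> 'cV[R]_n) : Prop :=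
  (forall i, measurable_fun I01 (fun x => f x i ord0)) /\
  (\int[@lebesgue_measure R]_(x in I01) (mnorm2 (f x))%:E < +oo)%E.

Definition L2norm2 {R : realType} {n : nat} (f : R -> 'cV[R]_n) : R :=
  \int[@lebesgue_measure R]_(x in I01) mnorm2 (f x).

(** f is in H^1((0,1); R^n) with weak derivative g: f, g in L^2 and
    f is the (absolutely continuous) primitive of g on [0,1]. *)
Definition isH1 {R : realType} {n : nat} (f g : R -> 'cV[R]_n) : Prop :=
  isL2 f /\ isL2 g /\
  forall x, 0 <= x <= 1 -> f x = f 0 + mint 0 x g.

Definition H1norm2 {R : realType} {n : nat} (f g : R -> 'cV[R]_n) : R :=
  L2norm2 f + L2norm2 g.

Definition C1nonneg {R : realType} {m n : nat} (F dF : R -> 'M[R]_(m, n)) : Prop :=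
  (forall t, 0 <= t -> forall e, 0 < e -> exists2 d, 0 < d &
     forall s, 0 <= s -> `|s - t| < d ->
       mnorm (F s - F t - (s - t) *: dF t) <= e * `|s - t|) /\
  (forall t, 0 <= t -> forall e, 0 < e -> exists2 d, 0 < d &
     forall s, 0 <= s -> `|s - t| < d -> mnorm (dF s - dF t) <= e).

Definition cont01 {R : realType} {m n : nat} (F : R -> 'M[R]_(m, n)) : Prop :=
  forall x, 0 <= x <= 1 -> forall e, 0 < e -> exists2 d, 0 < d &
    forall y, 0 <= y <= 1 -> `|y - x| < d -> mnorm (F y - F x) <= e.

Definition C1map {R : realType} {n p q : nat} (f : 'cV[R]_n -> 'M[R]_(p, q)) : Prop :=
  exists D : 'cV[R]_n -> 'I_n -> 'M[R]_(p, q),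
    (forall x i e, 0 < e -> exists2 d, 0 < d &
       forall h : R, 0 < `|h| < d ->
         mnorm (h^-1 *: (f (x + h *: delta_mx i ord0) - f x) - D x i) <= e) /\
    (forall i x e, 0 < e -> exists2 d, 0 < d &
       forall y, mnorm (y - x) < d -> mnorm (D y i - D x i) <= e).

(** A is Hurwitz: every (complex) eigenvalue a + i b, with eigenvector u + i w,
    has negative real part. *)
Definition hurwitz {R : realType} {n : nat} (A : 'M[R]_n) : Prop :=
  forall (a b : R) (u w : 'cV[R]_n), (u != 0) || (w != 0) ->
    A *m u = a *: u - b *: w -> A *m w = b *: u + a *: w -> a < 0.

Definition detectable {R : realType} {n p : nat} (A : 'M[R]_n) (C : 'M[R]_(p, n)) : Prop :=
  exists L : 'M[R]_(n, p), hurwitz (A + L *m C).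

Definition spd {R : realType} {n : nat} (G : 'M[R]_n) : Prop :=
  G^T = G /\ forall x : 'cV[R]_n, x != 0 -> 0 < (x^T *m G *m x) ord0 ord0.

Definition diagc {R : realType} {n : nat} (v : 'cV[R]_n) : 'M[R]_n :=
  diag_mx v^T.

Definition Kop1 {R : realType} {n : nat} (K1 : R -> 'M[R]_n) (K2 : 'M[R]_n)
  (zeta : R -> 'cV[R]_n) : 'cV[R]_n :=
  mint 0 1 (fun x => K1 x *m zeta x) + K2 *m zeta 1.
Definition Kop2 {R : realType} {n : nat} (K3 : R -> 'M[R]_n)
  (zeta : R -> 'cV[R]_n) : 'cV[R]_n :=
  mint 0 1 (fun x => K3 x *m zeta x).

(** Classical-solution regularity of (X, z) (z t is the profile z(.,t)):
    (X,z) in C^1(R_{>=0}; X-space) with time derivative (dX, zt),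
    and in C^0(R_{>=0}; D(A)), zxi t being the weak xi-derivative of z t. *)
Definition classical_reg {R : realType} {nX nz : nat}
  (X dX : R -> 'cV[R]_nX) (z zt zxi : R -> R -> 'cV[R]_nz) : Prop :=
  (forall t, 0 <= t -> isL2 (z t) /\ isL2 (zt t)) /\
  (forall t, 0 <= t -> forall e, 0 < e -> exists2 d, 0 < d &
     forall s, 0 <= s -> `|s - t| < d ->
       Num.sqrt (mnorm2 (X s - X t - (s - t) *: dX t) +
                 L2norm2 (fun x => z s x - z t x - (s - t) *: zt t x))
       <= e * `|s - t|) /\
  (forall t, 0 <= t -> forall e, 0 < e -> exists2 d, 0 < d &
     forall s, 0 <= s -> `|s - t| < d ->
       Num.sqrt (mnorm2 (dX s - dX t) + L2norm2 (fun x => zt s x - zt t x)) <= e) /\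
  (forall t, 0 <= t -> isH1 (z t) (zxi t) /\ z t 0 = 0) /\
  (forall t, 0 <= t -> forall e, 0 < e -> exists2 d, 0 < d &
     forall s, 0 <= s -> `|s - t| < d ->
       Num.sqrt (mnorm2 (X s - X t) +
                 H1norm2 (fun x => z s x - z t x) (fun x => zxi s x - zxi t x)) <= e).

(* Main.v *)
(** The prediction error of the filters decays exponentially, so the parameter error [te] obeys
    [te' = - Gamma (R te - eta)] with [eta] exponentially small and [R] positive semidefinite up to
    an exponentially small term. Its energy for the form of [Gamma^-1] is therefore bounded, and it
    decays when persistent excitation makes [R] uniformly positive.

    The profile error solves a transport equation with the source [diag te * Sigma * z] and vanishes
    at the inflow boundary. Since [U'] need not be bounded, its gradient is not estimated through the
    time derivative: the weight [exp (- m x)] is applied to the backward differences in space, which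
    solve the same equation because the system profile [z] also vanishes at the boundary. The
    resulting differential inequality is uniform in the step, and Lebesgue differentiation with
    Fatou's lemma carries it over to the gradient, which controls the whole profile error.

    Finally the finite-dimensional error solves a Hurwitz system forced by these quantities. *)

(* Two features of the system shape the argument. As [h2] is injective, the observer recovers [v]
   exactly, so the profile error is driven by [Thh *m Sigma v] acting on itself and by
   [diagc te *m Sigma v] acting on [z]; the source [h2 v], constant in space and in general nonzero
   at the inflow, cancels. This is what lets the zero extensions to the left of 0 solve the extended
   equation, and coefficients that do not depend on [x] commute with differences. Transport runs
   from left to right, so backward differences on [[0, 1]] never meet the jump of the extensions at
   1.

   As the interval is bounded, the weight may be as steep as desired: [m] is taken so large that the
   damping [lam0 * m] exceeds the bound on the reaction plus the rate of the source. Hence the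
   profile puts no restriction on the rate, which is limited only by that of [te] and by the
   spectrum of [A1 + L1 *m A2].

   Rates are attached to squares, and rate 0 means boundedness. A single estimate, used with rate 0
   or with the positive rate that excitation provides, gives both conclusions. *)
Require Import Defs.
From HB Require Import structures.
From mathcomp Require Import all_boot all_order all_algebra.
From mathcomp Require Import all_classical all_reals all_analysis.
From mathcomp Require Import measurable_realfun complex ring lra.
Import Order.TTheory GRing.Theory Num.Theory.
Import numFieldNormedType.Exports.
Local Open Scope classical_set_scope.
Local Open Scope ring_scope.

Set Implicit Arguments.
Unset Strict Implicit.
Unset Printing Implicit Defensive.

(** * Derivatives on the half-line and comparison *)

(** The derivative is relative to [0, oo): nothing is asked of [f] at negative times. *)
Definition hderiv {R : realType} (f : R -> R) (t l : R) : Prop :=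
  forall e : R, 0 < e -> exists2 d : R, 0 < d &
    forall s : R, 0 <= s -> `|s - t| < d -> `|f s - f t - (s - t) * l| <= e * `|s - t|.

Lemma hderiv_cst {R : realType} (c t : R) : hderiv (fun=> c) t 0.
Proof.
move=> e e0; exists 1 => // s _ _.
by rewrite subrr mulr0 subrr normr0 mulr_ge0 // ltW.
Qed.

Lemma hderiv_lip {R : realType} (f : R -> R) t l : hderiv f t l ->
  exists2 d : R, 0 < d & forall s : R, 0 <= s -> `|s - t| < d ->
    `|f s - f t| <= (1 + `|l|) * `|s - t|.
Proof.
move=> /(_ 1 ltr01)[d d0 H]; exists d => // s s0 st; have := H s s0 st.
move=> h; rewrite (_ : f s - f t = (f s - f t - (s - t) * l) + (s - t) * l); last by ring.
apply: (le_trans (ler_normD _ _)); rewrite [X in _ <= X]mulrDl; apply: lerD => //.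
by rewrite normrM mulrC.
Qed.

Lemma hderivD {R : realType} (f g : R -> R) t a b :
  hderiv f t a -> hderiv g t b -> hderiv (fun s => f s + g s) t (a + b).
Proof.
move=> Hf Hg e e0; have e2 : 0 < e / 2 by rewrite divr_gt0.
have [d d0 H] := Hf _ e2; have [d' d'0 H'] := Hg _ e2.
exists (Num.min d d'); first by rewrite lt_min d0.
move=> s s0; rewrite lt_min => /andP[h h'].
rewrite (_ : _ - _ = (f s - f t - (s - t) * a) + (g s - g t - (s - t) * b)); last by ring.
apply: (le_trans (ler_normD _ _)).
apply: (le_trans (lerD (H _ s0 h) (H' _ s0 h'))); lra.
Qed.

Lemma hderivM {R : realType} (f g : R -> R) t a b :
  hderiv f t a -> hderiv g t b -> hderiv (fun s => f s * g s) t (a * g t + f t * b).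
Proof.
move=> Hf Hg e e0.
have [d1 d10 L] := hderiv_lip Hf.
have K0 : 0 < 1 + `|g t| + `|f t| + (1 + `|a|) * (1 + `|b|).
  by have := normr_ge0 (f t); have := normr_ge0 (g t);
     have := normr_ge0 a; have := normr_ge0 b; nra.
set K := (X in 0 < X) in K0.
have eK : 0 < e / K by rewrite divr_gt0.
have [d2 d20 H2] := Hf _ eK; have [d3 d30 H3] := Hg _ eK.
have [d4 d40 L4] := hderiv_lip Hg.
(* Keeping [|s - t|] below [e / K] turns the product of the two increments, quadratic in [|s - t|],
   into a linear term. *)
exists (Num.min (Num.min d1 d2) (Num.min (Num.min d3 d4) (e / K))).
  by rewrite !lt_min d10 d20 d30 d40.
move=> s s0; rewrite !lt_min => /andP[/andP[h1 h2] /andP[/andP[h3 h4] h5]].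
have {}L := L _ s0 h1; have {}L4 := L4 _ s0 h4.
have {}H2 := H2 _ s0 h2; have {}H3 := H3 _ s0 h3.
rewrite (_ : _ - _ = (f s - f t - (s - t) * a) * g t
   + f t * (g s - g t - (s - t) * b) + (f s - f t) * (g s - g t)); last by ring.
apply: (le_trans (ler_normD _ _)); apply: (le_trans (lerD (ler_normD _ _) (lexx _))).
rewrite !normrM.
have -> : e = e / K * K by field; rewrite gt_eqF.
set x := `|s - t| in L L4 H2 H3 h5 *; set k := e / K in eK h5 H2 H3 *.
have x0 : 0 <= x by exact: normr_ge0.
have A1 := ler_wpM2r (normr_ge0 (g t)) H2.
have A2 := ler_wpM2l (normr_ge0 (f t)) H3.
have A3 := ler_pM (normr_ge0 _) (normr_ge0 _) L L4.
apply: (le_trans (lerD (lerD A1 A2) A3)).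
have B : x * x <= k * x by apply: ler_wpM2r => //; exact: ltW.
have C0 : 0 <= (1 + `|a|) * (1 + `|b|) by rewrite mulr_ge0 ?addr_ge0.
have := ler_wpM2l C0 B.
have -> : (1 + `|a|) * x * ((1 + `|b|) * x) = (1 + `|a|) * (1 + `|b|) * (x * x) by ring.
have kx0 : 0 <= k * x by rewrite mulr_ge0 // ltW.
rewrite /K; nra.
Qed.

Lemma hderivZ {R : realType} (f : R -> R) t a c :
  hderiv f t a -> hderiv (fun s => c * f s) t (c * a).
Proof.
by move=> h; have := hderivM (hderiv_cst c t) h; rewrite mul0r add0r.
Qed.

Lemma hderivN {R : realType} (f : R -> R) t a :
  hderiv f t a -> hderiv (fun s => - f s) t (- a).
Proof.
move=> /(@hderivZ _ _ _ _ (-1)); rewrite mulN1r.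
by under [X in hderiv X]eq_fun do rewrite mulN1r.
Qed.

Lemma hderivB {R : realType} (f g : R -> R) t a b :
  hderiv f t a -> hderiv g t b -> hderiv (fun s => f s - g s) t (a - b).
Proof. by move=> hf /hderivN; exact: hderivD. Qed.

Lemma hderiv_sum {R : realType} (I : Type) (r : seq I) (f : I -> R -> R) t (a : I -> R) :
  (forall i, hderiv (f i) t (a i)) ->
  hderiv (fun s => \sum_(i <- r) f i s) t (\sum_(i <- r) a i).
Proof.
move=> h; elim: r => [|i r IH].
  rewrite big_nil; under [X in hderiv X]eq_fun do rewrite big_nil.
  exact: hderiv_cst.
rewrite big_cons; under [X in hderiv X]eq_fun do rewrite big_cons.
exact: hderivD.
Qed.

Lemma is_derive_hderiv {R : realType} (f : R -> R) (t l : R) :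
  is_derive t 1 f l -> hderiv f t l.
Proof.
move=> [df fl] e e0.
have : h^-1 *: (f (h + t) - f t) @[h --> 0^'] --> l.
  have := df; rewrite /derivable -fl /derive.
  by under eq_fun do rewrite [_%:A]mulr1.
move=> /cvgrPdist_le /(_ e e0).
rewrite /prop_near1 /dnbhs /within /=.
move=> /nbhs_ballP [d /= d0 H]; exists d => // s s0 st.
have [->|sne] := eqVneq s t.
  by rewrite !subrr mul0r subrr normr0 mulr0.
have sne' : s - t != 0 by rewrite subr_eq0.
have := H (s - t); rewrite /ball /= sub0r normrN => /(_ st sne').
rewrite subrK /GRing.scale /= => h.
rewrite (_ : _ - _ = - ((s - t) * (l - (s - t)^-1 * (f s - f t)))); last first.
  by rewrite mulrBr mulrA mulfV // mul1r; ring.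
by rewrite normrN normrM mulrC ler_wpM2r.
Qed.

Lemma hderiv_is_derive {R : realType} (f : R -> R) (t l : R) : 0 < t ->
  hderiv f t l -> is_derive t 1 f l.
Proof.
move=> t0 H.
have C : h^-1 *: (f (h *: 1 + t) - f t) @[h --> 0^'] --> l.
  apply/cvgrPdist_le => e e0; have [d d0 {}H] := H _ e0.
  rewrite /prop_near1 /dnbhs /within /=.
  (* A radius of at most [t] keeps [h + t] in the half-line, the only place where the hypothesis
     speaks. *)
  apply/nbhs_ballP; exists (Num.min d t); first by rewrite /= lt_min d0.
  move=> h; rewrite /ball /= sub0r normrN lt_min => /andP[hd ht] hn0.
  have s0 : 0 <= h + t.
    by move: ht; rewrite ltr_norml => /andP[? _]; lra.
  have := H (h + t) s0; rewrite addrK => /(_ hd) {}H.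
  rewrite [h%:A]mulr1 /GRing.scale /=.
  rewrite (_ : _ - _ = - (h^-1 * (f (h + t) - f t - h * l))); last by field.
  rewrite normrN normrM normfV ler_pdivrMl ?normr_gt0 //.
  by rewrite [X in _ <= X]mulrC.
split; first by apply/cvg_ex; exists l.
by apply/cvg_lim => //; exact: Rhausdorff.
Qed.

Lemma hderiv_expR {R : realType} (c t : R) :
  hderiv (fun s => expR (c * s)) t (c * expR (c * t)).
Proof.
apply: is_derive_hderiv.
have h : is_derive t 1 (fun s : R => c * s) c.
  by apply: is_derive_eq; rewrite /GRing.scale /= mulr1.
have := @is_derive1_comp _ _ _ _ _ _ (is_derive_expR (c * t)) h.
by rewrite mulrC.
Qed.

Lemma hderiv_continuous {R : realType} (f df : R -> R) a b : 0 <= a ->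
  (forall t : R, 0 <= t -> hderiv f t (df t)) -> {within `[a, b], continuous f}.
Proof.
move=> a0 H; apply/subspace_continuousP => x /=; rewrite in_itv /= => /andP[ax xb].
have x0 : 0 <= x by exact: le_trans ax.
apply/cvgrPdist_le => e e0.
have [d d0 L] := hderiv_lip (H _ x0).
rewrite /prop_near1 /within /=; apply/nbhs_ballP.
have K0 : 0 < 1 + `|df x| by rewrite ltr_pwDl.
exists (Num.min d (e / (1 + `|df x|))); first by rewrite /= lt_min d0 divr_gt0.
move=> y; rewrite /ball /= lt_min => /andP[yd ye]; rewrite in_itv /= => /andP[ay yb].
rewrite distrC; apply: (le_trans (L _ (le_trans a0 ay) _)); first by rewrite distrC.
by rewrite mulrC -ler_pdivlMr // distrC ltW.
Qed.

(** Mean value theorem. The left end needs continuity alone, so an inequality at positive times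
    suffices; the equations of the system hold only there. *)
Lemma hderiv_le0_nincr {R : realType} (f df : R -> R) a b : 0 <= a -> a <= b ->
  (forall t : R, 0 <= t -> hderiv f t (df t)) ->
  (forall t : R, 0 < t -> df t <= 0) -> f b <= f a.
Proof.
move=> a0 ab H D.
move: ab; rewrite le_eqVlt => /orP[/eqP <- //|ab].
have [] := @MVT _ f df a b ab.
- move=> x; rewrite in_itv /= => /andP[ax _].
  by apply: hderiv_is_derive; [exact: le_lt_trans ax|apply: H; exact: le_trans (ltW ax)].
- exact: hderiv_continuous H.
move=> c; rewrite in_itv /= => /andP[ac cb] e.
by rewrite -subr_le0 e mulr_le0_ge0 ?D ?subr_ge0 ?(le_lt_trans a0) // ltW.
Qed.

(** Variation of constants without integrals: [expR (c * t) * f t - b / (c - k) * expR ((c - k) *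
    t)] is nonincreasing. The gap [k < c] lets the response inherit the rate of the forcing. *)
Lemma comparison_exp {R : realType} (f df : R -> R) c b k :
  k < c -> 0 <= b ->
  (forall t : R, 0 <= t -> hderiv f t (df t)) ->
  (forall t : R, 0 < t -> df t <= - c * f t + b * expR (- k * t)) ->
  forall t, 0 <= t -> f t <= (`|f 0| + b / (c - k)) * expR (- k * t).
Proof.
move=> kc b0 H D t t0.
pose g s := expR (c * s) * f s + (- (b / (c - k))) * expR ((c - k) * s).
pose dg s := (c * expR (c * s) * f s + expR (c * s) * df s)
   + (- (b / (c - k))) * ((c - k) * expR ((c - k) * s)).
have ck : 0 < c - k by rewrite subr_gt0.
have Hg s : 0 <= s -> hderiv g s (dg s).
  move=> s0; apply: hderivD; last exact/hderivZ/hderiv_expR.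
  by apply: hderivM; [exact: hderiv_expR|exact: H].
have E s : expR ((c - k) * s) = expR (c * s) * expR (- k * s).
  by rewrite -expRD; congr expR; ring.
have Dg s : 0 < s -> dg s <= 0.
  move=> /D; rewrite /dg E => h.
  have -> : - (b / (c - k)) * ((c - k) * (expR (c * s) * expR (- k * s)))
     = - (b * (expR (c * s) * expR (- k * s))) by field; rewrite gt_eqF.
  have := ler_wpM2l (expR_ge0 (c * s)) h; lra.
have := hderiv_le0_nincr (lexx 0) t0 Hg Dg.
rewrite /g !mulr0 !expR0 E mul1r mulr1 => h.
have X : expR (c * t) * expR (- c * t) = 1.
  by rewrite -expRD mulNr subrr expR0.
have q0 : 0 <= b / (c - k) by rewrite divr_ge0 // ltW.
have := ler_wpM2l (expR_ge0 (- c * t)) h.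
set q := b / (c - k) in q0 h *.
rewrite (_ : _ * (_ + _) = (expR (c * t) * expR (- c * t)) * (f t - q * expR (- k * t))); last by ring.
rewrite X mul1r lerBlDr => {}h; apply: (le_trans h).
rewrite mulrDl lerD2r.
apply: (@le_trans _ _ (expR (- c * t) * `|f 0|)).
  by apply: ler_wpM2l => //; have := ler_norm (f 0); lra.
by rewrite mulrC ler_wpM2l // ler_expR; apply: ler_wpM2r => //; lra.
Qed.

(** * Integration on the line *)

Definition L1R {R : realType} (u : R -> R) : Prop :=
  (@lebesgue_measure R).-integrable setT (EFin \o u).
Definition L2R {R : realType} (u : R -> R) : Prop :=
  measurable_fun setT u /\ L1R (fun x => u x ^+ 2).
Definition itg {R : realType} (u : R -> R) : R := \int[@lebesgue_measure R]_x u x.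

Lemma L1R_measurable {R : realType} (u : R -> R) : L1R u -> measurable_fun setT u.
Proof. by move=> /measurable_int /measurable_EFinP. Qed.

Lemma L1R_le {R : realType} (u v : R -> R) : measurable_fun setT u ->
  (forall x, `|u x| <= v x) -> L1R v -> L1R u.
Proof.
move=> mu uv; apply: le_integrable => //; first exact/measurable_EFinP.
by move=> x _; rewrite lee_fin (le_trans (uv x)) // ler_norm.
Qed.

Lemma L1R0 {R : realType} : L1R (fun=> 0 : R).
Proof. exact: integrable0. Qed.

Lemma L1RD {R : realType} (u v : R -> R) : L1R u -> L1R v -> L1R (fun x => u x + v x).
Proof. by move=> hu hv; have := integrableD measurableT hu hv. Qed.

Lemma L1RZ {R : realType} c (u : R -> R) : L1R u -> L1R (fun x => c * u x).
Proof. by move=> hu; have := integrableZl measurableT c hu. Qed.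

Lemma L1RB {R : realType} (u v : R -> R) : L1R u -> L1R v -> L1R (fun x => u x - v x).
Proof. by move=> hu hv; have := integrableB measurableT hu hv. Qed.

Lemma L1R_abs {R : realType} (u : R -> R) : L1R u -> L1R (fun x => `|u x|).
Proof. by move=> hu; have := integrable_norm hu. Qed.

Lemma L1R_mulb {R : realType} (C : R) (w u : R -> R) : measurable_fun setT w ->
  (forall x, `|w x| <= C) -> L1R u -> L1R (fun x => w x * u x).
Proof.
move=> mw wC hu; apply: (L1R_le _ _ (L1RZ C (L1R_abs hu))) => [|x].
  by apply: measurable_funM => //; exact: L1R_measurable.
by rewrite normrM ler_wpM2r.
Qed.

Lemma itgD {R : realType} (u v : R -> R) : L1R u -> L1R v ->
  itg (fun x => u x + v x) = itg u + itg v.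
Proof. by move=> hu hv; rewrite /itg RintegralD. Qed.

Lemma itgB {R : realType} (u v : R -> R) : L1R u -> L1R v ->
  itg (fun x => u x - v x) = itg u - itg v.
Proof. by move=> hu hv; rewrite /itg RintegralB. Qed.

Lemma itgZ {R : realType} c (u : R -> R) : L1R u -> itg (fun x => c * u x) = c * itg u.
Proof. by move=> hu; rewrite /itg RintegralZl. Qed.

Lemma itg_le {R : realType} (u v : R -> R) : L1R u -> L1R v ->
  (forall x, u x <= v x) -> itg u <= itg v.
Proof. by move=> hu hv uv; apply: le_Rintegral. Qed.

Lemma itg_ge0 {R : realType} (u : R -> R) : (forall x, 0 <= u x) -> 0 <= itg u.
Proof. by move=> h; apply: Rintegral_ge0. Qed.

Lemma itg0 {R : realType} : itg (fun=> 0 : R) = 0.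
Proof. by rewrite /itg Rintegral_cst // mul0r. Qed.

Lemma eq_itg {R : realType} (u v : R -> R) : u =1 v -> itg u = itg v.
Proof. by move=> /funext ->. Qed.

Lemma EFin_itg {R : realType} (u : R -> R) : L1R u ->
  (\int[@lebesgue_measure R]_x (u x)%:E = (itg u)%:E)%E.
Proof. by move=> hu; rewrite /itg /Rintegral fineK //; exact: integrable_fin_num. Qed.

Lemma L2R_mul {R : realType} (u v : R -> R) : L2R u -> L2R v -> L1R (fun x => u x * v x).
Proof.
move=> [mu hu] [mv hv]; apply: (L1R_le _ _ (L1RD hu hv)) => [|x].
  exact: measurable_funM.
rewrite ler_norml; have := sqr_ge0 (u x - v x); have := sqr_ge0 (u x + v x).
by move: (u x) (v x) => a b; nra.
Qed.

Lemma L2RD {R : realType} (u v : R -> R) : L2R u -> L2R v -> L2R (fun x => u x + v x).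
Proof.
move=> hu hv; split; first by apply: measurable_funD; [case: hu|case: hv].
have := L1RD (L1RD hu.2 hv.2) (L1RZ 2 (L2R_mul hu hv)).
by congr L1R; apply/funext => x; ring.
Qed.

Lemma L2RZ {R : realType} c (u : R -> R) : L2R u -> L2R (fun x => c * u x).
Proof.
move=> hu; split; first by apply: measurable_funM => //; case: hu.
have := L1RZ (c ^+ 2) hu.2.
by congr L1R; apply/funext => x; ring.
Qed.

Lemma L2RB {R : realType} (u v : R -> R) : L2R u -> L2R v -> L2R (fun x => u x - v x).
Proof.
move=> hu /(L2RZ (-1)) hv; have := L2RD hu hv.
by congr L2R; apply/funext => x; ring.
Qed.

Lemma L2R_mulb {R : realType} (C : R) (w u : R -> R) : measurable_fun setT w ->
  (forall x, `|w x| <= C) -> L2R u -> L2R (fun x => w x * u x).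
Proof.
move=> mw wC [mu hu]; split; first exact: measurable_funM.
apply: (@L1R_le _ _ (fun x => C ^+ 2 * u x ^+ 2) _ _ (L1RZ _ hu)) => [|x].
  by apply: measurable_funX; exact: measurable_funM.
rewrite normrX normrM exprMn (real_normK (num_real (u x))) ler_wpM2r ?sqr_ge0 //.
by rewrite ler_sqr ?nnegrE // (le_trans _ (wC x)).
Qed.

(** Lebesgue measure is determined by its values on the intervals []a, b]], whose length a
    translation preserves. *)
Lemma lebesgue_measure_shift {R : realType} (h : R) (A : set R) : measurable A ->
  pushforward (@lebesgue_measure R) ((fun x : R => x - h) : _ -> measurableTypeR R) A
  = lebesgue_measure A.
Proof.
move=> mA.
have mf : measurable_fun setT (fun x : R => x - h) by apply: measurable_funB.
apply/esym/lebesgue_measure_unique => //= _ [[a b]] _ <-.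
rewrite /pushforward (_ : _ @^-1` _ = `]a + h, b + h]%classic); last first.
  by apply/seteqP; split => x /=; rewrite !in_itv /= => /andP[p q]; apply/andP; split; lra.
rewrite !lebesgue_measure_itv /= !lte_fin ltrD2r; case: ifP => // _.
by congr (_%:E); ring.
Qed.

Lemma L1R_shift {R : realType} (h : R) (u : R -> R) : L1R u ->
  L1R (fun x => u (x - h)) /\ itg (fun x => u (x - h)) = itg u.
Proof.
move=> hu; have mu := L1R_measurable hu.
have mf : measurable_fun [set: measurableTypeR R] (fun x : measurableTypeR R => x - h : measurableTypeR R).
  by apply: measurable_funB.
have muh : measurable_fun setT (fun x : R => u (x - h)) by apply: measurableT_comp.
(* Nonnegative functions come first: for [|u|] this gives the integrability that the signed change
   of variables asks for. *)
have E (f : R -> \bar R) : measurable_fun setT f -> (forall x, 0 <= f x)%E ->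
   (\int[@lebesgue_measure R]_x f (x - h)%R = \int[@lebesgue_measure R]_x f x)%E.
  move=> mF f0.
  have := @ge0_integral_pushforward _ _ _ _ _ _ mf (@lebesgue_measure R) setT f
    measurableT mF (fun y _ => f0 y).
  rewrite preimage_setT => <-.
  by apply: eq_measure_integral => A mA _; exact: (lebesgue_measure_shift h).
have i1 : L1R (fun x => u (x - h)).
  apply/integrableP; split; first exact/measurable_EFinP.
  have := E (fun x => `|(u x)%:E|)%E; rewrite /= => -> //.
    by case/integrableP: hu.
  by apply/measurable_EFinP; exact: measurableT_comp.
split => //; rewrite /itg /Rintegral; congr fine.
have mU : measurable_fun setT (EFin \o u) by exact/measurable_EFinP.
have := @integral_pushforward _ _ _ _ _ _ mf (@lebesgue_measure R) setT _ mU i1 measurableT.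
rewrite preimage_setT => <-.
by apply: eq_measure_integral => A mA _; exact: (lebesgue_measure_shift h).
Qed.

Lemma L2R_shift {R : realType} (h : R) (u : R -> R) : L2R u -> L2R (fun x => u (x - h)).
Proof.
move=> [mu hu]; split; last by case: (L1R_shift h hu).
by apply: measurableT_comp => //; apply: measurable_funB.
Qed.

Lemma measurable_pair_sect1 {R : realType} (chi : R * R -> R) x :
  measurable_fun setT chi -> measurable_fun setT (fun y => chi (x, y)).
Proof. by move=> m; apply: (measurableT_comp m); exact: pair1_measurable. Qed.
Lemma measurable_pair_sect2 {R : realType} (chi : R * R -> R) y :
  measurable_fun setT chi -> measurable_fun setT (fun x => chi (x, y)).
Proof. by move=> m; apply: (measurableT_comp m); exact: pair2_measurable. Qed.

(** Since [chi] is at most 1, [|u x| * |v y|] dominates the integrand on the plane. A half-plane for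
    [chi] will give integration by parts, a strip the bound on differences. *)
Lemma itg_fubini {R : realType} (u v : R -> R) (chi : R * R -> R) :
  measurable_fun setT chi -> (forall p, 0 <= chi p <= 1) -> L1R u -> L1R v ->
  L1R (fun x => u x * itg (fun y => chi (x, y) * v y)) /\
  itg (fun x => u x * itg (fun y => chi (x, y) * v y)) =
  itg (fun y => v y * itg (fun x => chi (x, y) * u x)).
Proof.
move=> mchi chi01 hu hv.
have chi1 p : `|chi p| <= 1 by case/andP: (chi01 p) => a b; rewrite ger0_norm.
pose f := fun p : R * R => (u p.1 * v p.2 * chi p)%:E.
have mf0 : measurable_fun setT (fun p : R * R => u p.1 * v p.2 * chi p).
  apply: measurable_funM => //.
  apply: measurable_funM; apply: measurableT_comp => //; exact: L1R_measurable.
have mf : measurable_fun setT f by exact/measurable_EFinP.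
have cv x : L1R (fun y => chi (x, y) * v y).
  by apply: (@L1R_mulb _ 1) => //; exact: measurable_pair_sect1.
have cu y : L1R (fun x => chi (x, y) * u x).
  by apply: (@L1R_mulb _ 1) => //; exact: measurable_pair_sect2.
have F1 x : (\int[@lebesgue_measure R]_y f (x, y) =
    (u x * itg (fun y => chi (x, y) * v y))%:E)%E.
  rewrite -itgZ // -EFin_itg; last exact: L1RZ.
  by apply: eq_integral => y _; rewrite /f /=; congr (_%:E); ring.
have F2 y : (\int[@lebesgue_measure R]_x f (x, y) =
    (v y * itg (fun x => chi (x, y) * u x))%:E)%E.
  rewrite -itgZ // -EFin_itg; last exact: L1RZ.
  by apply: eq_integral => x _; rewrite /f /=; congr (_%:E); ring.
have If : (@lebesgue_measure R \x @lebesgue_measure R)%E.-integrable setT f.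
  apply/integrable12ltyP => //.
  have le x : (\int[@lebesgue_measure R]_y `|f (x, y)| <=
     (`|u x| * itg (fun y => `|v y|))%:E)%E.
    rewrite -itgZ; last exact: L1R_abs.
    rewrite -EFin_itg; last exact/L1RZ/L1R_abs.
    apply: ge0_le_integral => //=.
    - apply/measurable_EFinP; apply: measurableT_comp => //.
      exact: measurable_pair_sect1 x mf0.
    - by apply/measurable_EFinP; apply: L1R_measurable; exact/L1RZ/L1R_abs.
    - by move=> y _; rewrite lee_fin !normrM ler_piMr // mulr_ge0.
  have hU := L1RZ (itg (fun y => `|v y|)) (L1R_abs hu).
  apply: (@le_lt_trans _ _ (\int[@lebesgue_measure R]_x (itg (fun y => `|v y|) * `|u x|)%:E)%E).
    apply: ge0_le_integral => //=.
    - by move=> x _; apply: integral_ge0.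
    - have mabs : measurable_fun setT
          (fun p : measurableTypeR R * measurableTypeR R => `|u p.1 * v p.2 * chi p|%:E)%E.
        by apply/measurable_EFinP; apply: measurableT_comp.
      exact: (measurable_fun_fubini_tonelli_F (m2 := @lebesgue_measure R) _ mabs).
    - by apply/measurable_EFinP; exact: L1R_measurable.
    - by move=> x _; rewrite mulrC le.
  by rewrite EFin_itg // ltry.
split.
  have := integrable_fubini_F If; rewrite /fubini_F.
  by apply: eq_integrable => // x _; rewrite F1.
have := Fubini If.
under eq_integral do rewrite F1.
under [X in _ = X]eq_integral do rewrite F2.
by rewrite /itg /Rintegral => ->.
Qed.

(** * Weighted integration by parts *)

Definition ind {R : realType} (b : bool) : R := if b then 1 else 0.

Lemma ind01 {R : realType} b : 0 <= (ind b : R) <= 1.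
Proof. by case: b; rewrite /ind lexx ler01. Qed.

Lemma ind_abs {R : realType} b : `|ind b : R| <= 1.
Proof. by case: b; rewrite /ind ?normr1 ?normr0. Qed.

Lemma measurable_ind {R : realType} d (T : measurableType d) (b : T -> bool) :
  measurable_fun setT b -> measurable_fun setT (fun x => ind (b x) : R).
Proof. by move=> mb; apply: measurable_fun_ifT. Qed.

(** Functions on [0, 1] are extended by zero, so that they can be translated freely. *)
Definition zext {R : realType} (f : R -> R) (x : R) : R := ind (0 <= x <= 1) * f x.

Lemma zextE {R : realType} (f : R -> R) : zext f = f \_ I01.
Proof.
apply/funext => x; rewrite patchE /zext /ind.
rewrite (_ : (x \in I01) = (0 <= x <= 1)); last first.
  by apply/idP/idP; rewrite inE /I01 /= in_itv.
by case: ifP; rewrite ?mul1r ?mul0r.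
Qed.

Lemma zext_in {R : realType} (f : R -> R) x : 0 <= x <= 1 -> zext f x = f x.
Proof. by rewrite /zext => ->; rewrite mul1r. Qed.

Lemma zext_out {R : realType} (f : R -> R) x : ~~ (0 <= x <= 1) -> zext f x = 0.
Proof. by rewrite /zext => /negbTE ->; rewrite mul0r. Qed.

Lemma itg_zext {R : realType} (f : R -> R) :
  itg (zext f) = \int[@lebesgue_measure R]_(x in I01) f x.
Proof. by rewrite zextE [RHS]Rintegral_mkcond. Qed.

Lemma measurable_I01 {R : realType} : measurable (I01 : set R).
Proof. exact: measurable_itv. Qed.

Lemma measurable_zext {R : realType} (f : R -> R) :
  measurable_fun I01 f <-> measurable_fun setT (zext f).
Proof. rewrite zextE; apply: measurable_restrictT; exact: measurable_I01. Qed.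

Lemma L1R_zext {R : realType} (f : R -> R) :
  (@lebesgue_measure R).-integrable I01 (EFin \o f) <-> L1R (zext f).
Proof.
rewrite /L1R zextE (_ : EFin \o (f \_ I01) = (EFin \o f) \_ I01).
  by apply: integrable_mkcond; exact: measurable_I01.
by apply/funext => x /=; rewrite !patchE; case: ifP.
Qed.

Lemma zext_sqr {R : realType} (f : R -> R) :
  zext (fun x => f x ^+ 2) = (fun x => zext f x ^+ 2).
Proof. by apply/funext => x; rewrite /zext exprMn /ind; case: ifP => _; rewrite ?expr1n ?expr0n. Qed.

Lemma L1R_ind_itv {R : realType} (a b : bool) (x y : R) (c : R -> bool) :
  (forall t, c t = (t \in Interval (BSide a x) (BSide b y))) ->
  L1R (fun t => ind (c t)).
Proof.
move=> E; have := @integrable_indic_itv R x y a b.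
rewrite /L1R; apply: eq_integrable => // t _ /=; congr (_%:E).
rewrite /ind E indicE; case: ifP => h; first by rewrite mem_set.
by rewrite memNset // => /=; rewrite h.
Qed.

Lemma itg_ind_itv {R : realType} (a b : bool) (x y : R) (c : R -> bool) : x <= y ->
  (forall t, c t = (t \in Interval (BSide a x) (BSide b y))) ->
  itg (fun t => ind (c t)) = y - x.
Proof.
move=> xy E; transitivity (\int[@lebesgue_measure R]_(t in [set` Interval (BSide a x) (BSide b y)]) (1 : R)).
  rewrite Rintegral_mkcond; apply: eq_itg => t; rewrite patchE /ind E.
  case: ifP => h; first by rewrite mem_set.
  by rewrite memNset //= h.
rewrite /Rintegral integral_cst; last exact: measurable_itv.
transitivity (fine (@lebesgue_measure R [set` Interval (BSide a x) (BSide b y)])).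
  by congr fine; rewrite mul1e.
rewrite lebesgue_measure_itv /=.
by rewrite lte_fin; move: xy; rewrite le_eqVlt => /orP[/eqP ->|->] //=; rewrite ltxx subrr.
Qed.

(** Integration starts at -oo, so that translating [u] translates its primitive and no base point
    interferes. *)
Definition prim {R : realType} (u : R -> R) (x : R) : R := itg (fun y => ind (y <= x) * u y).

Lemma L1R_ind_mul {R : realType} (c : R -> bool) (u : R -> R) :
  measurable_fun setT c -> L1R u -> L1R (fun y => ind (c y) * u y).
Proof.
by move=> mc; apply: (@L1R_mulb _ 1) => [|x]; [exact: measurable_ind|exact: ind_abs].
Qed.

Lemma L1R_prim {R : realType} (u : R -> R) x : L1R u -> L1R (fun y => ind (y <= x) * u y).
Proof. by apply: L1R_ind_mul; apply: measurable_fun_ler. Qed.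

Lemma prim_itv {R : realType} (u : R -> R) x :
  prim u x = \int[@lebesgue_measure R]_(t in `]-oo, x]) u t.
Proof.
rewrite Rintegral_mkcond; apply: eq_itg => y; rewrite patchE /ind.
by case: (boolP (y <= x)) => h; [rewrite mem_set ?mul1r|rewrite memNset ?mul0r];
   rewrite //= in_itv //= (negbTE h).
Qed.

Lemma prim_lt {R : realType} (u : R -> R) x : L1R u ->
  itg (fun y => ind (y < x) * u y) = prim u x.
Proof.
move=> hu; rewrite prim_itv -Rintegral_itv_bndo_bndc; last exact: integrableS hu.
rewrite Rintegral_mkcond; apply: eq_itg => y; rewrite patchE /ind.
by case: (boolP (y < x)) => h; [rewrite mem_set ?mul1r|rewrite memNset ?mul0r];
   rewrite //= in_itv //= (negbTE h).
Qed.

(** Fubini on the half-plane [y <= x]: the two terms integrate [u] times [v] over complementary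
    half-planes, the diagonal being null. *)
Lemma itg_parts {R : realType} (u v : R -> R) : L1R u -> L1R v ->
  itg (fun x => u x * prim v x) + itg (fun x => v x * prim u x) = itg u * itg v.
Proof.
move=> hu hv.
pose chi := fun p : R * R => (ind (p.2 <= p.1) : R).
have mchi : measurable_fun setT chi by apply: measurable_ind; apply: measurable_fun_ler.
have [_ ->] := itg_fubini mchi (fun p => ind01 _) hu hv.
have E y : itg (fun x => chi (x, y) * u x) = itg u - prim u y.
  rewrite -(prim_lt _ hu) -itgB //; last by apply: L1R_ind_mul => //; apply: measurable_fun_ltr.
  apply: eq_itg => x; rewrite /chi /= /ind.
  by rewrite leNgt; case: (x < y) => /=; ring.
under eq_itg do rewrite E.
have [h _] := itg_fubini mchi (fun p => ind01 _) hv hu.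
rewrite -itgD //; last first.
  have := L1RB (L1RZ (itg u) hv) h.
  by congr L1R; apply/funext => x; rewrite /prim /chi /=; ring.
rewrite -itgZ //; apply: eq_itg => x; ring.
Qed.

Lemma L1R_mul_prim {R : realType} (u v : R -> R) : L1R u -> L1R v -> L1R (fun x => u x * prim v x).
Proof.
move=> hu hv; pose chi := fun p : R * R => (ind (p.2 <= p.1) : R).
have mchi : measurable_fun setT chi by apply: measurable_ind; apply: measurable_fun_ler.
by have [] := itg_fubini mchi (fun p => ind01 _) hu hv.
Qed.

(** The chain rule for the square of a primitive that may fail to be differentiable at some points:
    [itg_parts] with both factors equal to [g] cut off at [x]. *)
Lemma prim_sqr {R : realType} (g : R -> R) x : L1R g ->
  prim g x ^+ 2 = prim (fun y => 2 * (g y * prim g y)) x.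
Proof.
move=> hg; have hu := L1R_prim x hg.
have := itg_parts hu hu; rewrite -expr2 => <-.
(* To the left of [x] the cut-off does not change the primitive. *)
have E y : ind (y <= x) * g y * prim (fun y => ind (y <= x) * g y) y
   = ind (y <= x) * (g y * prim g y).
  rewrite {1 3}/ind; case: ifP => yx; last by rewrite !mul0r.
  rewrite !mul1r; congr (_ * _); apply: eq_itg => t.
  by rewrite /ind; case: ifP => ty; rewrite ?mul0r // (le_trans ty yx) mul1r.
rewrite (eq_itg E) /prim -itgD; try exact/L1R_prim/L1R_mul_prim.
by apply: eq_itg => y; rewrite /prim; ring.
Qed.


(** [|a| <= 1 + a ^+ 2], and the constant is integrable over [[0, 1]]. *)
Lemma L1R_zext_bounded {R : realType} (u : R -> R) : L2R (zext u) -> L1R (zext u).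
Proof.
move=> [mu hu].
have hi : L1R (fun t => ind (0 <= t <= 1) : R).
  by apply: (@L1R_ind_itv _ true false 0 1) => t; rewrite in_itv.
apply: (L1R_le mu _ (L1RD hi hu)) => x; rewrite /zext /ind.
case: ifP => _; rewrite ?mul0r ?normr0 ?add0r ?expr0n //= mul1r ler_norml.
by move: (u x) => a; nra.
Qed.

Lemma continuous_exp_scale {R : realType} (m : R) : continuous (fun x : R => expR (m * x)).
Proof.
by move=> x; apply: continuous_comp; [exact: mulrl_continuous|exact: continuous_expR].
Qed.

Lemma itg_exp {R : realType} (m x : R) : 0 < m -> 0 <= x ->
  itg (fun t => ind (0 <= t <= x) * expR (- m * t)) = (1 - expR (- m * x)) / m.
Proof.
move=> m0; rewrite le_eqVlt => /orP[/eqP <-|x0].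
  rewrite mulr0 expR0 subrr mul0r.
  transitivity (\int[@lebesgue_measure R]_(t in [set 0]) expR (- m * t)).
    rewrite Rintegral_mkcond; apply: eq_itg => t; rewrite patchE /ind -eq_le.
    case: eqVneq => h; first by rewrite mem_set ?mul1r.
    by rewrite memNset ?mul0r //= => h'; move: h; rewrite h' eqxx.
  exact: Rintegral_set1.
have c1 : continuous (fun x : R => expR (- m * x)) by exact: continuous_exp_scale.
have D (t : R) : is_derive t 1 (fun x => - m^-1 * expR (- m * x)) (expR (- m * t)).
  have h : is_derive t 1 (fun s : R => - m * s) (- m).
    by apply: is_derive_eq; rewrite /GRing.scale /= mulr1.
  have h' := @is_derive1_comp _ _ _ _ _ _ (is_derive_expR (- m * t)) h.
  have h2 := @is_deriveZ _ _ _ _ (- m^-1) _ _ _ h'.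
  apply: (is_derive_eq h2); rewrite /GRing.scale /=; field; exact: lt0r_neq0.
have cF : continuous (fun x : R => - m^-1 * expR (- m * x)).
  by move=> t; apply: cvgMr => //; exact: c1.
have := @continuous_FTC2 R (fun t => expR (- m * t)) (fun x => - m^-1 * expR (- m * x)) 0 x x0.
move=> H; transitivity (\int[@lebesgue_measure R]_(t in `[0, x]) expR (- m * t)).
  rewrite Rintegral_mkcond; apply: eq_itg => t; rewrite patchE /ind.
  case: ifP => h; first by rewrite mem_set ?mul1r //= in_itv.
  by rewrite memNset ?mul0r //= in_itv /= h.
rewrite /Rintegral H.
- rewrite /= mulr0 expR0; field; exact: lt0r_neq0.
- exact: continuous_subspaceT.
- split.
  + by move=> t _; case: (D t).
  + by apply: cvg_at_right_filter; exact: cF.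
  + by apply: cvg_at_left_filter; exact: cF.
- by move=> t _; rewrite derive1E; apply: derive_val.
Qed.

Lemma L1R_zext_continuous {R : realType} (f : R -> R) :
  {within I01, continuous f} -> L1R (zext f).
Proof.
move=> cf; apply/L1R_zext; apply: continuous_compact_integrable => //.
exact: segment_compact.
Qed.

Lemma prim_out_le {R : realType} (u : R -> R) x : (forall y, y < 0 -> u y = 0) ->
  x < 0 -> prim u x = 0.
Proof.
move=> hu x0; rewrite -[RHS](@itg0 R); apply: eq_itg => y; rewrite /ind.
by case: ifP => h; rewrite ?mul0r // hu ?mulr0 //; exact: le_lt_trans x0.
Qed.

(** Integration by parts for [2 f f'] against the weight [exp (- m x)], where
    [f' = g] is only integrable; the boundary term at [1] is dropped. *)
Lemma weighted_parts {R : realType} (m : R) (g : R -> R) : 0 < m -> L1R g ->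
  (forall x, ~~ (0 <= x <= 1) -> g x = 0) ->
  let E := zext (fun x => expR (- m * x)) in
  L1R (fun x => E x * (prim g x * g x)) /\ L1R (fun x => E x * prim g x ^+ 2) /\
  m * itg (fun x => E x * prim g x ^+ 2) <= 2 * itg (fun x => E x * (prim g x * g x)).
Proof.
move=> m0 hg g0 E.
have hE : L1R E by apply/L1R_zext_continuous/continuous_subspaceT/continuous_exp_scale.
have E1 x : `|E x| <= 1.
  rewrite /E /zext /ind; case: ifP => [/andP[x0 _]|_]; last by rewrite mul0r normr0.
  rewrite mul1r ger0_norm ?expR_ge0 // -[leRHS]expR0 ler_expR.
  by rewrite mulNr oppr_le0 mulr_ge0 // ltW.
pose k := fun y => 2 * (g y * prim g y).
have hk : L1R k by exact/L1RZ/L1R_mul_prim.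
have hk2 : L1R (fun x => E x * prim g x ^+ 2).
  have := L1R_mul_prim hE hk; congr L1R; apply/funext => x.
  by rewrite prim_sqr.
have hEg : L1R (fun x => E x * (prim g x * g x)).
  apply: (L1R_mulb (L1R_measurable hE) E1).
  by have := L1R_mul_prim hg hg; congr L1R; apply/funext => x; rewrite mulrC.
split => //; split => //.
have := itg_parts hk hE.
(* The primitive of the weight is [(1 - expR (- m * x)) / m], whose exponential part restores the
   weight itself. Outside [[0, 1]] both sides vanish with [g]. *)
have P x : k x * prim E x = m^-1 * (k x - 2 * (E x * (prim g x * g x))).
  have [x01|x01] := boolP (0 <= x <= 1); last by rewrite /k g0 //; ring.
  have -> : prim E x = (1 - expR (- m * x)) / m.
    rewrite -itg_exp //; last by case/andP: x01.
    apply: eq_itg => y; rewrite /E /zext /ind; case/andP: x01 => x0 x1.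
    case: (boolP (y <= x)) => yx; last by rewrite andbF !mul0r.
    by rewrite (le_trans yx x1) !andbT mul1r.
  rewrite /k /E zext_in //; field; exact: lt0r_neq0.
have hE2 := L1RZ 2 hEg.
rewrite (eq_itg P) itgZ; last exact: L1RB.
rewrite itgB // itgZ //.
have -> : itg k = prim g 1 ^+ 2.
  rewrite prim_sqr //; apply: eq_itg => y; rewrite /ind.
  case: ifP => [|/negbT h]; first by rewrite mul1r.
  by rewrite /k g0 ?negb_and ?h ?orbT //; ring.
have -> : itg (fun x => E x * prim k x) = itg (fun x => E x * prim g x ^+ 2).
  by apply: eq_itg => x; rewrite prim_sqr.
have -> : itg E = (1 - expR (- m * 1)) / m by rewrite -itg_exp.
set a := itg _; set b := itg _; set c := prim g 1 ^+ 2.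
(* With [G] for [prim g], the identity now says that [m] times the integral of [E G^2] is twice the
   integral of [E G g] minus [G(1)^2 exp(-m)]. *)
move=> H; have := congr1 ( *%R m) H.
rewrite mulrDr mulrA mulfV ?lt0r_neq0 // mul1r.
have -> : m * (c * ((1 - expR (- m * 1)) / m)) = c - c * expR (- m * 1).
  by field; exact: lt0r_neq0.
have : 0 <= c * expR (- m * 1) by rewrite mulr_ge0 ?sqr_ge0 ?expR_ge0.
by lra.
Qed.

(** For [0 < C] evaluate at the vertex; for [C = 0] the expression is affine in [s], which forces
    [B = 0]. It yields Cauchy-Schwarz both in [L^2] and for the form of [Gamma^-1]. *)
Lemma discriminant_le {R : realType} (A B C : R) :
  (forall s, 0 <= A + 2 * s * B + s ^+ 2 * C) -> B ^+ 2 <= A * C.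
Proof.
move=> H; have [C0|C0] := ltP 0 C.
  have := H (- (B / C)).
  have -> : A + 2 * - (B / C) * B + (- (B / C)) ^+ 2 * C = (A * C - B ^+ 2) / C.
    by field; exact: lt0r_neq0.
  by rewrite pmulr_lge0 ?invr_gt0 // subr_ge0.
have A0 : 0 <= A by have := H 0; rewrite mulr0 mul0r expr0n mul0r !addr0.
have C1 : C = 0.
  apply/eqP; rewrite eq_le C0 /= leNgt; apply/negP => Cn.
  (* If [C < 0], the values at the two square roots of [(A + B ^+ 2 + 1) / (- C)] have a negative
     sum. *)
  have s0 : 0 <= (A + B ^+ 2 + 1) / (- C).
    by rewrite divr_ge0 ?oppr_ge0 // addr_ge0 // addr_ge0 // sqr_ge0.
  have e : A + B ^+ 2 + 1 = (A + B ^+ 2 + 1) / (- C) * (- C).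
    by field; rewrite ltr0_neq0.
  set s := _ / _ in s0 e.
  have := H (Num.sqrt s); have := H (- Num.sqrt s).
  rewrite sqrrN sqr_sqrtr //.
  by have := sqr_ge0 B; lra.
subst C; rewrite mulr0; have [->|B0] := eqVneq B 0; first by rewrite expr0n.
(* The affine function takes the value -1 at this point. *)
have := H (- ((A + 1) / (2 * B))).
have -> : A + 2 * - ((A + 1) / (2 * B)) * B + (- ((A + 1) / (2 * B))) ^+ 2 * 0 = -1 by field.
by rewrite ler0N1.
Qed.

Lemma itg_sqrD {R : realType} (u v : R -> R) s : L2R u -> L2R v ->
  itg (fun x => (u x + s * v x) ^+ 2) =
  itg (fun x => u x ^+ 2) + 2 * s * itg (fun x => u x * v x) + s ^+ 2 * itg (fun x => v x ^+ 2).
Proof.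
move=> hu hv; have huv := L2R_mul hu hv.
have h1 := L1RZ (2 * s) huv; have h2 := L1RZ (s ^+ 2) hv.2.
have h3 := L1RD hu.2 h1.
rewrite -!itgZ //; last by case: hv.
rewrite -itgD //; last by case: hu.
by rewrite -itgD //; apply: eq_itg => x; ring.
Qed.

Lemma itg_CS {R : realType} (u v : R -> R) : L2R u -> L2R v ->
  itg (fun x => u x * v x) ^+ 2 <= itg (fun x => u x ^+ 2) * itg (fun x => v x ^+ 2).
Proof.
move=> hu hv; apply: discriminant_le => s; rewrite -itg_sqrD //.
by apply: itg_ge0 => x; exact: sqr_ge0.
Qed.

(** * Backward differences *)

Definition dif {R : realType} (h : R) (f : R -> R) (x : R) : R := zext f x - zext f (x - h).

(** The factor is the square root of the weight [exp (- m x)], so that the Lyapunov functional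
    of a difference is a plain squared L2 norm. *)
Definition wdif {R : realType} (m h : R) (f : R -> R) (x : R) : R :=
  zext (fun y => expR (- (m / 2) * y)) x * dif h f x.

Lemma weight_bound {R : realType} (m x : R) : 0 <= m ->
  `|zext (fun y => expR (- m * y)) x| <= 1.
Proof.
move=> m0; rewrite /zext /ind; case: ifP => [/andP[x0 _]|_]; last by rewrite mul0r normr0.
rewrite mul1r ger0_norm ?expR_ge0 // -[leRHS]expR0 ler_expR.
by rewrite mulNr oppr_le0 mulr_ge0.
Qed.

Lemma measurable_weight {R : realType} (m : R) :
  measurable_fun setT (zext (fun y : R => expR (- m * y))).
Proof.
apply: L1R_measurable; apply/L1R_zext_continuous/continuous_subspaceT.
exact: continuous_exp_scale.
Qed.

Lemma L2R_dif {R : realType} (h : R) (f : R -> R) : L2R (zext f) -> L2R (dif h f).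
Proof. by move=> hf; apply: L2RB => //; exact: L2R_shift. Qed.

Lemma L2R_wdif {R : realType} (m h : R) (f : R -> R) : 0 <= m ->
  L2R (zext f) -> L2R (wdif m h f).
Proof.
move=> m0 hf; apply: (@L2R_mulb _ 1); first exact: measurable_weight.
  by move=> x; apply: weight_bound; rewrite divr_ge0.
exact: L2R_dif.
Qed.

(** [(a - b)^2 <= 2 a^2 + 2 b^2] and translation invariance; the constant does not depend on [h]. *)
Lemma wdif_norm {R : realType} (m h : R) (f : R -> R) : 0 <= m -> L2R (zext f) ->
  itg (fun x => wdif m h f x ^+ 2) <= 4 * itg (fun x => zext f x ^+ 2).
Proof.
move=> m0 hf; have [h1 e] := L1R_shift h hf.2.
have -> : 4 * itg (fun x => zext f x ^+ 2) =
    itg (fun x => 2 * zext f x ^+ 2 + 2 * zext f (x - h) ^+ 2).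
  rewrite itgD ?itgZ //; try exact: L1RZ; try by case: hf.
    by rewrite e; ring.
  by apply: L1RZ; case: hf.
apply: itg_le.
- by case: (L2R_wdif h m0 hf).
- by apply: L1RD; apply: L1RZ => //; case: hf.
move=> x; rewrite /wdif exprMn.
have m2 : 0 <= m / 2 by rewrite divr_ge0.
have := weight_bound x m2; set w := zext _ x => /ler_normlP [w1 w2].
have w3 : w ^+ 2 <= 1 by nra.
apply: (@le_trans _ _ (dif h f x ^+ 2)); first by rewrite ler_piMl ?sqr_ge0.
rewrite /dif; move: (zext f (x - h)) => b; move: (zext f x) => a.
by have := sqr_ge0 (a + b); nra.
Qed.

Lemma wdif_lin {R : realType} (m h c : R) (f g : R -> R) x :
  wdif m h (fun y => f y + c * g y) x = wdif m h f x + c * wdif m h g x.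
Proof. by rewrite /wdif /dif /zext; ring. Qed.

Lemma weight_sqr {R : realType} (m x : R) :
  zext (fun y => expR (- (m / 2) * y)) x ^+ 2 = zext (fun y => expR (- m * y)) x.
Proof.
rewrite /zext exprMn -expRM_natl (_ : ind _ ^+ 2 = ind (0 <= x <= 1)); last first.
  by rewrite /ind; case: ifP => _; rewrite ?expr1n ?expr0n.
by congr (_ * expR _); field.
Qed.

(** At [x = 0] this forces [f 0 = 0]: the inflow condition is built in. *)
Definition primitive01 {R : realType} (f g : R -> R) : Prop :=
  forall x, 0 <= x <= 1 -> f x = \int[@lebesgue_measure R]_(t in `[0, x]) g t.

(** Because [f 0 = 0], the zero extension has no jump at 0. The identity stops at 1, where it may
    jump; backward differences on [[0, 1]] do not look past that point. *)
Lemma zext_prim {R : realType} (f g : R -> R) x : primitive01 f g -> x <= 1 ->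
  zext f x = prim (zext g) x.
Proof.
move=> fg x1; have [x0|x0] := ltP x 0.
  rewrite prim_out_le // => [|y y0]; rewrite zext_out //; by rewrite negb_and -ltNge ?y0 ?x0.
rewrite zext_in ?x0 // fg ?x0 // Rintegral_mkcond; apply: eq_itg => y.
rewrite patchE (_ : (y \in `[0, x]%classic) = (0 <= y <= x)); last first.
  by apply/idP/idP; rewrite inE /= in_itv.
rewrite /zext /ind; have [yx|_] := boolP (y <= x); last by rewrite andbF mul0r.
by rewrite (le_trans yx x1) andbT mul1r; case: ifP => _; rewrite ?mul1r ?mul0r.
Qed.

Lemma dif_neg {R : realType} (h : R) (f : R -> R) x : 0 <= h -> x < 0 -> dif h f x = 0.
Proof.
move=> h0 x0; rewrite /dif !zext_out ?subr0 //; rewrite negb_and -ltNge ?x0 //.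
by rewrite (le_lt_trans _ x0) // gerBl.
Qed.

(** A translate of a primitive is the primitive of the translate. The cut-off of [dif h g] to
    [[0, 1]] removes, below [x], only negative points, where the difference vanishes. *)
Lemma dif_prim {R : realType} (h : R) (f g : R -> R) x : 0 <= h -> L2R (zext g) ->
  primitive01 f g -> 0 <= x <= 1 -> dif h f x = prim (zext (dif h g)) x.
Proof.
move=> h0 hg fg /andP[x0 x1].
have g1 := L1R_zext_bounded hg.
transitivity (prim (dif h g) x).
  rewrite /dif (zext_prim fg x1) (zext_prim fg); last by rewrite (le_trans _ x1) // gerBl.
  rewrite {2}/prim; have [_ <-] := L1R_shift h (L1R_prim (x - h) g1).
  rewrite -itgB; first by apply: eq_itg => y; rewrite lerD2r; ring.
  - exact: L1R_prim.
  - by case: (L1R_shift h (L1R_prim (x - h) g1)).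
apply: eq_itg => y; rewrite {1 2}/ind; case: ifP => yx; rewrite ?mul0r // !mul1r.
have [y0|y0] := ltP y 0; first by rewrite dif_neg // zext_out // negb_and -ltNge y0.
by rewrite zext_in // y0 (le_trans yx x1).
Qed.

(** [weighted_parts] applied to the derivative [dif h g] of [dif h f]; its weight [expR (- m * x)]
    is the square of the factor in [wdif]. *)
Lemma wdif_ibp {R : realType} (m h : R) (f g : R -> R) : 0 < m -> 0 <= h ->
  L2R (zext g) -> primitive01 f g ->
  m * itg (fun x => wdif m h f x ^+ 2) <= 2 * itg (fun x => wdif m h f x * wdif m h g x).
Proof.
move=> m0 h0 hg fg.
(* The cut-off is needed because [dif h g] may be nonzero up to [1 + h], while [weighted_parts]
   requires support in [[0, 1]]. *)
have dg : L2R (zext (dif h g)).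
  apply: (@L2R_mulb _ 1) => [|x|]; [|exact: ind_abs|exact: L2R_dif].
  apply: measurable_ind.
  apply: (@measurable_and _ _ setT (fun x : R => 0 <= x) (fun x => x <= 1)); exact: measurable_fun_ler.
have [_ [_ H]] := weighted_parts m0 (L1R_zext_bounded dg) (fun x => @zext_out _ _ x).
have E1 : (fun x => wdif m h f x ^+ 2) =1
    (fun x => zext (fun y => expR (- m * y)) x * prim (zext (dif h g)) x ^+ 2).
  move=> x; rewrite /wdif exprMn weight_sqr.
  have [x01|x01] := boolP (0 <= x <= 1); last by rewrite zext_out // !mul0r.
  by rewrite (dif_prim h0 hg fg).
have E2 : (fun x => wdif m h f x * wdif m h g x) =1
    (fun x => zext (fun y => expR (- m * y)) x * (prim (zext (dif h g)) x * zext (dif h g) x)).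
  move=> x; rewrite /wdif mulrACA -expr2 weight_sqr.
  have [x01|x01] := boolP (0 <= x <= 1); last by rewrite zext_out // !mul0r.
  by rewrite (dif_prim h0 hg fg) // [zext (dif h g) x]zext_in.
by rewrite (eq_itg E1) (eq_itg E2).
Qed.

Lemma L2R_ind {R : realType} (c : R -> bool) :
  L1R (fun t => ind (c t)) -> L2R (fun t => ind (c t) : R).
Proof.
move=> h; split; first exact: L1R_measurable.
by move: h; congr L1R; apply/funext => x; rewrite /ind; case: ifP => _; rewrite ?expr1n ?expr0n.
Qed.

Lemma ind_sqr {R : realType} b : (ind b : R) ^+ 2 = ind b.
Proof. by case: b; rewrite /ind ?expr1n ?expr0n. Qed.

Lemma itg_ind_CS {R : realType} (c : R -> bool) (u : R -> R) :
  L1R (fun t => ind (c t)) -> L2R u ->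
  itg (fun y => ind (c y) * u y) ^+ 2 <=
  itg (fun y => ind (c y)) * itg (fun y => ind (c y) * u y ^+ 2).
Proof.
move=> hc hu; have i2 := L2R_ind hc.
have h2 : L2R (fun y => ind (c y) * u y).
  by apply: (@L2R_mulb _ 1) => // [|x]; [exact: L1R_measurable|exact: ind_abs].
have := itg_CS i2 h2.
rewrite (@eq_itg _ (fun x => ind (c x) * (ind (c x) * u x)) (fun y => ind (c y) * u y)); last first.
  by move=> x; rewrite mulrA -expr2 ind_sqr.
rewrite (@eq_itg _ (fun x => ind (c x) ^+ 2) (fun y => ind (c y))); last by move=> x; rewrite ind_sqr.
rewrite (@eq_itg _ (fun x => (ind (c x) * u x) ^+ 2) (fun y => ind (c y) * u y ^+ 2)) //.
by move=> x; rewrite exprMn ind_sqr.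
Qed.

(** Cauchy-Schwarz on [[0, x]], of length at most 1. Through it the gradient controls the profile
    and its value at the outflow. *)
Lemma primitive01_sup {R : realType} (f g : R -> R) x : L2R (zext g) -> primitive01 f g ->
  0 <= x <= 1 -> f x ^+ 2 <= itg (fun y => zext g y ^+ 2).
Proof.
move=> hg fg x01; have /andP[x0 x1] := x01.
have i1 : L1R (fun t => ind (0 <= t <= x) : R).
  by apply: (@L1R_ind_itv _ true false 0 x) => t; rewrite in_itv.
have := itg_ind_CS i1 hg.
rewrite (@itg_ind_itv _ true false 0 x) => [|//|t]; last by rewrite in_itv.
rewrite subr0 => H.
have -> : f x = itg (fun y => ind (0 <= y <= x) * zext g y).
  rewrite -(zext_in f x01) (zext_prim fg x1); apply: eq_itg => y.
  rewrite /zext /ind; case: (boolP (0 <= y)) => //= _.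
  by rewrite !mul0r mulr0.
apply: (le_trans H); apply: (@le_trans _ _ (itg (fun y => ind (0 <= y <= x) * zext g y ^+ 2))).
  rewrite ler_piMl // itg_ge0 // => y; rewrite mulr_ge0 ?sqr_ge0 //.
  by case/andP: (@ind01 R (0 <= y <= x)).
have i2 := @L1R_mulb _ 1 _ _ (L1R_measurable i1) (fun y => ind_abs _) hg.2.
apply: itg_le => //; first by case: hg.
by move=> y; rewrite ler_piMl ?sqr_ge0 //; case/andP: (@ind01 R (0 <= y <= x)).
Qed.

(** The difference at [x] is the integral of [g] over [(x - h, x]]. Cauchy-Schwarz on this interval
    gives one factor [h], exchanging the integrals over the strip gives the other. *)
Lemma wdif_lip {R : realType} (m h : R) (f g : R -> R) : 0 <= m -> 0 < h ->
  L2R (zext g) -> L2R (zext f) -> primitive01 f g ->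
  itg (fun x => wdif m h f x ^+ 2) <= h ^+ 2 * itg (fun y => zext g y ^+ 2).
Proof.
move=> m0 h0 hg hf fg.
pose chi := fun p : R * R => (ind ((p.1 - h < p.2) && (p.2 <= p.1)) : R).
have mchi : measurable_fun setT chi.
  apply: measurable_ind.
  apply: (@measurable_and _ _ setT (fun p : R * R => p.1 - h < p.2) (fun p => p.2 <= p.1)).
    by apply: measurable_fun_ltr => //; apply: measurable_funB.
  exact: measurable_fun_ler.
have i01 : L1R (fun t => ind (0 <= t <= 1) : R).
  by apply: (@L1R_ind_itv _ true false 0 1) => t; rewrite in_itv.
have hF := (itg_fubini mchi (fun p => ind01 _) i01 hg.2).1.
have ichi x : L1R (fun y => chi (x, y)).
  by apply: (@L1R_ind_itv _ false false (x - h) x) => t; rewrite in_itv.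
apply: (@le_trans _ _ (itg (fun x => h * (ind (0 <= x <= 1) *
      itg (fun y => chi (x, y) * zext g y ^+ 2))))).
  apply: itg_le; [by case: (L2R_wdif h m0 hf)|exact: L1RZ|] => x.
  have [x01|x01] := boolP (0 <= x <= 1); last first.
    by rewrite /wdif zext_out // mul0r expr0n /ind mul0r mulr0.
  rewrite [ind true]/ind mul1r.
  have x1 : x <= 1 by case/andP: x01.
  have -> : wdif m h f x = zext (fun y => expR (- (m / 2) * y)) x *
       itg (fun y => chi (x, y) * zext g y).
    congr (_ * _); have g1 := L1R_zext_bounded hg.
    rewrite /dif (zext_prim fg x1) (zext_prim fg); last by rewrite (le_trans _ x1) // gerBl ltW.
    rewrite -itgB; [|exact: L1R_prim|exact: L1R_prim].
    apply: eq_itg => y; rewrite /chi /= /ind ltNge.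
    have [yx|yx] := boolP (y <= x); last first.
      by rewrite andbF (_ : (y <= x - h) = false); [ring|apply/negbTE; move: yx; rewrite -!ltNge; lra].
    by rewrite andbT; case: (y <= x - h) => /=; ring.
  rewrite exprMn.
  have m2 : 0 <= m / 2 by rewrite divr_ge0.
  have := weight_bound x m2; set w := zext _ x => /ler_normlP [w1 w2].
  have w3 : w ^+ 2 <= 1 by nra.
  apply: (@le_trans _ _ (itg (fun y => chi (x, y) * zext g y) ^+ 2)).
    by rewrite ler_piMl ?sqr_ge0.
  have := itg_ind_CS (ichi x) hg.
  rewrite (@itg_ind_itv _ false false (x - h) x) => [|//|t]; last by rewrite in_itv.
    by rewrite opprB addrC subrK.
  by rewrite gerBl ltW.
rewrite (itgZ _ hF) (itg_fubini mchi (fun p => ind01 _) i01 hg.2).2.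
rewrite expr2 -mulrA (ler_wpM2l (ltW h0)) //.
have [hF2 _] := itg_fubini (chi := fun p => chi (p.2, p.1)) (measurableT_comp mchi (@measurable_swap _ _ _ _))
   (fun p => ind01 _) hg.2 i01.
rewrite -itgZ //; last by case: hg.
apply: itg_le => //; first by apply: L1RZ; case: hg.
(* For fixed [y] the strip leaves an interval of length [h] for [x]: this is the second factor
   [h]. *)
move=> y; rewrite [leRHS]mulrC ler_wpM2l ?sqr_ge0 //.
have iy : L1R (fun x => ind ((y <= x) && (x < y + h)) : R).
  by apply: (@L1R_ind_itv _ true true y (y + h)) => t; rewrite in_itv.
have mx : measurable_fun setT (fun x => chi (x, y)) by exact: measurable_pair_sect2.
apply: (@le_trans _ _ (itg (fun x => ind ((y <= x) && (x < y + h)) : R))).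
  apply: itg_le => //.
    by apply: (@L1R_mulb _ 1) => // x; exact: ind_abs.
  move=> x; rewrite /chi /= ltrBlDr andbC.
  by rewrite ler_piMr //; [case/andP: (@ind01 R ((y <= x) && (x < y + h)))|
                           case/andP: (@ind01 R (0 <= x <= 1))].
rewrite (@itg_ind_itv _ true true y (y + h)) => [||t]; last by rewrite in_itv.
  by rewrite addrC addKr.
by rewrite lerDl ltW.
Qed.

Lemma weight_sqr_ge {R : realType} (m x : R) : 0 <= m -> 0 <= x <= 1 ->
  1 <= expR m * zext (fun y => expR (- (m / 2) * y)) x ^+ 2.
Proof.
move=> m0 /andP[x0 x1]; rewrite weight_sqr zext_in ?x0 // -expRD -[leLHS]expR0 ler_expR.
by rewrite mulNr subr_ge0 ler_piMr.
Qed.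

(** Lebesgue differentiation of the primitive, sampled along the steps [1 / (n + 1)]. *)
Lemma ae_quotient_cvg {R : realType} (f g : R -> R) : L1R (zext g) -> primitive01 f g ->
  {ae @lebesgue_measure R, forall x, x <= 1 ->
    (fun n : nat => dif n.+1%:R^-1 f x / n.+1%:R^-1) @ \oo --> zext g x}.
Proof.
move=> g1 fg.
have loc : locally_integrable [set: R] (zext g).
  have := @integrable_locally R (zext g) setT measurableT g1.
  by congr locally_integrable; apply/funext => x; rewrite patchE mem_set.
have i1 y : (@lebesgue_measure R).-integrable `]-oo, y] (EFin \o zext g) by exact: integrableS g1.
have PE : (fun y => \int[@lebesgue_measure R]_(t in `]-oo, y]) zext g t) = prim (zext g).
  by apply/funext => y; rewrite prim_itv.
have := FTC1Ny i1 loc; rewrite /= PE.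
apply: filterS; first exact: (ae_filter_ringOfSetsType (@lebesgue_measure R)).
move=> x /= [] D; rewrite derive1E => E x1.
have C : h^-1 *: (prim (zext g) (h *: 1 + x) - prim (zext g) x) @[h --> 0^'] --> zext g x.
  by rewrite -E; exact: D.
apply/cvgrPdist_le => e e0.
have := C => /cvgrPdist_le /(_ e e0).
rewrite /prop_near1 /dnbhs /within /= => /nbhs_ballP [d /= d0 H].
have := near_infty_natSinv_lt (PosNum d0); apply: filterS => n /= nd.
have n0 : (0 : R) < n.+1%:R^-1 by rewrite invr_gt0.
set k := n.+1%:R^-1 in nd n0 *.
(* The backward quotient is the difference quotient at the negative increment [- k]. *)
have := H (- k); rewrite /ball /= sub0r opprK gtr0_norm // oppr_eq0 gt_eqF // => /(_ nd isT).
rewrite /dif (zext_prim fg x1) (zext_prim fg); last by rewrite (le_trans _ x1) // gerBl ltW.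
rewrite [(- k)%:A]mulr1 /GRing.scale /= (addrC (- k)).
set a := prim _ _; set b := prim _ _.
by rewrite (_ : (- k)^-1 * (a - b) = (b - a) / k) //; field; rewrite lt0r_neq0.
Qed.

(** The weighted quotients converge almost everywhere to the weighted gradient, and Fatou's lemma
    keeps the bound [K]. The factor [expR m] then removes the weight, at least [expR (- m)] on
    [[0, 1]]. *)
Lemma wdif_fatou {R : realType} (m K : R) (f g : R -> R) : 0 <= m ->
  L2R (zext g) -> L2R (zext f) -> primitive01 f g ->
  (forall h, 0 < h -> itg (fun x => wdif m h f x ^+ 2) <= h ^+ 2 * K) ->
  itg (fun x => zext g x ^+ 2) <= expR m * K.
Proof.
move=> m0 hg hf fg HK.
have m2 : 0 <= m / 2 by rewrite divr_ge0.
pose w := zext (fun y : R => expR (- (m / 2) * y)).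
have mw : measurable_fun setT w by exact: measurable_weight.
have hwg : L2R (fun x => w x * zext g x).
  by apply: (@L2R_mulb _ 1) => // x; exact: weight_bound.
pose q n : R := n.+1%:R^-1.
have q0 n : 0 < q n by rewrite invr_gt0.
pose v n x := (((q n)^-1 * wdif m (q n) f x) ^+ 2)%:E.
have hv n : L2R (fun x => (q n)^-1 * wdif m (q n) f x) by exact/L2RZ/L2R_wdif.
have mv n : measurable_fun setT (v n) by apply/measurable_EFinP; exact: L1R_measurable (hv n).2.
have v0 n x : setT x -> (0 <= v n x)%E by rewrite lee_fin sqr_ge0.
have F := fatou (@lebesgue_measure R) measurableT mv v0.
have LK : (limn_einf (fun n => \int[@lebesgue_measure R]_x v n x) <= K%:E)%E.
  rewrite limn_einf_lim; apply: lime_le; first exact: is_cvg_einfs.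
  apply: nearW => n; apply: (@le_trans _ _ (\int[@lebesgue_measure R]_x v n x)%E).
    by apply: ereal_inf_lbound; exists n => /=.
  rewrite /v EFin_itg; last exact: (hv n).2.
  rewrite lee_fin.
  rewrite (@eq_itg _ _ (fun x => (q n) ^- 2 * wdif m (q n) f x ^+ 2)); last first.
    by move=> x; rewrite exprMn exprVn.
  rewrite itgZ; last by case: (L2R_wdif (q n) m0 hf).
  by rewrite mulrC ler_pdivrMr ?exprn_gt0 // mulrC HK.
have AE : ae_eq (@lebesgue_measure R) setT (fun x => ((w x * zext g x) ^+ 2)%:E) (fun x => limn_einf (v^~ x)).
  have := ae_quotient_cvg (L1R_zext_bounded hg) fg.
  apply: filterS; first exact: (ae_filter_ringOfSetsType (@lebesgue_measure R)).
  move=> x /= H _.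
  (* Outside [[0, 1]] both sides vanish with the weight; the convergence of the quotients is
     asserted only up to 1. *)
  have [x01|x01] := boolP (0 <= x <= 1); last first.
    have -> : v^~ x = (fun=> 0%E).
      apply/funext => n; rewrite /v /wdif zext_out // mul0r mulr0 expr0n //.
    rewrite (cvg_limn_einf_sup (cvg_cst _)).1 /w zext_out // mul0r expr0n //.
  have {}H := H (proj2 (andP x01)).
  apply/esym; apply: (cvg_limn_einf_sup _).1; apply: cvg_EFin; first by apply: nearW.
  have -> : fine \o v^~ x = (fun n => (w x * (dif (q n) f x / q n)) ^+ 2).
    by apply/funext => n; rewrite /v /wdif /= -/w; congr (_ ^+ 2); ring.
  have c1 : (fun n => w x * (dif (q n) f x / q n)) @ \oo --> w x * zext g x by apply: cvgMr.
  exact: (cvgM c1 c1).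
have wK : itg (fun x => (w x * zext g x) ^+ 2) <= K.
  rewrite -lee_fin -EFin_itg; last by case: hwg.
  apply: le_trans _ LK; apply: le_trans _ F.
  rewrite le_eqVlt; apply/orP; left; apply/eqP.
  apply: ae_eq_integral => //.
  - by apply/measurable_EFinP; apply: L1R_measurable; case: hwg.
  (* Measurability of the lower limit is read off the upper limit of the negatives. *)
  - rewrite (_ : (fun x => _) = (fun x => - limn_esup (-%E \o v^~ x))%E).
      have mN n : measurable_fun setT (fun x => - v n x)%E by apply: measurableT_comp.
      apply: measurableT_comp => //.
      exact: (@measurable_fun_limn_esup _ _ _ _ (fun n x => - v n x)%E).
    apply/funext => x; rewrite -limn_einfN; congr limn_einf.
    by apply/funext => n; rewrite /comp oppeK.
apply: (@le_trans _ _ (expR m * itg (fun x => (w x * zext g x) ^+ 2))); last first.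
  by rewrite ler_pM2l // expR_gt0.
rewrite -itgZ; last by case: hwg.
apply: itg_le; first by case: hg.
  by apply: L1RZ; case: hwg.
move=> x; have [x01|x01] := boolP (0 <= x <= 1); last by rewrite zext_out // mulr0 expr0n mulr0.
by rewrite [(w x * _) ^+ 2]exprMn mulrA ler_peMl ?sqr_ge0 //; exact: weight_sqr_ge.
Qed.

(** * Transport equations *)

Definition bil {R : realType} (m h : R) (f g : R -> R) : R :=
  itg (fun x => wdif m h f x * wdif m h g x).

Lemma bil_sqr {R : realType} (m h : R) (f : R -> R) :
  bil m h f f = itg (fun x => wdif m h f x ^+ 2).
Proof. by apply: eq_itg => x; rewrite expr2. Qed.

Lemma bil_ge0 {R : realType} (m h : R) (f : R -> R) : 0 <= bil m h f f.
Proof. by rewrite bil_sqr; apply: itg_ge0 => x; exact: sqr_ge0. Qed.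

Lemma bilC {R : realType} (m h : R) (f g : R -> R) : bil m h f g = bil m h g f.
Proof. by apply: eq_itg => x; rewrite mulrC. Qed.

Lemma zext_lin {R : realType} (f g : R -> R) c :
  zext (fun y => f y + c * g y) = (fun x => zext f x + c * zext g x).
Proof. by apply/funext => x; rewrite /zext; ring. Qed.

Lemma L2R_zext_lin {R : realType} (f g : R -> R) c : L2R (zext f) -> L2R (zext g) ->
  L2R (zext (fun y => f y + c * g y)).
Proof. by move=> hf hg; rewrite zext_lin; apply: L2RD => //; exact: L2RZ. Qed.

Lemma L2R_zext0 {R : realType} : L2R (zext (fun=> 0 : R)).
Proof.
have -> : zext (fun=> 0 : R) = (fun=> 0) by apply/funext => x; rewrite /zext mulr0.
split => //; rewrite expr0n; exact: L1R0.
Qed.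

Lemma L2R_zext_sum {R : realType} (I : Type) (r : seq I) (c : I -> R) (g : I -> R -> R) :
  (forall i, L2R (zext (g i))) -> L2R (zext (fun y => \sum_(i <- r) c i * g i y)).
Proof.
move=> hg; elim: r => [|i r IH].
  by under [X in zext X]eq_fun do rewrite big_nil; exact: L2R_zext0.
under [X in zext X]eq_fun do rewrite big_cons addrC.
exact: L2R_zext_lin.
Qed.

Lemma bil_lin {R : realType} (m h c : R) (f g k : R -> R) : 0 <= m ->
  L2R (zext f) -> L2R (zext g) -> L2R (zext k) ->
  bil m h f (fun y => g y + c * k y) = bil m h f g + c * bil m h f k.
Proof.
move=> m0 hf hg hk.
have Sf := L2R_wdif h m0 hf; have Sg := L2R_wdif h m0 hg; have Sk := L2R_wdif h m0 hk.
have fk := L2R_mul Sf Sk; have fg := L2R_mul Sf Sg.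
rewrite /bil -(itgZ _ fk) -(itgD fg (L1RZ c fk)).
by apply: eq_itg => x; rewrite wdif_lin; ring.
Qed.

Lemma bil0r {R : realType} (m h : R) (f : R -> R) : bil m h f (fun=> 0) = 0.
Proof.
rewrite -[RHS](@itg0 R); apply: eq_itg => x.
by rewrite [X in _ * X](_ : _ = 0) ?mulr0 // /wdif /dif /zext; ring.
Qed.

Lemma bil_CS {R : realType} (m h : R) (f g : R -> R) : 0 <= m ->
  L2R (zext f) -> L2R (zext g) -> bil m h f g ^+ 2 <= bil m h f f * bil m h g g.
Proof. by move=> m0 hf hg; rewrite !bil_sqr; apply: itg_CS; exact: L2R_wdif. Qed.

Lemma bil_norm {R : realType} (m h : R) (f : R -> R) : 0 <= m -> L2R (zext f) ->
  bil m h f f <= 4 * itg (fun x => zext f x ^+ 2).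
Proof. by move=> m0 hf; rewrite bil_sqr; exact: wdif_norm. Qed.

Lemma bil_quad {R : realType} (m h c : R) (g k : R -> R) : 0 <= m ->
  L2R (zext g) -> L2R (zext k) ->
  bil m h (fun y => g y + c * k y) (fun y => g y + c * k y) =
  bil m h g g + 2 * c * bil m h g k + c ^+ 2 * bil m h k k.
Proof.
move=> m0 hg hk.
have E f : L2R (zext f) -> bil m h (fun y => g y + c * k y) f = bil m h g f + c * bil m h k f.
  by move=> hf; rewrite bilC (bil_lin h c m0 hf hg hk) (bilC _ _ f g) (bilC _ _ f k).
rewrite (bil_lin h c m0 (L2R_zext_lin c hg hk) hg hk) (E _ hg) (E _ hk) (bilC _ _ k g).
by move: (bil _ _ g g) (bil _ _ g k) (bil _ _ k k) => a b d; ring.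
Qed.

(** This is how an equation that holds only almost everywhere can be tested against [f]. *)
Lemma bil_null {R : realType} (m h : R) (f r : R -> R) : 0 <= m ->
  L2R (zext f) -> L2R (zext r) -> itg (fun x => zext r x ^+ 2) = 0 -> bil m h f r = 0.
Proof.
move=> m0 hf hr r0.
have := bil_norm h m0 hr; rewrite r0 mulr0 => s0.
have b0 : bil m h r r = 0 by apply/eqP; rewrite eq_le s0 bil_ge0.
have := bil_CS h m0 hf hr; rewrite b0 mulr0 => c0.
by apply/eqP; rewrite -sqrf_eq0 eq_le sqr_ge0 c0.
Qed.

Lemma bil_amgm {R : realType} (m h c : R) (f g : R -> R) : 0 <= m ->
  L2R (zext f) -> L2R (zext g) ->
  2 * (c * bil m h f g) <= bil m h f f + c ^+ 2 * bil m h g g.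
Proof.
move=> m0 hf hg; have := bil_ge0 m h (fun y => f y + (- c) * g y).
by rewrite (bil_quad h (- c) m0 hf hg) sqrrN; lra.
Qed.

Opaque bil.

Lemma bil_sum {R : realType} (m h : R) (I : Type) (r : seq I) (f : R -> R)
    (c : I -> R) (g : I -> R -> R) : 0 <= m ->
  L2R (zext f) -> (forall i, L2R (zext (g i))) ->
  bil m h f (fun y => \sum_(i <- r) c i * g i y) = \sum_(i <- r) c i * bil m h f (g i).
Proof.
move=> m0 hf hg; elim: r => [|i r IH].
  by rewrite big_nil; under [X in bil _ _ _ X]eq_fun do rewrite big_nil; exact: bil0r.
rewrite big_cons; under [X in bil _ _ _ X]eq_fun do rewrite big_cons addrC.
by rewrite (bil_lin h (c i) m0 hf (L2R_zext_sum _ _ hg) (hg i)) IH addrC.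
Qed.

Lemma normr_le_of_sqr {R : realType} (x y : R) : 0 <= y -> x ^+ 2 <= y ^+ 2 -> `|x| <= y.
Proof. by move=> y0; rewrite -(real_normK (num_real x)) ler_sqr ?nnegrE. Qed.

(** Write [u s] as its tangent [p] at [t] plus a remainder [r], small in [L^2]. The energy of [p] is
    an explicit quadratic in [s - t], and Cauchy-Schwarz handles the terms with [r]. *)
Lemma hderiv_bil {R : realType} (m h : R) (u u' : R -> R -> R) t : 0 <= m -> 0 <= t ->
  (forall s, 0 <= s -> L2R (zext (u s))) -> L2R (zext (u' t)) ->
  (forall e : R, 0 < e -> exists2 d : R, 0 < d & forall s : R, 0 <= s -> `|s - t| < d ->
    itg (fun x => zext (fun y => u s y - u t y - (s - t) * u' t y) x ^+ 2)
      <= (e * `|s - t|) ^+ 2) ->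
  hderiv (fun s => bil m h (u s) (u s)) t (2 * bil m h (u t) (u' t)).
Proof.
move=> m0 t0 hu hu' H e e0.
set A := bil m h (u' t) (u' t); set E := bil m h (u t) (u t); set B := bil m h (u t) (u' t).
have A0 : 0 <= A by exact: bil_ge0.
have E0 : 0 <= E by exact: bil_ge0.
(* [C] bounds the energy of the tangent for [|s - t| <= 1]. With [ep] and the radius below, each of
   the three error terms is at most [e / 4 * |s - t|]. *)
pose C := 2 * E + 2 * A + 1.
have C1 : 1 <= C by rewrite /C; lra.
have C0 : 0 < C by lra.
pose ep := Num.min 1 (e / (16 * C)).
have eC : 0 < e / (16 * C) by rewrite divr_gt0 // mulr_gt0.
have ep0 : 0 < ep by rewrite lt_min ltr01.
have ep1 : ep <= 1 by rewrite ge_min lexx.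
have epC : 16 * (C * ep) <= e.
  have : ep <= e / (16 * C) by rewrite ge_min lexx orbT.
  by rewrite ler_pdivlMr ?mulr_gt0 //; lra.
have [d d0 {}H] := H ep ep0.
have eA : 0 < e / (4 * (A + 1)) by rewrite divr_gt0 // mulr_gt0 //; lra.
exists (Num.min d (Num.min 1 (e / (4 * (A + 1))))); first by rewrite !lt_min d0 ltr01.
move=> s s0; rewrite !lt_min => /andP[sd /andP[s1 sA]].
have {}H := H s s0 sd.
set r := (fun y => u s y - u t y - (s - t) * u' t y) in H.
have hs := hu s s0; have ht := hu t t0.
have hr : L2R (zext r).
  have := L2R_zext_lin (- (s - t)) (L2R_zext_lin (-1) hs ht) hu'.
  by congr L2R; congr zext; apply/funext => y; rewrite /r; ring.
pose p := fun y => u t y + (s - t) * u' t y.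
have hp : L2R (zext p) by exact: L2R_zext_lin.
have Es : bil m h (u s) (u s) = bil m h p p + 2 * bil m h p r + bil m h r r.
  have -> : u s = (fun y => p y + 1 * r y).
    by apply/funext => y; rewrite /p /r; ring.
  by rewrite (bil_quad h 1 m0 hp hr) expr1n mulr1 mul1r.
have Ep : bil m h p p = E + 2 * (s - t) * B + (s - t) ^+ 2 * A by exact: bil_quad.
set x := `|s - t| in H sd s1 sA *.
have x0 : 0 <= x by exact: normr_ge0.
have xx : (s - t) ^+ 2 = x ^+ 2 by rewrite /x real_normK ?num_real.
have rr : bil m h r r <= 4 * (ep * x) ^+ 2.
  by apply: le_trans (bil_norm h m0 hr) _; rewrite ler_pM2l.
have pp : bil m h p p <= C.
  have := bil_amgm h (- (s - t)) m0 ht hu'; rewrite sqrrN xx -/E -/A -/B => h1.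
  have x21 : x ^+ 2 <= 1 by rewrite expr_le1 // ltW.
  have x2A : x ^+ 2 * A <= A by rewrite ler_piMl.
  have h2 := bil_amgm h (s - t) m0 ht hu'; move: h2; rewrite xx -/E -/A -/B => h2.
  by rewrite Ep xx /C; lra.
have pr : `|bil m h p r| <= C * (2 * ep * x).
  apply: normr_le_of_sqr; first by rewrite !mulr_ge0 // ltW.
  apply: (le_trans (bil_CS h m0 hp hr)).
  have y0 : 0 <= (ep * x) ^+ 2 by exact: sqr_ge0.
  apply: (@le_trans _ _ (C * (4 * (ep * x) ^+ 2))).
    by apply: ler_pM => //; exact: bil_ge0.
  have -> : (C * (2 * ep * x)) ^+ 2 = C * (C * (4 * (ep * x) ^+ 2)) by ring.
  rewrite ler_pM2l // ler_peMl // mulr_ge0 //.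
rewrite Es Ep -/E -/B xx.
rewrite (_ : _ - _ - _ = x ^+ 2 * A + 2 * bil m h p r + bil m h r r); last by ring.
apply: (le_trans (ler_normD _ _)); apply: (le_trans (lerD (ler_normD _ _) (lexx _))).
rewrite (ger0_norm (bil_ge0 _ _ _)) ger0_norm ?mulr_ge0 ?sqr_ge0 // normrM ger0_norm //.
have t1 : x ^+ 2 * A <= e / 4 * x.
  rewrite expr2 -mulrA mulrC ler_wpM2r //.
  move: sA; rewrite ltr_pdivlMr ?mulr_gt0 //; last by lra.
  by move: x0 A0; nra.
have t2 : 2 * `|bil m h p r| <= e / 4 * x.
  apply: (@le_trans _ _ (2 * (C * (2 * ep * x)))); first by rewrite ler_pM2l.
  have -> : 2 * (C * (2 * ep * x)) = 4 * (C * ep) * x by ring.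
  by rewrite ler_wpM2r //; lra.
have t3 : bil m h r r <= e / 4 * x.
  apply: (le_trans rr); rewrite (_ : 4 * (ep * x) ^+ 2 = 4 * ep * (ep * x) * x); last by ring.
  rewrite ler_wpM2r //.
  have : 4 * ep * (ep * x) <= 4 * ep.
    by rewrite ler_piMr ?mulr_ge0 ?ltW //; nra.
  have : ep <= C * ep by rewrite ler_peMl // ltW.
  lra.
have ex0 : 0 <= e * x by rewrite mulr_ge0 // ltW.
lra.
Qed.

Lemma primitive01_weight_decay {R : realType} (m h : R) (f g : R -> R) : 0 < m -> 0 <= h ->
  L2R (zext g) -> primitive01 f g -> m * bil m h f f <= 2 * bil m h f g.
Proof. by move=> m0 h0 hg fg; rewrite bil_sqr; exact: wdif_ibp. Qed.

Lemma bil_lip {R : realType} (m h : R) (f g : R -> R) : 0 <= m -> 0 < h ->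
  L2R (zext g) -> L2R (zext f) -> primitive01 f g ->
  bil m h f f <= h ^+ 2 * itg (fun y => zext g y ^+ 2).
Proof. by move=> *; rewrite bil_sqr; exact: wdif_lip. Qed.

Lemma itg_ae0 {R : realType} (r : R -> R) : L2R r ->
  {ae @lebesgue_measure R, forall x, r x = 0} -> itg (fun x => r x ^+ 2) = 0.
Proof.
move=> hr r0; rewrite -[RHS](@itg0 R) /itg /Rintegral; congr fine.
apply: ae_eq_integral => //.
  by apply/measurable_EFinP; apply: L1R_measurable; case: hr.
move: r0; apply: filterS; first exact: (ae_filter_ringOfSetsType (@lebesgue_measure R)).
by move=> x -> _; rewrite expr0n.
Qed.

(** Testing the equation against [z i]: the transport term supplies a damping proportional to [m],
    while [2 a b <= a^2 + b^2] splits the coupling and the source. [M] and [N] do not depend on [x],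
    hence pass through the differences. *)
Lemma bil_transport {R : realType} (n : nat) (m h lam mM bN : R) (i : 'I_n)
    (z : 'I_n -> R -> R) (zt zx : R -> R) (y : 'I_n -> R -> R) (M N : 'I_n -> R) :
  0 < m -> 0 < h ->
  (forall j, L2R (zext (z j))) -> L2R (zext zt) -> L2R (zext zx) ->
  (forall j, L2R (zext (y j))) -> primitive01 (z i) zx -> 0 <= lam ->
  {ae @lebesgue_measure R, forall x, 0 <= x <= 1 ->
     zt x + lam * zx x = \sum_j M j * z j x + \sum_j N j * y j x} ->
  (forall j, `|M j| <= mM) -> (forall j, N j ^+ 2 <= bN) ->
  2 * bil m h (z i) zt <= - (lam * m) * bil m h (z i) (z i)
    + \sum_j mM * (bil m h (z i) (z i) + bil m h (z j) (z j))
    + \sum_j (bil m h (z i) (z i) + bN * bil m h (y j) (y j)).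
Proof.
move=> m0 h0 hz hzt hzx hy zp lam0 pde hM hN; have m0' := ltW m0.
have hsz := L2R_zext_sum (index_enum 'I_n) M hz.
have hsy := L2R_zext_sum (index_enum 'I_n) N hy.
pose a := fun x => zt x + lam * zx x.
pose b := fun x => \sum_j M j * z j x + 1 * \sum_j N j * y j x.
have ha : L2R (zext a) by exact: L2R_zext_lin.
have hb : L2R (zext b) by exact: L2R_zext_lin.
have hab : L2R (zext (fun x => a x + (-1) * b x)) by exact: L2R_zext_lin.
have r0 : itg (fun x => zext (fun x => a x + (-1) * b x) x ^+ 2) = 0.
  apply: itg_ae0 => //; move: pde; apply: filterS.
    exact: (ae_filter_ringOfSetsType (@lebesgue_measure R)).
  move=> x H; have [x01|x01] := boolP (0 <= x <= 1); last by rewrite zext_out.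
  by rewrite zext_in // /a /b (H x01); ring.
have := bil_null h m0' (hz i) hab r0.
rewrite (bil_lin h (-1) m0' (hz i) ha hb) (bil_lin h lam m0' (hz i) hzt hzx).
rewrite (bil_lin h 1 m0' (hz i) hsz hsy) !(bil_sum h _ _ m0' (hz i)) // => E.
have {E} -> : bil m h (z i) zt = - (lam * bil m h (z i) zx)
   + \sum_j M j * bil m h (z i) (z j) + \sum_j N j * bil m h (z i) (y j).
  by move: E; set s1 := \sum_j _; set s2 := \sum_j _; move=> E; lra.
rewrite !mulrDr !mulr_sumr; apply: lerD; first apply: lerD.
(* The transport term, by weighted integration by parts; the outflow boundary contributes with the
   favourable sign. *)
- rewrite !mulrN mulNr lerN2 -mulrA [2 * _]mulrCA; apply: ler_wpM2l => //.
  exact: primitive01_weight_decay (ltW h0) hzx zp.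
- apply: ler_sum => j _.
  have h1 := bil_amgm h 1 m0' (hz i) (hz j); have h2 := bil_amgm h (-1) m0' (hz i) (hz j).
  move: h1 h2 (hM j); rewrite ler_norml sqrrN expr1n !mul1r mulN1r.
  have := bil_ge0 m h (z i); have := bil_ge0 m h (z j).
  set p := bil _ _ _ _; set q := bil _ _ _ _; set b' := bil _ _ _ _.
  move=> p0 q0 h1 h2 /andP[M1 M2].
  have hb' : `|b'| * 2 <= q + p by case: (ler0P b') => _; lra.
  have hM' : `|M j| <= mM by exact: hM.
  apply: (@le_trans _ _ (2 * (`|M j| * `|b'|))).
    by rewrite ler_pM2l // -normrM ler_norm.
  apply: (@le_trans _ _ (`|M j| * (q + p))).
    by rewrite mulrCA ler_wpM2l // mulrC.
  by rewrite ler_wpM2r // addr_ge0.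
- apply: ler_sum => j _.
  apply: (le_trans (bil_amgm h (N j) m0' (hz i) (hy j))).
  by rewrite lerD2l ler_wpM2r ?bil_ge0.
Qed.

(** Zero extension turns [z] and [y], which vanish at the inflow boundary, into solutions on the
    whole of (-oo, 1], so their differences solve the same equation. Letting [h] tend to 0 bounds
    the gradient without differentiating the coefficients [M], [N] in time. *)
Lemma transport_gradient_bound {R : realType} (n : nat)
    (z zt zx : 'I_n -> R -> R -> R) (y yx : 'I_n -> R -> R -> R)
    (M N : 'I_n -> 'I_n -> R -> R) (lam : 'I_n -> R) (lam0 mM B k Y : R) :
  0 < lam0 -> (forall i, lam0 <= lam i) -> 0 <= mM -> 0 <= B -> 0 <= k ->
  (forall i t, 0 <= t -> L2R (zext (z i t)) /\ L2R (zext (zt i t)) /\ L2R (zext (zx i t))) ->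
  (forall i t, 0 <= t -> L2R (zext (y i t)) /\ L2R (zext (yx i t))) ->
  (forall i t, 0 <= t -> primitive01 (z i t) (zx i t) /\ primitive01 (y i t) (yx i t)) ->
  (forall i t, 0 <= t -> itg (fun x => zext (yx i t) x ^+ 2) <= Y) ->
  (forall i t, 0 <= t -> forall e : R, 0 < e -> exists2 d : R, 0 < d &
    forall s : R, 0 <= s -> `|s - t| < d ->
    itg (fun x => zext (fun w => z i s w - z i t w - (s - t) * zt i t w) x ^+ 2)
      <= (e * `|s - t|) ^+ 2) ->
  (forall t, 0 < t -> forall i, {ae @lebesgue_measure R, forall x, 0 <= x <= 1 ->
     zt i t x + lam i * zx i t x = \sum_j M i j t * z j t x + \sum_j N i j t * y j t x}) ->
  (forall i j t, 0 <= t -> `|M i j t| <= mM) ->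
  (forall i j t, 0 <= t -> N i j t ^+ 2 <= B * expR (- k * t)) ->
  exists2 K, 0 <= K & forall i t, 0 <= t ->
    itg (fun x => zext (zx i t) x ^+ 2) <= K * expR (- k * t).
Proof.
move=> lam0_gt0 lamge mM0 B0 k0 hz hy hp hY hd pde hM hN.
have n0 : 0 <= n%:R :> R by [].
(* After summation over [i], the coupling costs [2 * n * mM] times the energy and the source [n]
   times. What remains of [lam0 * m] is a damping [k + 1], above the rate [k] of the source. *)
have [m m0 lm] : exists2 m : R, 0 < m & lam0 * m = 2 * n%:R * mM + n%:R + k + 1.
  exists ((2 * n%:R * mM + n%:R + k + 1) / lam0).
    by rewrite divr_gt0 // ltr_pwDr // !addr_ge0 //; rewrite !mulr_ge0.
  by rewrite mulrCA mulfV ?mulr1 // lt0r_neq0.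
have m0' := ltW m0.
pose E h t := \sum_i bil m h (z i t) (z i t).
pose dE h t := \sum_i (2 * bil m h (z i t) (zt i t)).
have Y0 (i : 'I_n) : 0 <= Y.
  by apply: le_trans (hY i 0 (lexx 0)); apply: itg_ge0 => x; exact: sqr_ge0.
(* [G] is the initial gradient energy and [W] bounds the source. Both enter multiplied by [h ^+ 2],
   by the bound on differences of primitives. *)
pose G := \sum_i itg (fun x => zext (zx i 0) x ^+ 2).
have G0 : 0 <= G by apply: sumr_ge0 => i _; apply: itg_ge0 => x; exact: sqr_ge0.
pose W := \sum_(i < n) \sum_(j < n) (B * Y).
have W0 : 0 <= W.
  by apply: sumr_ge0 => i _; apply: sumr_ge0 => j _; rewrite mulr_ge0 // (Y0 i).
have main h : 0 < h -> forall t, 0 <= t -> E h t <= h ^+ 2 * ((G + W) * expR (- k * t)).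
  move=> h0 t t0.
  have De s : 0 <= s -> hderiv (E h) s (dE h s).
    move=> s0; apply: hderiv_sum => i; apply: hderiv_bil => // [r r0||].
    - by case: (hz i r r0).
    - by case: (hz i s s0) => _ [].
    - exact: hd.
  have h2 : 0 <= h ^+ 2 by exact: sqr_ge0.
  have Db s : 0 < s -> dE h s <= - (k + 1) * E h s + h ^+ 2 * W * expR (- k * s).
    move=> s0; have s0' := ltW s0.
    have step (i : 'I_n) : 2 * bil m h (z i s) (zt i s) <=
       - (lam0 * m) * bil m h (z i s) (z i s)
       + \sum_(j < n) mM * (bil m h (z i s) (z i s) + bil m h (z j s) (z j s))
       + \sum_(j < n) (bil m h (z i s) (z i s) + B * expR (- k * s) * (h ^+ 2 * Y)).
      have hi := hz i s s0'.
      apply: (le_trans (@bil_transport _ n m h (lam i) mM (B * expR (- k * s)) i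
        (fun j => z j s) _ (zx i s) (fun j => y j s) (fun j => M i j s) (fun j => N i j s)
        m0 h0 _ hi.2.1 hi.2.2 _ _ _ _ _ _)).
      - by move=> j; case: (hz j s s0').
      - by move=> j; case: (hy j s s0').
      - by case: (hp i s s0').
      - exact: le_trans (ltW lam0_gt0) (lamge i).
      - exact: pde.
      - by move=> j; exact: hM.
      - by move=> j; exact: hN.
      apply: lerD; first apply: lerD => //.
        have mb : 0 <= m * bil m h (z i s) (z i s) by apply: mulr_ge0 => //; exact: bil_ge0.
        by rewrite !mulNr lerN2 -(mulrA (lam i)) -(mulrA lam0); exact: (ler_wpM2r mb (lamge i)).
      apply: ler_sum => j _; rewrite lerD2l; apply: ler_wpM2l.
        by rewrite mulr_ge0 ?expR_ge0.
      have [hy1 hy2] := hy j s s0'; have [_ py] := hp j s s0'.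
      by apply: le_trans (bil_lip m0' h0 hy2 hy1 py) _; rewrite ler_wpM2l // hY.
    apply: (le_trans (ler_sum _ (fun i _ => step i))).
    rewrite !big_split /= -mulr_sumr -/(E h s).
    under [X in _ + X + _ <= _]eq_bigr do rewrite -mulr_sumr big_split /= sumr_const card_ord -/(E h s).
    rewrite -mulr_sumr big_split /= sumrMnl sumr_const card_ord -/(E h s).
    under [X in _ + _ + X <= _]eq_bigr do rewrite big_split /= sumr_const card_ord.
    rewrite big_split /= sumrMnl -/(E h s).
    have -> : \sum_(i < n) \sum_(j < n) B * expR (- k * s) * (h ^+ 2 * Y) = h ^+ 2 * W * expR (- k * s).
      rewrite /W mulr_sumr mulr_suml; apply: eq_bigr => i _.
      by rewrite mulr_sumr mulr_suml; apply: eq_bigr => j _; ring.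
    rewrite addrA lerD2r -[_ *+ n]mulr_natl.
    by rewrite lm le_eqVlt; apply/orP; left; apply/eqP; ring.
  have b0 : 0 <= h ^+ 2 * W by rewrite mulr_ge0.
  (* The gap between damping and forcing is exactly 1, so the division in the comparison leaves the
     constant unchanged. *)
  have k1 : k < k + 1 by rewrite ltrDl.
  apply: (le_trans (comparison_exp k1 b0 De Db t0)).
  rewrite mulrA ler_wpM2r ?expR_ge0 // mulrDr; apply: lerD; last first.
    by rewrite addrC addKr divr1.
  rewrite ger0_norm; last by apply: sumr_ge0 => i _; exact: bil_ge0.
  rewrite /G mulr_sumr; apply: ler_sum => i _.
  have [h1 [h3 h4]] := hz i 0 (lexx 0); have [pz _] := hp i 0 (lexx 0).
  exact: bil_lip.
exists (expR m * (G + W)); first by rewrite mulr_ge0 ?expR_ge0 // addr_ge0.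
move=> i t t0; rewrite -mulrA.
have [h1 [h3 h4]] := hz i t t0; have [pz _] := hp i t t0.
apply: (wdif_fatou m0' h4 h1 pz) => h h0; rewrite -bil_sqr.
apply: le_trans (main h h0 t t0).
rewrite /E (bigD1 i) //= lerDl; apply: sumr_ge0 => j _; exact: bil_ge0.
Qed.

(** * Hurwitz systems *)

(** For [k = 0] this is boundedness. *)
Definition expdec {R : realType} (k : R) (f : R -> R) : Prop :=
  exists K, forall t, 0 <= t -> f t ^+ 2 <= K * expR (- k * t).

Lemma expdec_ge0 {R : realType} (k : R) (f : R -> R) : expdec k f ->
  exists2 K, 0 <= K & forall t, 0 <= t -> f t ^+ 2 <= K * expR (- k * t).
Proof.
move=> [K H]; exists K => //; have := H 0 (lexx 0); rewrite mulr0 expR0 mulr1.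
exact: le_trans (sqr_ge0 _).
Qed.

Lemma expdecD {R : realType} (k : R) (f g : R -> R) : expdec k f -> expdec k g ->
  expdec k (fun t => f t + g t).
Proof.
move=> [K Hf] [L Hg]; exists (2 * K + 2 * L) => t t0.
have := Hf t t0; have := Hg t t0; have := sqr_ge0 (f t - g t).
set e := expR _; move: (f t) (g t) => a b; nra.
Qed.

Lemma expdec_mulb {R : realType} (k C : R) (w f : R -> R) :
  (forall t, 0 <= t -> `|w t| <= C) -> expdec k f -> expdec k (fun t => w t * f t).
Proof.
move=> hw [K Hf]; exists (C ^+ 2 * K) => t t0; rewrite exprMn -mulrA.
apply: ler_pM; rewrite ?sqr_ge0 //; last exact: Hf.
rewrite -(real_normK (num_real (w t))) ler_sqr ?nnegrE //; first exact: hw.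
exact: le_trans (hw t t0).
Qed.

Lemma expdecM0 {R : realType} (k : R) (w f : R -> R) : expdec 0 w -> expdec k f ->
  expdec k (fun t => w t * f t).
Proof.
(* [a <= a ^+ 2 + 1] bounds [|w|] by [C + 1] without a square root. *)
move=> [C hC]; apply: (expdec_mulb (C := C + 1)) => t t0.
have := hC t t0; rewrite oppr0 mul0r expR0 mulr1.
rewrite -(real_normK (num_real (w t))).
by have := sqr_ge0 (`|w t| - 1); move: `|_| => a; nra.
Qed.

Lemma expdecZ {R : realType} (k c : R) (f : R -> R) : expdec k f ->
  expdec k (fun t => c * f t).
Proof. exact: expdec_mulb. Qed.

Lemma expdecN {R : realType} (k : R) (f : R -> R) : expdec k f ->
  expdec k (fun t => - f t).
Proof. by move=> [K Hf]; exists K => t t0; rewrite sqrrN; exact: Hf. Qed.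

Lemma expdec0 {R : realType} (k : R) : expdec k (fun=> 0).
Proof. by exists 0 => t _; rewrite expr0n mul0r. Qed.

Lemma expdec_sum {R : realType} (k : R) (I : Type) (r : seq I) (f : I -> R -> R) :
  (forall i, expdec k (f i)) -> expdec k (fun t => \sum_(i <- r) f i t).
Proof.
move=> hf; elim: r => [|i r IH].
  by under eq_fun do rewrite big_nil; exact: expdec0.
by under eq_fun do rewrite big_cons; exact: expdecD.
Qed.

Lemma expdec_le {R : realType} (k k' : R) (f : R -> R) : k' <= k -> expdec k f -> expdec k' f.
Proof.
move=> kk /expdec_ge0 [K K0 H]; exists K => t t0; apply: (le_trans (H t t0)).
by rewrite ler_wpM2l // ler_expR ler_wpM2r // lerN2.
Qed.

(** * Complex-valued functions, through real and imaginary parts *)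

Definition chderiv {R : realType} (f : R -> R[i]) (t : R) (l : R[i]) : Prop :=
  hderiv (fun s => complex.Re (f s)) t (complex.Re l) /\
  hderiv (fun s => complex.Im (f s)) t (complex.Im l).

Definition cexpdec {R : realType} (k : R) (f : R -> R[i]) : Prop :=
  expdec k (fun t => complex.Re (f t)) /\ expdec k (fun t => complex.Im (f t)).

Lemma ReD {R : realType} (x y : R[i]) : complex.Re (x + y) = complex.Re x + complex.Re y.
Proof. by case: x; case: y. Qed.
Lemma ImD {R : realType} (x y : R[i]) : complex.Im (x + y) = complex.Im x + complex.Im y.
Proof. by case: x; case: y. Qed.
Lemma ReM {R : realType} (x y : R[i]) :
  complex.Re (x * y) = complex.Re x * complex.Re y - complex.Im x * complex.Im y.
Proof. by case: x; case: y. Qed.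
Lemma ImM {R : realType} (x y : R[i]) :
  complex.Im (x * y) = complex.Re x * complex.Im y + complex.Im x * complex.Re y.
Proof. by case: x; case: y. Qed.

Lemma chderivD {R : realType} (f g : R -> R[i]) t a b :
  chderiv f t a -> chderiv g t b -> chderiv (fun s => f s + g s) t (a + b).
Proof.
move=> [f1 f2] [g1 g2]; split; rewrite ?ReD ?ImD.
  by under [X in hderiv X]eq_fun do rewrite ReD; exact: hderivD.
by under [X in hderiv X]eq_fun do rewrite ImD; exact: hderivD.
Qed.

Lemma chderivZ {R : realType} (c : R[i]) (f : R -> R[i]) t a :
  chderiv f t a -> chderiv (fun s => c * f s) t (c * a).
Proof.
move=> [f1 f2]; split; rewrite ?ReM ?ImM.
  by under [X in hderiv X]eq_fun do rewrite ReM; apply: hderivB; exact: hderivZ.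
by under [X in hderiv X]eq_fun do rewrite ImM; apply: hderivD; exact: hderivZ.
Qed.

Lemma chderiv0 {R : realType} (t : R) : chderiv (fun=> 0) t 0.
Proof. by split; exact: hderiv_cst. Qed.

Lemma chderiv_mulmx {R : realType} (n p : nat) (P : 'M[R[i]]_(p, n))
    (y : R -> 'cV[R[i]]_n) (dy : 'cV[R[i]]_n) t :
  (forall j, chderiv (fun s => y s j ord0) t (dy j ord0)) ->
  forall i, chderiv (fun s => (P *m y s) i ord0) t ((P *m dy) i ord0).
Proof.
move=> H i; rewrite mxE; under [X in chderiv X]eq_fun do rewrite mxE.
elim: (index_enum _) => [|j r IH].
  by rewrite big_nil; under [X in chderiv X]eq_fun do rewrite big_nil; exact: chderiv0.
rewrite big_cons; under [X in chderiv X]eq_fun do rewrite big_cons.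
by apply: chderivD => //; exact: chderivZ.
Qed.

Lemma cexpdecD {R : realType} (k : R) (f g : R -> R[i]) : cexpdec k f -> cexpdec k g ->
  cexpdec k (fun t => f t + g t).
Proof.
move=> [f1 f2] [g1 g2]; split.
  by under eq_fun do rewrite ReD; exact: expdecD.
by under eq_fun do rewrite ImD; exact: expdecD.
Qed.

Lemma cexpdecZ {R : realType} (k : R) c (f : R -> R[i]) : cexpdec k f ->
  cexpdec k (fun t => c * f t).
Proof.
move=> [f1 f2]; split.
  by under eq_fun do rewrite ReM; apply: expdecD; [|apply: expdecN]; exact: expdecZ.
by under eq_fun do rewrite ImM; apply: expdecD; exact: expdecZ.
Qed.

Lemma cexpdec_mulmx {R : realType} (k : R) (n p : nat) (P : 'M[R[i]]_(p, n))
    (y : R -> 'cV[R[i]]_n) :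
  (forall j, cexpdec k (fun s => y s j ord0)) ->
  forall i, cexpdec k (fun s => (P *m y s) i ord0).
Proof.
move=> H i; under [X in cexpdec _ X]eq_fun do rewrite mxE.
elim: (index_enum _) => [|j r IH].
  by under [X in cexpdec _ X]eq_fun do rewrite big_nil; split; exact: expdec0.
under [X in cexpdec _ X]eq_fun do rewrite big_cons.
by apply: cexpdecD => //; exact: cexpdecZ.
Qed.

(** The squared modulus has damping [- 2 Re l], the imaginary part of [l] dropping out. Young's
    inequality spends half of it on the forcing; the other half, [- Re l], still exceeds [k]. *)
Lemma scalar_mode_decay {R : realType} (l : R[i]) (k : R) (y dy F : R -> R[i]) :
  complex.Re l < 0 -> k < - complex.Re l ->
  (forall t, 0 <= t -> chderiv y t (dy t)) ->
  (forall t, 0 < t -> dy t = l * y t + F t) -> cexpdec k F -> cexpdec k y.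
Proof.
set a := complex.Re l => a0 ka H E [/expdec_ge0[K1 K10 F1] /expdec_ge0[K2 K20 F2]].
pose u t := complex.Re (y t); pose w t := complex.Im (y t).
pose du t := complex.Re (dy t); pose dw t := complex.Im (dy t).
pose N t := u t * u t + w t * w t.
pose dN t := (du t * u t + u t * du t) + (dw t * w t + w t * dw t).
have HN t : 0 <= t -> hderiv N t (dN t).
  by move=> t0; case: (H t t0) => h1 h2; apply: hderivD; apply: hderivM.
pose b := (K1 + K2) / - a.
have na : 0 < - a by rewrite oppr_gt0.
have b0 : 0 <= b by rewrite divr_ge0 ?addr_ge0 // ltW.
have D t : 0 < t -> dN t <= - (- a) * N t + b * expR (- k * t).
  move=> t0; rewrite /dN /du /dw E // !ReD !ImD ReM ImM -/a -/(u t) -/(w t).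
  have := F1 t (ltW t0); have := F2 t (ltW t0).
  set e := expR _; set f1 := complex.Re (F t); set f2 := complex.Im (F t).
  rewrite /N; move: (u t) (w t) (complex.Im l) => p q im h2 h1.
  have am r f : 2 * (r * f) <= - a * r ^+ 2 + f ^+ 2 / - a.
    have : 0 <= (- a * r - f) ^+ 2 / - a by rewrite divr_ge0 ?sqr_ge0 // ltW.
    have -> : (- a * r - f) ^+ 2 / - a = - a * r ^+ 2 + f ^+ 2 / - a - 2 * (r * f).
      by field; exact: ltr0_neq0.
    by lra.
  have := am p f1; have := am q f2.
  have : f1 ^+ 2 / - a + f2 ^+ 2 / - a <= b * e.
    rewrite -mulrDl /b mulrAC ler_wpM2r ?invr_ge0 ?(ltW na) //.
    by rewrite mulrDl lerD.
  set x1 := f1 ^+ 2 / - a; set x2 := f2 ^+ 2 / - a; set be := b * e.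
  by lra.
have C := comparison_exp ka b0 HN D.
have uN t : u t ^+ 2 <= N t by rewrite /N -!expr2 lerDl sqr_ge0.
have wN t : w t ^+ 2 <= N t by rewrite /N -!expr2 lerDr sqr_ge0.
by split; exists (`|N 0| + b / (- a - k)) => t t0; apply: le_trans (C t t0); [exact: uN|exact: wN].
Qed.

(** The vector [(A - l) y] solves the same kind of system and forces [y' = l y + ...], so the roots
    are peeled off one at a time. *)
Lemma chain_decay {R : realType} (n : nat) (A : 'M[R[i]]_n) (k : R) (rs : seq R[i])
    (y dy g : R -> 'cV[R[i]]_n) :
  (forall l, l \in rs -> complex.Re l < 0 /\ k < - complex.Re l) ->
  (forall t, 0 <= t -> forall i, chderiv (fun s => y s i ord0) t (dy t i ord0)) ->
  (forall t, 0 < t -> dy t = A *m y t + g t) ->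
  (forall i, cexpdec k (fun t => g t i ord0)) ->
  (forall i, cexpdec k (fun t => (foldr (fun l B => B *m (A - l%:M)) 1%:M rs *m y t) i ord0)) ->
  forall i, cexpdec k (fun t => y t i ord0).
Proof.
elim: rs y dy g => [|l rs IH] y dy g hrs H E hg hP.
  by move=> i; have := hP i; under eq_fun do rewrite /= mul1mx.
have [l0 lk] := hrs l (mem_head _ _).
pose B := A - l%:M.
(* [B] commutes with [A], so [B *m y] solves the system forced by [B *m g], with one root fewer to
   remove. *)
have h1 : forall i, cexpdec k (fun t => (B *m y t) i ord0).
  apply: (IH _ (fun t => B *m dy t) (fun t => B *m g t)).
  - by move=> m mrs; apply: hrs; rewrite in_cons mrs orbT.
  - by move=> t t0 i; apply: chderiv_mulmx; exact: H.
  - move=> t t0; rewrite E // mulmxDr !mulmxA /B mulmxBl mulmxBr.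
    by rewrite scalar_mxC.
  - by move=> i; apply: cexpdec_mulmx.
  - by move=> i; have := hP i; under eq_fun do rewrite /= -mulmxA.
move=> i.
apply: (@scalar_mode_decay _ l k _ (fun t => dy t i ord0) (fun t => (B *m y t) i ord0 + g t i ord0)) => //.
- by move=> t t0; exact: H.
- move=> t t0; rewrite E // mxE addrA; congr (_ + _).
  by rewrite /B mulmxBl mul_scalar_mx !mxE addrC subrK.
- exact: cexpdecD.
Qed.

(** Needed because [eigenvalue] speaks of row vectors and [hurwitz] of column vectors. *)
Lemma char_poly_tr {F : comNzRingType} n (A : 'M[F]_n) : char_poly A^T = char_poly A.
Proof.
rewrite /char_poly -[RHS]det_tr; congr (\det _).
by rewrite /char_poly_mx linearB /= tr_scalar_mx map_trmx.
Qed.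

(** Over the complex numbers the characteristic polynomial splits, and by Cayley-Hamilton the
    product of its factors at [A] is 0, which starts [chain_decay]. [kap] depends on the spectrum
    only and serves every smaller rate, 0 included. *)
Lemma hurwitz_decay {R : realType} (n : nat) (A : 'M[R]_n) : (0 < n)%N -> hurwitz A ->
  exists2 kap : R, 0 < kap & forall k, k <= kap ->
  forall x dx g : R -> 'cV[R]_n,
  (forall t, 0 <= t -> forall i, hderiv (fun s => x s i ord0) t (dx t i ord0)) ->
  (forall t, 0 < t -> dx t = A *m x t + g t) ->
  (forall i, expdec k (fun t => g t i ord0)) ->
  forall i, expdec k (fun t => x t i ord0).
Proof.
case: n A => // n A _ hA.
pose cA := map_mx (real_complex R) A.
have [rs] := closed_field_poly_normal (char_poly cA).
rewrite (monicP (char_poly_monic _)) scale1r => Ers.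
have neg l : l \in rs -> complex.Re l < 0.
  move=> lrs.
  have : eigenvalue cA^T l.
    rewrite eigenvalue_root_char char_poly_tr Ers root_prod_XsubC //.
  move=> /eigenvalueP [v vl v0].
  have {}vl : cA *m v^T = l *: v^T.
    by rewrite -[cA]trmxK -trmx_mul vl linearZ.
  pose u : 'cV[R]_n.+1 := \col_i complex.Re (v ord0 i).
  pose w : 'cV[R]_n.+1 := \col_i complex.Im (v ord0 i).
  have sRe (I : Type) (r : seq I) (f : I -> R[i]) :
      complex.Re (\sum_(i <- r) f i) = \sum_(i <- r) complex.Re (f i).
    by elim: r => [|i r IH]; rewrite ?big_nil // !big_cons ReD IH.
  have sIm (I : Type) (r : seq I) (f : I -> R[i]) :
      complex.Im (\sum_(i <- r) f i) = \sum_(i <- r) complex.Im (f i).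
    by elim: r => [|i r IH]; rewrite ?big_nil // !big_cons ImD IH.
  apply: (hA (complex.Re l) (complex.Im l) u w).
  - apply/negPn/negP; rewrite negb_or !negbK => /andP[/eqP u0 /eqP w0].
    move/eqP: v0; apply; apply/rowP => i; rewrite mxE.
    have := congr1 (fun M : 'cV_n.+1 => M i ord0) u0.
    have := congr1 (fun M : 'cV_n.+1 => M i ord0) w0.
    by rewrite !mxE; case: (v ord0 i) => p q /= -> ->.
  - apply/colP => i; have := congr1 (fun M : 'cV_n.+1 => complex.Re (M i ord0)) vl.
    rewrite !mxE sRe ReM => <-; apply: eq_bigr => j _.
    by rewrite !mxE ReM /= mul0r subr0.
  - apply/colP => i; have := congr1 (fun M : 'cV_n.+1 => complex.Im (M i ord0)) vl.
    rewrite !mxE sIm ImM addrC => <-; apply: eq_bigr => j _.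
    by rewrite !mxE ImM /= mul0r addr0.
(* Halving the distance to the imaginary axis makes the inequality strict. *)
have [kap kap0 hk] : exists2 kap : R, 0 < kap & forall l, l \in rs -> kap < - complex.Re l.
  move: neg; elim: (rs) => [_|l r IH neg]; first by exists 1.
  have [kap kap0 h] := IH (fun l' h => neg l' (@mem_behead _ (l :: r) l' h)).
  have l0 : 0 < - complex.Re l by rewrite oppr_gt0 neg ?mem_head.
  exists (Num.min kap (- complex.Re l / 2)); first by rewrite lt_min kap0 divr_gt0.
  move=> m; rewrite in_cons gt_min => /orP[/eqP ->|mr]; last by rewrite h.
  by apply/orP; right; lra.
exists kap => // k kk x dx g H E hg i.
pose y t := map_mx (real_complex R) (x t).
suff : cexpdec k (fun t => y t i ord0).
  by move=> [h _]; move: h; congr expdec; apply/funext => t; rewrite mxE.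
apply: (@chain_decay _ _ cA k rs y (fun t => map_mx (real_complex R) (dx t))
   (fun t => map_mx (real_complex R) (g t))).
- by move=> l lrs; split; [exact: neg|exact: le_lt_trans (hk _ lrs)].
- move=> t t0 j; split; rewrite !mxE.
    by have := H t t0 j; congr hderiv; apply/funext => s; rewrite mxE.
  by have := hderiv_cst (0 : R) t; congr hderiv; apply/funext => s; rewrite mxE.
- by move=> t t0; rewrite E // map_mxD map_mxM.
- move=> j; split.
    by have := hg j; congr expdec; apply/funext => s; rewrite mxE.
  by have := expdec0 k; congr expdec; apply/funext => s; rewrite mxE.
move=> j.
(* [foldr] multiplies the factors in the order opposite to that of the product, hence the
   commutation. *)
have -> : foldr (fun l B => B *m (cA - l%:M)) 1%:M rs = 0.
  rewrite -[RHS](Cayley_Hamilton cA) Ers rmorph_prod /=.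
  elim: (rs) => [|l r IH]; first by rewrite big_nil.
  rewrite big_cons /= IH rmorphB /= horner_mx_X horner_mx_C.
  have C : GRing.comm (cA - l%:M) (\prod_(z <- r) horner_mx cA ('X - z%:P)).
    apply: commr_prod => z _; rewrite rmorphB /= horner_mx_X horner_mx_C.
    apply: commrB; apply/commr_sym; apply: commrB => //; try exact: comm_mx_scalar.
    - exact/comm_mx_sym/comm_mx_scalar.
  exact/esym.
by under eq_fun do rewrite mul0mx mxE; split; exact: expdec0.
Qed.

(** * The adaptive law *)

Lemma mnorm2_ge0 {R : realType} m n (A : 'M[R]_(m, n)) : 0 <= mnorm2 A.
Proof. by apply: sumr_ge0 => i _; apply: sumr_ge0 => j _; exact: sqr_ge0. Qed.

Lemma sqr_entry_le {R : realType} m n (A : 'M[R]_(m, n)) i j : A i j ^+ 2 <= mnorm2 A.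
Proof.
rewrite /mnorm2 (bigD1 i) //= (bigD1 j) //= -addrA lerDl addr_ge0 //.
  by apply: sumr_ge0 => k _; exact: sqr_ge0.
by apply: sumr_ge0 => k _; apply: sumr_ge0 => l _; exact: sqr_ge0.
Qed.

Lemma entry_le_mnorm {R : realType} m n (A : 'M[R]_(m, n)) i j : `|A i j| <= mnorm A.
Proof. by rewrite -sqrtr_sqr /mnorm ler_wsqrtr // sqr_entry_le. Qed.

Lemma mnorm2_col {R : realType} n (x : 'cV[R]_n) : mnorm2 x = \sum_i x i ord0 ^+ 2.
Proof. by apply: eq_bigr => i _; rewrite big_ord1. Qed.

Lemma C1nonneg_hderiv {R : realType} m n (F dF : R -> 'M[R]_(m, n)) : C1nonneg F dF ->
  forall t, 0 <= t -> forall i j, hderiv (fun s => F s i j) t (dF t i j).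
Proof.
move=> [H _] t t0 i j e e0; have [d d0 {}H] := H t t0 e e0.
exists d => // s s0 st; apply: le_trans (H s s0 st).
by have := entry_le_mnorm (F s - F t - (s - t) *: dF t) i j; rewrite !mxE.
Qed.

(** The bilinear form [x^T A y], as a double sum so that it can be differentiated term by term. *)
Definition qf {R : realType} n (A : 'M[R]_n) (x y : 'cV[R]_n) : R :=
  \sum_i \sum_j x i ord0 * A i j * y j ord0.

Lemma qfE {R : realType} n (A : 'M[R]_n) (x y : 'cV[R]_n) :
  qf A x y = (x^T *m A *m y) ord0 ord0.
Proof.
rewrite -mulmxA mxE; apply: eq_bigr => i _; rewrite !mxE mulr_sumr.
by apply: eq_bigr => j _; rewrite mulrA.
Qed.

Lemma hderiv_qf {R : realType} n (A : 'M[R]_n) (x y : R -> 'cV[R]_n) (dx dy : 'cV[R]_n) t :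
  (forall i, hderiv (fun s => x s i ord0) t (dx i ord0)) ->
  (forall i, hderiv (fun s => y s i ord0) t (dy i ord0)) ->
  hderiv (fun s => qf A (x s) (y s)) t (qf A dx (y t) + qf A (x t) dy).
Proof.
move=> hx hy; rewrite /qf -big_split /=; apply: hderiv_sum => i.
rewrite -big_split /=; apply: hderiv_sum => j.
apply: hderivM => //; have := hderivM (hx i) (hderiv_cst (A i j) t).
by rewrite mulr0 addr0.
Qed.

Lemma hderiv_qf_mx {R : realType} n (A : R -> 'M[R]_n) (dA : 'M[R]_n) (x y : 'cV[R]_n) t :
  (forall i j, hderiv (fun s => A s i j) t (dA i j)) ->
  hderiv (fun s => qf (A s) x y) t (qf dA x y).
Proof.
move=> h; apply: hderiv_sum => i; apply: hderiv_sum => j.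
have := hderivM (hderivZ (x i ord0) (h i j)) (hderiv_cst (y j ord0) t).
by rewrite mulr0 addr0.
Qed.

Lemma qf_bound {R : realType} n (A : 'M[R]_n) : exists2 C : R, 0 <= C &
  forall x : 'cV[R]_n, `|qf A x x| <= C * mnorm2 x.
Proof.
exists (\sum_i \sum_j `|A i j|).
  by apply: sumr_ge0 => i _; apply: sumr_ge0 => j _.
move=> x; rewrite /qf mulr_suml; apply: (le_trans (ler_norm_sum _ _ _)).
apply: ler_sum => i _; rewrite mulr_suml; apply: (le_trans (ler_norm_sum _ _ _)).
apply: ler_sum => j _; rewrite !normrM mulrAC mulrC; apply: ler_wpM2l => //.
have := sqr_entry_le x i ord0; have := sqr_entry_le x j ord0.
rewrite -(real_normK (num_real (x i ord0))) -(real_normK (num_real (x j ord0))).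
have := sqr_ge0 (`|x i ord0| - `|x j ord0|).
move: `|x i ord0| `|x j ord0| (mnorm2 x) => a b c; nra.
Qed.

Lemma qfDl {R : realType} n (A : 'M[R]_n) (x y z : 'cV[R]_n) s :
  qf A (x + s *: y) z = qf A x z + s * qf A y z.
Proof. by rewrite !qfE linearD linearZ /= !mulmxDl -!scalemxAl !mxE. Qed.

Lemma qfDr {R : realType} n (A : 'M[R]_n) (x y z : 'cV[R]_n) s :
  qf A z (x + s *: y) = qf A z x + s * qf A z y.
Proof. by rewrite !qfE mulmxDr -scalemxAr !mxE. Qed.

Lemma qf_sym {R : realType} n (A : 'M[R]_n) (x y : 'cV[R]_n) : A^T = A -> qf A x y = qf A y x.
Proof.
move=> hA; rewrite /qf exchange_big /=; apply: eq_bigr => i _; apply: eq_bigr => j _.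
by rewrite -{1}hA mxE; ring.
Qed.

Lemma spd_unit {R : realType} n (G : 'M[R]_n) : spd G -> G \in unitmx.
Proof.
move=> [Gs Gp]; rewrite -unitmx_tr -row_free_unit -kermx_eq0.
apply/eqP/row_matrixP => i; rewrite row0; apply/eqP; apply: contraT => v0.
set v := row i _ in v0.
have vG : v *m G^T = 0.
  by apply/sub_kermxP; rewrite /v row_sub.
have vT0 : v^T != 0 by apply: contra v0 => /eqP h; rewrite -[v]trmxK h linear0.
by have := Gp _ vT0; rewrite trmxK -{1}Gs vG mul0mx mxE ltxx.
Qed.

(** Cauchy-Schwarz for the form of [G^-1] at [x] and [G x] replaces a compactness argument. *)
Lemma spd_inv_lower {R : realType} n (G : 'M[R]_n) : spd G ->
  exists2 C : R, 0 < C & forall x : 'cV[R]_n, mnorm2 x <= C * qf (invmx G) x x.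
Proof.
move=> sG; have uG := spd_unit sG; have [Gs Gp] := sG.
have [C C0 hC] := qf_bound G.
have Gi : (invmx G)^T = invmx G by rewrite trmx_inv Gs.
have Gpos x : 0 <= qf G x x.
  rewrite qfE; have [->|x0] := eqVneq x 0; last exact/ltW/Gp.
  by rewrite trmx0 !mul0mx mxE.
have E x y : qf (invmx G) x (G *m y) = qf 1%:M x y.
  by rewrite !qfE -!mulmxA mulKmx // mul1mx.
have E1 x : qf 1%:M x x = mnorm2 x.
  rewrite qfE mulmx1 mnorm2_col mxE; apply: eq_bigr => i _.
  by rewrite mxE expr2.
have E2 x : qf (invmx G) (G *m x) (G *m x) = qf G x x.
  by rewrite E !qfE mulmx1 trmx_mul Gs.
(* Every vector is [G *m y], where the inverse form equals the form of [G] at [y]. *)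
have pos x : 0 <= qf (invmx G) x x.
  by rewrite -[x](mulKVmx uG) E2.
exists (C + 1); first by rewrite ltr_wpDl.
move=> x; have := mnorm2_ge0 x; rewrite le_eqVlt => /orP[/eqP <-|x0].
  by rewrite mulr_ge0 // addr_ge0.
have := @discriminant_le _ (qf (invmx G) x x) (qf (invmx G) x (G *m x))
   (qf (invmx G) (G *m x) (G *m x)).
rewrite E E1 E2 => CS.
have {}CS : mnorm2 x ^+ 2 <= qf (invmx G) x x * qf G x x.
  apply: CS => s; have := pos (x + s *: (G *m x)).
  rewrite qfDl !qfDr E2 E E1 (qf_sym _ _ Gi) E E1.
  by move=> h; apply: (le_trans h); rewrite le_eqVlt; apply/orP; left; apply/eqP; ring.
(* The mixed term in Cauchy-Schwarz is [mnorm2 x], so after this bound one factor [mnorm2 x]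
   cancels. *)
have h : qf G x x <= C * mnorm2 x by exact: le_trans (ler_norm _) (hC x).
rewrite -(ler_pM2r x0) -expr2; apply: (le_trans CS).
rewrite mulrAC mulrC; apply: ler_wpM2r => //; apply: (le_trans h).
by apply: ler_wpM2r; [exact: ltW|rewrite lerDl].
Qed.

Lemma hderiv_exp_exp {R : realType} (c k t : R) :
  hderiv (fun s => expR (c * expR (- k * s))) t
         (expR (c * expR (- k * t)) * (c * (- k * expR (- k * t)))).
Proof.
apply: is_derive_hderiv.
have h : is_derive t 1 (fun s : R => - k * s) (- k).
  by apply: is_derive_eq; rewrite /GRing.scale /= mulr1.
have h1 := @is_derive1_comp _ _ _ _ _ _ (is_derive_expR (- k * t)) h.
have h2 : is_derive t 1 (fun s => c * expR (- k * s)) _ := @is_deriveZ _ _ _ _ c _ _ _ h1.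
have := @is_derive1_comp _ expR (fun s => c * expR (- k * s)) t _ _ (is_derive_expR _) h2.
by move=> h3; apply: (is_derive_eq h3); rewrite /GRing.scale /=; ring.
Qed.

(** The growth rate has the finite integral [D / k] over the half-line;
    [expR (D / k * expR (- k * t))] is an integrating factor. *)
Lemma gronwall_exp {R : realType} (f df : R -> R) D k : 0 < k -> 0 <= D ->
  (forall t, 0 <= t -> hderiv f t (df t)) ->
  (forall t, 0 < t -> df t <= D * expR (- k * t) * f t) ->
  (forall t, 0 <= t -> 0 <= f t) ->
  forall t, 0 <= t -> f t <= f 0 * expR (D / k).
Proof.
move=> k0 D0 H Hd f0 t t0.
have Hg s : 0 <= s -> hderiv (fun s => f s * expR (D / k * expR (- k * s))) s
   (df s * expR (D / k * expR (- k * s)) +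
    f s * (expR (D / k * expR (- k * s)) * (D / k * (- k * expR (- k * s))))).
  by move=> s0; apply: hderivM; [exact: H|exact: hderiv_exp_exp].
have Dg s : 0 < s -> (df s * expR (D / k * expR (- k * s)) +
    f s * (expR (D / k * expR (- k * s)) * (D / k * (- k * expR (- k * s))))) <= 0.
  move=> /Hd; set e := expR (- k * s); set E := expR (D / k * e) => h.
  have -> : df s * E + f s * (E * (D / k * (- k * e))) = E * (df s - D * e * f s).
    by field; exact: lt0r_neq0.
  by rewrite mulr_ge0_le0 ?expR_ge0 // subr_le0.
have := hderiv_le0_nincr (lexx 0) t0 Hg Dg; rewrite mulr0 expR0 mulr1.
apply: le_trans; rewrite ler_peMr ?f0 // -[leLHS]expR0 ler_expR.
by rewrite mulr_ge0 ?expR_ge0 // divr_ge0 // ltW.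
Qed.

(** The weight [c] will be a decaying exponential, so that the smallness of [y] is shared between
    both terms. *)
Lemma dot_amgm {R : realType} n (x y : 'cV[R]_n) (c : R) : 0 < c ->
  2 * qf 1%:M x y <= c * mnorm2 x + c^-1 * mnorm2 y.
Proof.
move=> c0; have -> : qf 1%:M x y = \sum_i x i ord0 * y i ord0.
  by rewrite qfE mulmx1 mxE; apply: eq_bigr => i _; rewrite mxE.
rewrite !mnorm2_col !mulr_sumr -big_split /=; apply: ler_sum => i _.
move: (x i ord0) (y i ord0) => a b; rewrite -subr_ge0.
have -> : c * a ^+ 2 + c^-1 * b ^+ 2 - 2 * (a * b) = c^-1 * (c * a - b) ^+ 2.
  by field; exact: lt0r_neq0.
by rewrite mulr_ge0 ?sqr_ge0 // invr_ge0 ltW.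
Qed.

Lemma expdec_mnorm2 {R : realType} n k (f : R -> 'cV[R]_n) :
  (forall i, expdec k (fun t => f t i ord0)) ->
  exists2 K, 0 <= K & forall t, 0 <= t -> mnorm2 (f t) <= K * expR (- k * t).
Proof.
move=> h; suff [K H] : exists K, forall t, 0 <= t -> mnorm2 (f t) <= K * expR (- k * t).
  exists K => //; have := H 0 (lexx 0); rewrite mulr0 expR0 mulr1.
  exact: le_trans (mnorm2_ge0 _).
have : forall r : seq 'I_n, exists K, forall t, 0 <= t ->
   \sum_(i <- r) f t i ord0 ^+ 2 <= K * expR (- k * t).
  elim=> [|i r [K IH]]; first by exists 0 => t _; rewrite big_nil mul0r.
  have [L hL] := h i; exists (L + K) => t t0; rewrite big_cons mulrDl.
  by apply: lerD; [exact: hL|exact: IH].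
by move=> /(_ (index_enum 'I_n)) [K H]; exists K => t t0; rewrite mnorm2_col; exact: H.
Qed.

(** The Lyapunov function is the form of [Gamma^-1]; [alpha = 0] is the case without excitation. *)
Lemma parameter_error_decay {R : realType} (n : nat) (Gamma : 'M[R]_n)
    (te dte eta : R -> 'cV[R]_n) (Rm : R -> 'M[R]_n) (psi k0 alpha C1 : R) :
  spd Gamma -> 0 < psi -> 0 < k0 -> 0 <= alpha -> 0 <= C1 ->
  (forall t, 0 <= t -> forall i, hderiv (fun s => te s i ord0) t (dte t i ord0)) ->
  (forall t, 0 <= t -> dte t = Gamma *m (eta t - Rm t *m te t)) ->
  (forall i, expdec k0 (fun t => eta t i ord0)) ->
  (forall t x, 0 <= t -> (alpha - C1 * expR (- psi * t)) * mnorm2 x <= qf (Rm t) x x) ->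
  exists2 k, 0 <= k & (0 < alpha -> 0 < k) /\ forall i, expdec k (fun t => te t i ord0).
Proof.
move=> sG psi0 k00 al0 C10 hte Edte heta hR.
have uG := spd_unit sG; have [Gs _] := sG.
have Gi : (invmx Gamma)^T = invmx Gamma by rewrite trmx_inv Gs.
have [CG CG0 low] := spd_inv_lower sG.
have [C2 C20 upp] := qf_bound (invmx Gamma).
have [K K0 hK] := expdec_mnorm2 heta.
pose V t := qf (invmx Gamma) (te t) (te t).
pose dV t := qf (invmx Gamma) (dte t) (te t) + qf (invmx Gamma) (te t) (dte t).
have V0 t : 0 <= V t.
  have := le_trans (mnorm2_ge0 (te t)) (low (te t)); rewrite pmulr_rge0 //.
have HV t : 0 <= t -> hderiv V t (dV t) by move=> t0; apply: hderiv_qf => i; exact: hte.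
(* [k0 / 2], because [mnorm2 (eta t)] is divided by [expR (- kap * t)] and must still decay at rate
   [kap]; [psi], for the defect of [Rm]. *)
pose kap := Num.min (k0 / 2) psi.
have kap0 : 0 < kap by rewrite lt_min psi0 divr_gt0.
have kap1 : kap <= k0 / 2 by rewrite ge_min lexx.
have kap2 : kap <= psi by rewrite ge_min lexx orbT.
have ek t : 0 <= t -> expR (- psi * t) <= expR (- kap * t).
  by move=> t0; rewrite ler_expR; apply: ler_wpM2r => //; rewrite lerN2.
(* [2 * C1] comes from the defect of [Rm], [1] from the split of the mixed term, both converted to
   [V] by [CG]; [K] comes from [eta]. *)
pose D := (2 * C1 + 1) * CG + K.
have D0 : 0 <= D by rewrite /D; apply: addr_ge0 => //; apply: mulr_ge0; [lra|exact: ltW].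
have bound t : 0 <= t ->
    dV t <= - (2 * alpha) * mnorm2 (te t) + D * expR (- kap * t) * (V t + 1).
  move=> t0.
  have -> : dV t = 2 * qf 1%:M (te t) (eta t) - 2 * qf (Rm t) (te t) (te t).
    rewrite /dV (qf_sym _ _ Gi) Edte // !qfE -!mulmxA mulKmx // mul1mx.
    by rewrite mulmxBr !mxE; ring.
  set e := expR (- kap * t).
  have e0 : 0 < e by exact: expR_gt0.
  have h1 := dot_amgm (te t) (eta t) e0.
  have h2 : e^-1 * mnorm2 (eta t) <= K * e.
    rewrite mulrC ler_pdivrMr // -mulrA -expRD; apply: (le_trans (hK t t0)).
    rewrite ler_wpM2l // ler_expR.
    have := ler_wpM2r t0 kap1; lra.
  have h3 := hR t (te t) t0.
  have h4 : C1 * expR (- psi * t) * mnorm2 (te t) <= C1 * e * mnorm2 (te t).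
    apply: ler_wpM2r; first exact: mnorm2_ge0.
    by apply: ler_wpM2l => //; exact: ek.
  have h5 : (2 * C1 + 1) * e * mnorm2 (te t) <= (2 * C1 + 1) * e * (CG * V t).
    by apply: ler_wpM2l; [apply: mulr_ge0; [lra|exact: ltW]|exact: low].
  have -> : D * e * (V t + 1) = (2 * C1 + 1) * e * (CG * V t) + (2 * C1 + 1) * e * CG
      + K * e * V t + K * e by rewrite /D; ring.
  have p1 : 0 <= (2 * C1 + 1) * e * CG.
    by rewrite !mulr_ge0 ?(ltW CG0) ?(ltW e0) //; lra.
  have p2 : 0 <= K * e * V t by rewrite !mulr_ge0 // ltW.
  by lra.
(* Boundedness comes first, and for [V + 1], which makes the inequality homogeneous. It then turns
   the term with [D] into a decaying forcing. *)
have [VM VM0 hVM] : exists2 VM, 0 <= VM & forall t, 0 <= t -> V t + 1 <= VM.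
  exists ((V 0 + 1) * expR (D / kap)); first by rewrite mulr_ge0 ?expR_ge0 // addr_ge0.
  apply: (@gronwall_exp _ (fun t => V t + 1) (fun t => dV t + 0) D kap) => //.
  - by move=> t t0; apply: hderivD; [exact: HV|exact: hderiv_cst].
  - move=> t t0; rewrite addr0; apply: (le_trans (bound t (ltW t0))).
    rewrite gerDr mulNr oppr_le0; apply: mulr_ge0; last exact: mnorm2_ge0.
    by rewrite mulr_ge0.
  - by move=> t _; rewrite addr_ge0.
(* The damping [2 * alpha * mnorm2] expressed through [V], as [V <= (C2 + 1) * mnorm2]. *)
pose c := 2 * alpha / (C2 + 1).
have C21 : 0 < C2 + 1 by rewrite ltr_wpDl.
have c0 : 0 <= c by rewrite divr_ge0 ?mulr_ge0 // ltW.
(* Two uses: a rate below the damping [c], or mere boundedness when [alpha = 0], where [c]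
   vanishes. *)
have Vb k : 0 <= k -> k <= kap -> (k < c \/ (k = 0 /\ alpha = 0)) -> exists KV, forall t, 0 <= t -> V t <= KV * expR (- k * t).
  move=> k_ge0 kk [kc|[-> _]]; last first.
    by exists VM => t t0; rewrite oppr0 mul0r expR0 mulr1; have := hVM t t0; lra.
  have b0 : 0 <= D * VM by rewrite mulr_ge0.
  exists (`|V 0| + D * VM / (c - k)); apply: (comparison_exp kc b0 HV) => t t0.
  have t0' := ltW t0; apply: (le_trans (bound t t0')).
  apply: lerD; last first.
    rewrite -!mulrA; apply: ler_wpM2l => //; rewrite mulrC.
    apply: ler_pM; rewrite ?expR_ge0 //; first by rewrite addr_ge0.
      exact: hVM.
    by rewrite ler_expR; apply: ler_wpM2r => //; rewrite lerN2.
  rewrite !mulNr lerN2 /c mulrAC ler_pdivrMr // -[leRHS]mulrA; apply: ler_wpM2l.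
    by rewrite mulr_ge0.
  have := le_trans (ler_norm _) (upp (te t)); rewrite -/(V t) => h.
  by rewrite mulrDr mulr1 mulrC; apply: (le_trans h); rewrite lerDl mnorm2_ge0.
have fin k KV : (forall t, 0 <= t -> V t <= KV * expR (- k * t)) ->
    forall i, expdec k (fun t => te t i ord0).
  move=> H i; exists (CG * KV) => t t0; apply: (le_trans (sqr_entry_le (te t) i ord0)).
  by apply: (le_trans (low _)); rewrite -mulrA ler_pM2l //; exact: H.
move: al0; rewrite le_eqVlt => /orP[/eqP al0|al0].
  have [KV H] := Vb 0 (lexx 0) (ltW kap0) (or_intror (conj erefl (esym al0))).
  by exists 0 => //; split; [rewrite -al0 ltxx|exact: fin H].
have c1 : 0 < c by rewrite divr_gt0 // mulr_gt0.
have k1 : 0 < Num.min kap (c / 2) by rewrite lt_min kap0 divr_gt0.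
have k2 : Num.min kap (c / 2) < c by rewrite gt_min; apply/orP; right; lra.
have k3 : Num.min kap (c / 2) <= kap by rewrite ge_min lexx.
have [KV H] := Vb _ (ltW k1) k3 (or_introl k2).
by exists (Num.min kap (c / 2)); [exact: ltW|split => //; exact: fin H].
Qed.

Lemma hderiv_continuous_at {R : realType} (f : R -> R) t l : 0 < t -> hderiv f t l ->
  {for t, continuous f}.
Proof.
move=> t0 h; have [D _] := hderiv_is_derive t0 h.
exact/differentiable_continuous/derivable1_diffP.
Qed.

(** The mean value theorem for [F] minus the primitive of [k]; only [k] is integrated, so [dF] may
    be any pointwise derivative. *)
Lemma integral_le_increment {R : realType} (F dF k dk : R -> R) a b : 0 <= a -> a < b ->
  (forall t, 0 <= t -> hderiv F t (dF t)) -> (forall t, 0 <= t -> hderiv k t (dk t)) ->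
  (forall t, a < t < b -> k t <= dF t) ->
  \int[@lebesgue_measure R]_(x in `[a, b]) k x <= F b - F a.
Proof.
move=> a0 ab hF hk kF.
have ck : {within `[a, b], continuous k} by exact: hderiv_continuous hk.
have ik : (@lebesgue_measure R).-integrable `[a, b] (EFin \o k).
  by apply: continuous_compact_integrable => //; exact: segment_compact.
pose K x := \int[@lebesgue_measure R]_(t in `[a, x]) k t.
have cK : {within `[a, b], continuous K}.
  exact: (parameterized_integral_continuous (ltW ab) ik).
have dK x : x \in `]a, b[%R -> is_derive x 1 (fun y => F y - K y) (dF x - k x).
  rewrite in_itv /= => /andP[ax xb]; have x0 := le_lt_trans a0 ax.
  have cx := hderiv_continuous_at x0 (hk x (ltW x0)).
  have [D E] := continuous_FTC1_closed xb ik ax cx.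
  have iK : is_derive x 1 K (k x).
    apply: DeriveDef; first exact: D.
    by rewrite -derive1E; exact: E.
  have iF := hderiv_is_derive x0 (hF x (ltW x0)).
  exact: is_deriveB.
have cFK : {within `[a, b], continuous (fun y => F y - K y)}.
  have cF : {within `[a, b], continuous F} by exact: hderiv_continuous hF.
  by move=> x; apply: (@continuousB _ _ (subspace `[a, b])); [exact: cF|exact: cK].
have [c cab E] := MVT ab dK cFK.
have Ka : K a = 0 by rewrite /K set_itv1 Rintegral_set1.
have := mulr_ge0 (_ : 0 <= dF c - k c) (_ : 0 <= b - a).
rewrite -E Ka subr0 -/(K b) subr_ge0 => H.
rewrite lerBrDr -lerBrDl; move: H; rewrite !subr_ge0 => H.
have := H (kF c _) (ltW ab); move: cab; rewrite in_itv /= => cab /(_ cab).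
by rewrite -/(K b); lra.
Qed.

Lemma linear_decay {R : realType} (c k : R) (f df g : R -> R) : 0 < c -> k < c ->
  (forall t, 0 <= t -> hderiv f t (df t)) ->
  (forall t, 0 < t -> df t = - c * f t + g t) -> expdec k g -> expdec k f.
Proof.
move=> c0 kc hf E hg.
suff [] : cexpdec k (fun t => (f t)%:C%C) by [].
apply: (@scalar_mode_decay _ (- c)%:C%C k _ (fun t => (df t)%:C%C) (fun t => (g t)%:C%C)).
- by rewrite /= oppr_lt0.
- by rewrite /= opprK.
- by move=> t t0; split; [exact: hf|exact: hderiv_cst].
- by move=> t t0; rewrite E // rmorphD rmorphM.
- by split => //; exact: expdec0.
Qed.

(** * Persistent excitation and the adaptive law *)

Lemma qf_outer {R : realType} n (p x : 'cV[R]_n) :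
  qf (p *m p^T) x x = (\sum_i x i ord0 * p i ord0) ^+ 2.
Proof.
rewrite expr2 mulr_suml; apply: eq_bigr => i _; rewrite mulr_sumr.
by apply: eq_bigr => j _; rewrite mxE big_ord1 !mxE; ring.
Qed.

Lemma qf_lin {R : realType} n (A B : 'M[R]_n) a b (x : 'cV[R]_n) :
  qf (a *: A + b *: B) x x = a * qf A x x + b * qf B x x.
Proof.
rewrite /qf !mulr_sumr -big_split; apply: eq_bigr => i _ /=.
rewrite !mulr_sumr -big_split; apply: eq_bigr => j _ /=; rewrite !mxE; ring.
Qed.

Lemma integrable_itvZ {R : realType} (a b c : R) (f : R -> R) :
  (@lebesgue_measure R).-integrable `[a, b] (EFin \o f) ->
  (@lebesgue_measure R).-integrable `[a, b] (EFin \o (fun s => c * f s)).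
Proof.
have mI : measurable (`[a, b]%classic : set (measurableTypeR R)) by exact: measurable_itv.
by move=> h; have := integrableZl mI c h.
Qed.

Lemma Rintegral_itv_sum {R : realType} (I : Type) (a b : R) (r : seq I) (f : I -> R -> R) :
  (forall i, (@lebesgue_measure R).-integrable `[a, b] (EFin \o f i)) ->
  (@lebesgue_measure R).-integrable `[a, b] (EFin \o (fun s => \sum_(i <- r) f i s)) /\
  \int[@lebesgue_measure R]_(s in `[a, b]) (\sum_(i <- r) f i s) =
  \sum_(i <- r) \int[@lebesgue_measure R]_(s in `[a, b]) f i s.
Proof.
move=> hf; elim: r => [|i r [IH1 IH2]].
  have -> : (fun s => \sum_(i <- [::]) f i s) = (fun=> 0) by apply/funext => s; rewrite big_nil.
  split; first exact: integrable0.
  by rewrite big_nil /Rintegral integral0.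
have -> : (fun s => \sum_(j <- i :: r) f j s) = (fun s => f i s + \sum_(j <- r) f j s).
  by apply/funext => s; rewrite big_cons.
split; last by rewrite big_cons RintegralD // IH2.
have mI : measurable (`[a, b]%classic : set (measurableTypeR R)) by exact: measurable_itv.
by have := integrableD mI (hf i) IH1.
Qed.

(** [Rm 0] is arbitrary, possibly indefinite, whence the defect [C * expR (- psi * t)]. *)
Lemma excitation_lower_bound {R : realType} n (phi dphi : R -> 'cV[R]_n)
    (Rm dRm : R -> 'M[R]_n) (psi : R) : 0 < psi ->
  (forall t, 0 <= t -> forall i, hderiv (fun s => phi s i ord0) t (dphi t i ord0)) ->
  (forall t, 0 <= t -> forall i j, hderiv (fun s => Rm s i j) t (dRm t i j)) ->
  (forall t, 0 <= t -> dRm t = - psi *: Rm t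
     + (1 + mnorm2 (phi t))^-1 *: (phi t *m (phi t)^T)) ->
  (exists2 C, 0 <= C & forall t x, 0 <= t -> (0 - C * expR (- psi * t)) * mnorm2 x <= qf (Rm t) x x)
  /\ ((exists M, forall t, 0 <= t -> mnorm (phi t) <= M) ->
   (exists T0 a0, 0 < T0 /\ 0 < a0 /\ forall t, 0 <= t ->
      forall x : 'cV[R]_n,
        a0 * mnorm2 x <= (x^T *m mint t (t + T0) (fun s => phi s *m (phi s)^T) *m x) ord0 ord0) ->
   exists2 al, 0 < al & exists2 C, 0 <= C &
     forall t x, 0 <= t -> (al - C * expR (- psi * t)) * mnorm2 x <= qf (Rm t) x x).
Proof.
move=> psi0 hphi hR ER.
have [C C0 hC] := qf_bound (Rm 0).
pose k (x : 'cV[R]_n) t := (\sum_i x i ord0 * phi t i ord0) ^+ 2.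
(* The factor [expR (psi * t)] removes the forgetting term, leaving a quantity that never decreases
   and grows with the normalised regressor. *)
pose w (x : 'cV_n) t := expR (psi * t) * qf (Rm t) x x.
pose dw (x : 'cV_n) t := psi * expR (psi * t) * qf (Rm t) x x + expR (psi * t) * qf (dRm t) x x.
have hw x t : 0 <= t -> hderiv (w x) t (dw x t).
  move=> t0; apply: hderivM; first exact: hderiv_expR.
  by apply: hderiv_qf_mx => i j; exact: hR.
have Edw x t : 0 <= t -> dw x t = expR (psi * t) * ((1 + mnorm2 (phi t))^-1 * k x t).
  by move=> t0; rewrite /dw ER // qf_lin qf_outer -/(k x t); ring.
have N1 t : 0 < 1 + mnorm2 (phi t) by rewrite ltr_pwDl // mnorm2_ge0.
have dw0 x t : 0 <= t -> 0 <= dw x t.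
  move=> t0; rewrite Edw //; apply: mulr_ge0; first exact: expR_ge0.
  by apply: mulr_ge0; [rewrite invr_ge0 ltW|exact: sqr_ge0].
have incr x a b : 0 <= a -> a <= b -> w x a <= w x b.
  move=> a0 ab; rewrite -lerN2.
  apply: (@hderiv_le0_nincr _ (fun t => - w x t) (fun t => - dw x t) a b) => //.
    by move=> t t0; apply: hderivN; exact: hw.
  by move=> t t0; rewrite oppr_le0; apply: dw0; exact: ltW.
have ee t : expR (- psi * t) * expR (psi * t) = 1 by rewrite -expRD mulNr addNr expR0.
have base t x : 0 <= t -> (0 - C * expR (- psi * t)) * mnorm2 x <= qf (Rm t) x x.
  move=> t0; have := incr x 0 t (lexx 0) t0; rewrite {1}/w mulr0 expR0 mul1r => h.
  have h1 : - (C * mnorm2 x) <= qf (Rm 0) x x by have := hC x; rewrite ler_norml => /andP[].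
  have := ler_wpM2l (expR_ge0 (- psi * t)) (le_trans h1 h).
  by rewrite /w [leRHS]mulrA ee mul1r; apply: le_trans; rewrite sub0r mulNr mulrN -mulrA mulrCA.
split; first by exists C.
move=> [M hM] [T0 [a0 [T00 [a00 PE]]]].
have M2 t : 0 <= t -> mnorm2 (phi t) <= M ^+ 2.
  move=> t0; rewrite -(sqr_sqrtr (mnorm2_ge0 (phi t))) ler_sqr ?nnegrE ?sqrtr_ge0 //.
    exact: hM.
  by apply: le_trans (hM t t0); exact: sqrtr_ge0.
have M1 : 0 < 1 + M ^+ 2 by rewrite ltr_pwDl // sqr_ge0.
(* Over a window of length [T0] ending at [t], forgetting costs at most the factor
   [expR (- psi * T0)] and the normalisation at most [1 + M ^+ 2]. *)
pose al := expR (- psi * T0) / (1 + M ^+ 2) * a0.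
have al0 : 0 < al by rewrite mulr_gt0 // divr_gt0 ?expR_gt0.
have PEk t x : 0 <= t -> a0 * mnorm2 x <=
    \int[@lebesgue_measure R]_(s in `[t, (t + T0)]) k x s.
  move=> t0; apply: (le_trans (PE t t0 x)).
  (* Integrability of the entries allows the quadratic form to be moved inside the entrywise
     integral [mint]. *)
  have ip i j : (@lebesgue_measure R).-integrable `[t, (t + T0)] (EFin \o (fun s => phi s i ord0 * phi s j ord0)).
    apply: continuous_compact_integrable; first exact: segment_compact.
    have H s : 0 <= s -> hderiv (fun s => phi s i ord0 * phi s j ord0) s _ :=
      fun s0 => hderivM (hphi s s0 i) (hphi s s0 j).
    exact: (hderiv_continuous t0 H).
  rewrite -qfE /qf.
  have -> : \int[@lebesgue_measure R]_(s in `[t, (t + T0)]) k x s =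
     \int[@lebesgue_measure R]_(s in `[t, (t + T0)]) (\sum_i \sum_j x i ord0 * x j ord0 * (phi s i ord0 * phi s j ord0)).
    apply: eq_Rintegral => s _; rewrite /k expr2 mulr_suml; apply: eq_bigr => i _.
    by rewrite mulr_sumr; apply: eq_bigr => j _; ring.
  have Rsum := @Rintegral_itv_sum R 'I_n t (t + T0).
  have iZ c i j : (@lebesgue_measure R).-integrable `[t, (t + T0)]
      (EFin \o (fun s => c * (phi s i ord0 * phi s j ord0))).
    exact: integrable_itvZ.
  rewrite (Rsum _ _ (fun i => (Rsum (index_enum 'I_n) _ (fun j => iZ (x i ord0 * x j ord0) i j)).1)).2.
  apply: ler_sum => i _.
  rewrite (Rsum _ _ (fun j => iZ (x i ord0 * x j ord0) i j)).2.
  apply: ler_sum => j _; rewrite RintegralZl // mxE.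
  rewrite le_eqVlt; apply/orP; left; apply/eqP; rewrite mulrAC; congr (_ * _).
  by apply: eq_Rintegral => s _; rewrite mxE big_ord1 mxE.
(* The extra [al * expR (psi * T0)] makes the claim weaker than the unexcited bound for [t < T0],
   before a full window has elapsed. *)
exists al => //; exists (C + al * expR (psi * T0)); first by rewrite addr_ge0 // mulr_ge0 ?expR_ge0 // ltW.
move=> t x t0; have m0 := mnorm2_ge0 x.
have [tT|tT] := leP T0 t; last first.
  apply: le_trans (base t x t0); apply: ler_wpM2r => //.
  have : 1 <= expR (psi * T0) * expR (- psi * t).
    rewrite -expRD -[leLHS]expR0 ler_expR mulNr -mulrBr mulr_ge0 // ?ltW // subr_gt0 //.
  move=> /(ler_wpM2l (ltW al0)); rewrite mulr1 mulrDl -!mulrA; lra.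
pose t1 := t - T0.
have t10 : 0 <= t1 by rewrite subr_ge0.
have t1t : t1 < t by rewrite ltrBlDr ltrDl.
have tE : t = t1 + T0 by rewrite /t1 subrK.
pose c0 := expR (psi * t1) / (1 + M ^+ 2).
have c00 : 0 < c0 by rewrite divr_gt0 ?expR_gt0.
have hk s : 0 <= s -> hderiv (k x) s _ := fun s0 =>
  let h := hderiv_sum (index_enum 'I_n) (fun i => hderivZ (x i ord0) (hphi s s0 i)) in hderivM h h.
(* On the window, [c0] is a lower bound for the weight divided by the normalisation. *)
have INC : \int[@lebesgue_measure R]_(s in `[t1, t]) k x s <= c0^-1 * w x t - c0^-1 * w x t1.
  apply: (@integral_le_increment _ (fun s => c0^-1 * w x s) (fun s => c0^-1 * dw x s) _ _ _ _ t10 t1t _ hk).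
    by move=> s s0; apply: hderivZ; exact: hw.
  move=> s /andP[s1 s2]; have s0 : 0 <= s by apply: le_trans (ltW s1).
  rewrite ler_pdivlMl // Edw // [leRHS]mulrA; apply: ler_wpM2r; first exact: sqr_ge0.
  rewrite /c0; apply: ler_pM; rewrite ?expR_ge0 ?invr_ge0 ?(ltW M1) //.
    by rewrite ler_expR ler_pM2l // ltW.
  by rewrite lef_pV2 ?posrE // lerD2l M2.
have := PEk t1 x t10; rewrite -tE => h1.
have {h1}INC := le_trans h1 INC.
have h2 : c0 * (a0 * mnorm2 x) <= w x t - w x t1.
  by move: INC; rewrite -mulrBr ler_pdivlMl.
have h3 : - (C * mnorm2 x) <= w x t1.
  apply: le_trans (incr x 0 t1 (lexx 0) t10); rewrite /w mulr0 expR0 mul1r.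
  by have := hC x; rewrite ler_norml => /andP[].
have h4 : c0 * (a0 * mnorm2 x) - C * mnorm2 x <= w x t by lra.
have := ler_wpM2l (expR_ge0 (- psi * t)) h4.
rewrite {1}/w [leRHS]mulrA ee mul1r; apply: le_trans.
have -> : expR (- psi * t) * (c0 * (a0 * mnorm2 x) - C * mnorm2 x) =
    (al - C * expR (- psi * t)) * mnorm2 x.
  rewrite /al /c0; have -> : expR (- psi * T0) = expR (- psi * t) * expR (psi * t1).
    by rewrite -expRD; congr expR; rewrite /t1; ring.
  by field; exact: lt0r_neq0.
apply: ler_wpM2r => //; rewrite lerD2l lerN2 mulrDl lerDl.
by apply: mulr_ge0; [apply: mulr_ge0; [exact: ltW|]|]; exact: expR_ge0.
Qed.

(** In the derivative of [eta = Rm *m theta + Q] the regressor parts of [Rm] and [Q] cancel up to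
    [eps], so [eta] has damping [psi] and an exponentially small forcing; and
    [te' = Gamma *m (eta - Rm *m te)]. *)
Lemma adaptive_error_decay {R : realType} n (Gamma : 'M[R]_n) (psi k0 : R) (theta : 'cV[R]_n)
    (phi dphi thh dthh Q dQ : R -> 'cV[R]_n) (Rm dRm : R -> 'M[R]_n) (y eps : R -> R) :
  spd Gamma -> 0 < psi -> 0 < k0 ->
  (forall t, 0 <= t -> forall i, hderiv (fun s => phi s i ord0) t (dphi t i ord0)) ->
  (forall t, 0 <= t -> forall i, hderiv (fun s => thh s i ord0) t (dthh t i ord0)) ->
  (forall t, 0 <= t -> forall i, hderiv (fun s => Q s i ord0) t (dQ t i ord0)) ->
  (forall t, 0 <= t -> forall i j, hderiv (fun s => Rm s i j) t (dRm t i j)) ->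
  (forall t, 0 <= t -> dthh t = - (Gamma *m (Rm t *m thh t + Q t))) ->
  (forall t, 0 <= t -> dRm t = - psi *: Rm t
     + (1 + mnorm2 (phi t))^-1 *: (phi t *m (phi t)^T)) ->
  (forall t, 0 <= t -> dQ t = - psi *: Q t - (1 + mnorm2 (phi t))^-1 *: (y t *: phi t)) ->
  (forall t, 0 <= t -> y t = \sum_i theta i ord0 * phi t i ord0 + eps t) -> expdec k0 eps ->
  (forall i, expdec 0 (fun t => theta i ord0 - thh t i ord0)) /\
  ((exists M, forall t, 0 <= t -> mnorm (phi t) <= M) ->
   (exists T0 a0, 0 < T0 /\ 0 < a0 /\ forall t, 0 <= t ->
      forall x : 'cV[R]_n,
        a0 * mnorm2 x <= (x^T *m mint t (t + T0) (fun s => phi s *m (phi s)^T) *m x) ord0 ord0) ->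
   exists2 k, 0 < k & forall i, expdec k (fun t => theta i ord0 - thh t i ord0)).
Proof.
move=> sG psi0 k00 hphi hthh hQ hR Ethh ER EQ Ey heps.
have N1 t : 0 < 1 + mnorm2 (phi t) by rewrite ltr_pwDl // mnorm2_ge0.
pose te t := theta - thh t.
pose eta t := Rm t *m theta + Q t.
(* Halving [psi] keeps the rate strictly below the damping of [eta]. *)
pose k1 := Num.min k0 (psi / 2).
have k10 : 0 < k1 by rewrite lt_min k00 divr_gt0.
have k1psi : k1 < psi by rewrite gt_min; apply/orP; right; lra.
have heta i : expdec k1 (fun t => eta t i ord0).
  apply: (@linear_decay _ psi k1 _ (fun t => \sum_j theta j ord0 * dRm t i j + dQ t i ord0)
     (fun t => (- ((1 + mnorm2 (phi t))^-1 * phi t i ord0)) * eps t)) => //.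
  - move=> t t0; rewrite /eta.
    under [X in hderiv X]eq_fun do rewrite !mxE.
    apply: hderivD; last exact: hQ.
    apply: hderiv_sum => j; have := hderivZ (theta j ord0) (hR t t0 i j).
    by under [X in hderiv X]eq_fun do rewrite mulrC.
  - move=> t /ltW t0; rewrite ER // EQ // !mxE Ey //.
    under eq_bigr do rewrite !mxE big_ord1 !mxE.
    set N := (1 + _)^-1; set p := phi t i ord0.
    have -> : \sum_j theta j ord0 * (- psi * Rm t i j + N * (p * phi t j ord0)) =
       - psi * (\sum_j Rm t i j * theta j ord0) + N * p * \sum_j theta j ord0 * phi t j ord0.
      rewrite !mulr_sumr -big_split; apply: eq_bigr => j _ /=; ring.
    by ring.
  (* The normalisation bounds [|phi_i| / (1 + |phi|^2)] by 1 even when the regressor is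
     unbounded. *)
  - apply: (expdec_mulb (C := 1)); last by apply: expdec_le heps; rewrite ge_min lexx.
    move=> t t0; rewrite normrN normrM gtr0_norm ?invr_gt0 //.
    rewrite mulrC ler_pdivrMr // mul1r.
    have := sqr_entry_le (phi t) i ord0; rewrite -(real_normK (num_real (phi t i ord0))).
    by have := sqr_ge0 (`|phi t i ord0| - 1); move: `|_| => a; nra.
have hte t : 0 <= t -> forall i, hderiv (fun s => te s i ord0) t ((- dthh t) i ord0).
  move=> t0 i; rewrite /te mxE.
  under [X in hderiv X]eq_fun do rewrite !mxE.
  by have := hderivB (hderiv_cst (theta i ord0) t) (hthh t t0 i); rewrite sub0r.
have Ete t : 0 <= t -> - dthh t = Gamma *m (eta t - Rm t *m te t).
  move=> t0; rewrite Ethh // opprK; congr (_ *m _).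
  by rewrite /eta /te mulmxBr opprD opprK addrACA subrr add0r addrC.
have teE i : (fun t => te t i ord0) = (fun t => theta i ord0 - thh t i ord0).
  by apply/funext => t; rewrite !mxE.
have [[C C0 hC] PE] := excitation_lower_bound psi0 hphi hR ER.
split.
  have [k kge0 [_ H]] := parameter_error_decay sG psi0 k10 (lexx 0) C0 hte Ete heta hC.
  by move=> i; rewrite -teE; apply: expdec_le (H i).
move=> hM hPE; have [al al0 [C' C'0 hC']] := PE hM hPE.
have [k kge0 [kp H]] := parameter_error_decay sG psi0 k10 (ltW al0) C'0 hte Ete heta hC'.
by exists k; [exact: kp|move=> i; rewrite -teE].
Qed.

(** * Bounds for the nonlinearity and the integral operators *)

Lemma mnorm_lt {R : realType} n (A : 'cV[R]_n) (e : R) : 0 < e ->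
  (forall i, `|A i ord0| <= e / n.+1%:R) -> mnorm A < e.
Proof.
move=> e0 h; rewrite -[ltRHS](gtr0_norm e0) -sqrtr_sqr /mnorm ltr_sqrt ?exprn_gt0 //.
rewrite mnorm2_col.
apply: (@le_lt_trans _ _ (\sum_(i < n) (e / n.+1%:R) ^+ 2)).
  apply: ler_sum => i _; rewrite -(real_normK (num_real (A i ord0))).
  by rewrite ler_sqr ?nnegrE ?divr_ge0 ?(ltW e0) // h.
rewrite sumr_const card_ord -[ltLHS]mulr_natr expr_div_n -mulrA.
rewrite gtr_pMr ?exprn_gt0 // ltr_pdivrMl ?exprn_gt0 // mulr1.
apply: (@lt_le_trans _ _ n.+1%:R); first by rewrite ltr_nat.
by rewrite expr2 ler_peMr // ler1n.
Qed.

(** The partial derivatives are continuous, hence bounded on the compact box; the mean value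
    theorem, one coordinate at a time, carries this to [f], of which [C1map] gives only derivatives
    along the axes. *)
Lemma C1map_bounded {R : realType} n p q (f : 'cV[R]_n -> 'M[R]_(p, q)) (r : R) i j :
  C1map f -> exists L : R, forall v : 'cV[R]_n, (forall l, `|v l ord0| <= r) -> `|f v i j| <= L.
Proof.
move=> [D [hD cD]].
(* For [r < 0] the box is empty, except in dimension 0, where it is a point. *)
have [r0|r0] := ltP r 0.
  case: n f D hD cD => [|n] f D hD cD.
    by exists `|f 0 i j| => v _; rewrite (_ : v = 0) //; apply/matrixP => -[].
  by exists 0 => v /(_ ord0) h; have := le_trans (normr_ge0 _) h; rewrite leNgt r0.
have DB (k : 'I_n) : exists L : R, forall v : 'cV[R]_n, (forall l, `|v l ord0| <= r) -> `|D v k i j| <= L.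
  (* Row vectors, for which compactness of boxes and the extreme value theorem are available. *)
  pose A := [set w : 'rV[R]_n | forall l, `[(- r), r]%classic (w ord0 l)].
  have cA : compact A.
    by apply: (@rV_compact _ _ (fun=> `[(- r), r]%classic)) => l; exact: segment_compact.
  have A0 : A !=set0.
    by exists 0 => l /=; rewrite mxE in_itv /= oppr_le0 r0.
  have cg : {within A, continuous (fun w : 'rV[R]_n => `|D w^T k i j|)}.
    apply: continuous_subspaceT => w; have Fw : Filter (nbhs w) := nbhs_filter w.
    apply/(@cvgrPdist_le _ _ _ (nbhs w) Fw) => e e0.
    have [d d0 H] := cD k w^T e e0.
    apply/nbhs_ballP; exists (d / n.+1%:R); first by rewrite /= divr_gt0.
    move=> w' [_ bw] /=.
    apply: (le_trans (ler_dist_dist _ _)); rewrite distrC.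
    have : mnorm (w'^T - w^T) < d.
      by apply: mnorm_lt => // l; rewrite !mxE distrC; exact/ltW/(bw ord0 l).
    move=> /H h; apply: le_trans h; have := entry_le_mnorm (D w'^T k - D w^T k) i j.
    by rewrite !mxE.
  have [c _ hc] := EVT_max_rV A0 cA cg.
  exists `|D c^T k i j| => v hv; have := hc v^T; rewrite trmxK; apply.
  by rewrite inE => l /=; rewrite mxE in_itv /= -ler_norml.
have [L hL] : exists2 L : R, 0 <= L &
    forall k (v : 'cV[R]_n), (forall l, `|v l ord0| <= r) -> `|D v k i j| <= L.
  have [L0 hL0] := choice DB.
  exists (\sum_k `|L0 k|); first by apply: sumr_ge0.
  move=> k v hv; apply: (le_trans (hL0 k v hv)); apply: (le_trans (ler_norm _)).
  by rewrite (bigD1 k) //= lerDl sumr_ge0.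
move=> DL; exists (`|f 0 i j| + n%:R * (L * r)) => v hv.
(* the path from 0 to [v] that switches on one coordinate at a time *)
pose tr (m : nat) : 'cV[R]_n := \col_l (if (l < m)%N then v l ord0 else 0).
have -> : v = tr n.
  by apply/colP => l; rewrite mxE ltn_ord.
have : forall m, (m <= n)%N -> `|f (tr m) i j| <= `|f 0 i j| + m%:R * (L * r).
  elim=> [_|m IH mn].
    by rewrite mul0r addr0 (_ : tr 0%N = 0) //; apply/colP => l; rewrite !mxE.
  pose k := Ordinal mn.
  have trS : tr m.+1 = tr m + v k ord0 *: delta_mx k ord0.
    apply/colP => l; rewrite !mxE eqxx andbT ltnS leq_eqVlt.
    have [->|lk] := eqVneq l k; first by rewrite eqxx /= ltnn add0r mulr1.
    have -> : (l == m :> nat) = false by apply/negbTE; exact: lk.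
    by rewrite /= mulr0 addr0.
  pose g (s : R) : R := f (tr m + s *: delta_mx k ord0) i j.
  have dg (s : R) : is_derive s 1 g (D (tr m + s *: delta_mx k ord0) k i j).
    set y := tr m + s *: delta_mx k ord0.
    have C : h^-1 *: (g (h *: 1 + s) - g s) @[h --> 0^'] --> D y k i j.
      apply/cvgrPdist_le => e e0; have [d d0 H] := hD y k e e0.
      rewrite /prop_near1 /dnbhs /within /=; apply/nbhs_ballP; exists d => //= h.
      rewrite /ball /= sub0r normrN => hd h0.
      have := H h; rewrite normr_gt0 h0 hd => /(_ isT) {}H; apply: le_trans H.
      have := entry_le_mnorm (h^-1 *: (f (y + h *: delta_mx k ord0) - f y) - D y k) i j.
      rewrite !mxE distrC [h%:A]mulr1 /GRing.scale /= /g -/y.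
      by rewrite (_ : tr m + (h + s) *: delta_mx k ord0 = y + h *: delta_mx k ord0) //
                 /y scalerDl [in RHS]addrAC addrA.
    apply: DeriveDef; first by apply/cvg_ex; exists (D y k i j).
    by apply/cvg_lim => //; exact: Rhausdorff.
  have in_box s : `|s| <= r -> forall l, `|(tr m + s *: delta_mx k ord0) l ord0| <= r.
    move=> sr l; rewrite !mxE eqxx andbT.
    have [->|lk] := eqVneq l k; first by rewrite /= ltnn add0r mulr1.
    by rewrite mulr0 addr0; case: ifP => _; rewrite ?normr0.
  have step : `|g (v k ord0) - g 0| <= L * r.
    have cg (a b : R) : {within `[a, b], continuous g}.
      apply: continuous_subspaceT => x; have [Dx _] := dg x.
      exact/differentiable_continuous/derivable1_diffP.
    have vk := hv k; rewrite ler_norml in vk; have /andP[vk1 vk2] := vk.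
    have [s0|s0] := leP 0 (v k ord0).
      have [c] := MVT_segment s0 (fun x _ => dg x) (cg _ _).
      rewrite in_itv /= => /andP[c0 c1] ->; rewrite subr0 normrM.
      apply: ler_pM => //.
      by apply: DL; apply: in_box; rewrite ger0_norm // (le_trans c1).
    have [c] := MVT_segment (ltW s0) (fun x _ => dg x) (cg _ _).
    rewrite in_itv /= => /andP[c0 c1] E; rewrite distrC E sub0r normrM normrN.
    apply: ler_pM => //.
    by apply: DL; apply: in_box; rewrite ler0_norm // lerNl (le_trans vk1).
  have -> : f (tr m.+1) i j = g (v k ord0) by rewrite /g -trS.
  have g0 : g 0 = f (tr m) i j by rewrite /g scale0r addr0.
  rewrite g0 in step; have := IH (ltnW mn); move: step.
  have -> : m.+1%:R * (L * r) = m%:R * (L * r) + L * r by rewrite -natr1; ring.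
  set u := g _; set w := f _ _ _; set z := m%:R * _ => h1 h2.
  have := ler_normD (u - w) w; rewrite subrK; lra.
by move=> /(_ n (leqnn n)).
Qed.

(** * Components of profiles and of the integral operators *)

Lemma L1R_sum {R : realType} (I : Type) (r : seq I) (f : I -> R -> R) :
  (forall i, L1R (f i)) -> L1R (fun x => \sum_(i <- r) f i x) /\
  itg (fun x => \sum_(i <- r) f i x) = \sum_(i <- r) itg (f i).
Proof.
move=> hf; elim: r => [|i r [IH1 IH2]].
  rewrite (_ : (fun x => _) = (fun=> 0)); first by rewrite big_nil itg0; split => //; exact: L1R0.
  by apply/funext => x; rewrite big_nil.
rewrite (_ : (fun x => _) = (fun x => f i x + \sum_(j <- r) f j x)).
  by split; [exact: L1RD|rewrite big_cons itgD // IH2].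
by apply/funext => x; rewrite big_cons.
Qed.

Lemma isL2_L2R {R : realType} n (f : R -> 'cV[R]_n) : isL2 f ->
  forall i, L2R (zext (fun x => f x i ord0)).
Proof.
move=> [mf If] i; split; first exact/measurable_zext.
have mn : measurable_fun I01 (fun x => mnorm2 (f x)).
  under eq_fun do rewrite mnorm2_col.
  by apply: measurable_sum => k; apply: measurable_funX.
have IM : L1R (zext (fun x => mnorm2 (f x))).
  apply/L1R_zext/integrableP; split; first exact/measurable_EFinP.
  apply: le_lt_trans If; rewrite le_eqVlt; apply/orP; left; apply/eqP.
  by apply: eq_integral => x _ /=; rewrite ger0_norm // mnorm2_ge0.
rewrite -zext_sqr; apply: (L1R_le _ _ IM).
  by apply/measurable_zext; apply: measurable_funX.
move=> x; rewrite /zext normrM; have /andP[h0 _] := @ind01 R (0 <= x <= 1).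
rewrite (ger0_norm h0) ger0_norm ?sqr_ge0 // ler_wpM2l //; exact: sqr_entry_le.
Qed.

Lemma L2norm2_itg {R : realType} n (f : R -> 'cV[R]_n) :
  (forall i, L2R (zext (fun x => f x i ord0))) ->
  L2norm2 f = \sum_i itg (fun x => zext (fun y => f y i ord0) x ^+ 2).
Proof.
move=> hf; rewrite -(L1R_sum _ (fun i => (hf i).2)).2 /L2norm2 -itg_zext.
apply: eq_itg => x; rewrite /zext mnorm2_col mulr_sumr; apply: eq_bigr => i _.
by rewrite exprMn ind_sqr.
Qed.

Lemma L2norm2_ge0 {R : realType} n (f : R -> 'cV[R]_n) : 0 <= L2norm2 f.
Proof. by apply: Rintegral_ge0 => x _; exact: mnorm2_ge0. Qed.

Lemma isH1_primitive01 {R : realType} n (f g : R -> 'cV[R]_n) : isH1 f g -> f 0 = 0 ->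
  forall i, primitive01 (fun x => f x i ord0) (fun x => g x i ord0).
Proof. by move=> [_ [_ E]] f0 i x x01; rewrite E // f0 add0r mxE. Qed.

Lemma cont01_L2R {R : realType} m n (K : R -> 'M[R]_(m, n)) i j : cont01 K ->
  L2R (zext (fun x => K x i j)).
Proof.
move=> cK.
have c : {within I01, continuous (fun x => K x i j)}.
  apply/subspace_continuousP => x; rewrite /I01 /= in_itv /= => x01.
  apply/cvgrPdist_le => e e0; have [d d0 H] := cK x x01 e e0.
  rewrite /prop_near1 /within /=; apply/nbhs_ballP; exists d => //= y.
  rewrite /ball /= distrC => yd; rewrite /I01 /= in_itv /= => y01; rewrite distrC.
  by have := entry_le_mnorm (K y - K x) i j; rewrite !mxE => h; apply: (le_trans h); exact: H.
split; first by apply: L1R_measurable; exact: L1R_zext_continuous.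
rewrite -zext_sqr; apply: L1R_zext_continuous => x.
by apply: (@continuousM _ (subspace I01)); exact: c.
Qed.

Lemma Kop2E {R : realType} n (K : R -> 'M[R]_n) (f : R -> 'cV[R]_n) : cont01 K ->
  (forall j, L2R (zext (fun x => f x j ord0))) ->
  forall i, Kop2 K f i ord0 =
    \sum_j itg (fun x => zext (fun y => K y i j) x * zext (fun y => f y j ord0) x).
Proof.
move=> cK hf i; rewrite mxE.
rewrite -(L1R_sum _ (fun j => L2R_mul (cont01_L2R i j cK) (hf j))).2 -itg_zext.
apply: eq_itg => x; rewrite /zext mxE mulr_sumr; apply: eq_bigr => j _.
by rewrite mulrACA -expr2 ind_sqr.
Qed.

Lemma Kop2B {R : realType} n (K : R -> 'M[R]_n) (f g : R -> 'cV[R]_n) : cont01 K ->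
  (forall j, L2R (zext (fun x => f x j ord0))) ->
  (forall j, L2R (zext (fun x => g x j ord0))) ->
  Kop2 K f - Kop2 K g = Kop2 K (fun x => f x - g x).
Proof.
move=> cK hf hg.
have E j : (fun x => (f x - g x) j ord0) = (fun x => f x j ord0 + (-1) * g x j ord0).
  by apply/funext => x; rewrite !mxE mulN1r.
have hfg j : L2R (zext (fun x => (f x - g x) j ord0)).
  by rewrite E; exact: L2R_zext_lin.
apply/colP => i; rewrite (Kop2E cK hfg) mxE (Kop2E cK hf) mxE (Kop2E cK hg) -sumrB.
apply: eq_bigr => j _; rewrite -itgB; try exact: (L2R_mul (cont01_L2R _ _ cK)).
by apply: eq_itg => x; rewrite E zext_lin; ring.
Qed.

(** Cauchy-Schwarz in [x] against each kernel entry: only the [L^2] size of the profile matters. *)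
Lemma Kop2_decay {R : realType} n (K : R -> 'M[R]_n) (f : R -> R -> 'cV[R]_n) k B : cont01 K ->
  (forall t, 0 <= t -> forall j, L2R (zext (fun x => f t x j ord0))) ->
  (forall t, 0 <= t -> forall j, itg (fun x => zext (fun y => f t y j ord0) x ^+ 2) <= B * expR (- k * t)) ->
  forall i, expdec k (fun t => Kop2 K (f t) i ord0).
Proof.
move=> cK hf hB i.
have h j : expdec k (fun t => itg (fun x => zext (fun y => K y i j) x * zext (fun y => f t y j ord0) x)).
  exists (itg (fun x => zext (fun y => K y i j) x ^+ 2) * B) => t t0.
  apply: (le_trans (itg_CS (cont01_L2R i j cK) (hf t t0 j))).
  rewrite -mulrA; apply: ler_wpM2l; last exact: hB.
  by apply: itg_ge0 => x; exact: sqr_ge0.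
have [L hL] := expdec_sum (index_enum 'I_n) h.
by exists L => t t0; rewrite (Kop2E cK (hf t t0)); exact: hL.
Qed.

Lemma expdec_mulmx {R : realType} k m n (P : R -> 'M[R]_(m, n)) (y : R -> 'cV[R]_n) :
  (forall i j, expdec 0 (fun t => P t i j)) -> (forall j, expdec k (fun t => y t j ord0)) ->
  forall i, expdec k (fun t => (P t *m y t) i ord0).
Proof.
move=> hP hy i; under [X in expdec _ X]eq_fun do rewrite mxE.
by apply: expdec_sum => j; exact: expdecM0.
Qed.

Lemma expdec_cst {R : realType} (c : R) : expdec 0 (fun=> c).
Proof. by exists (c ^+ 2) => t _; rewrite oppr0 mul0r expR0 mulr1. Qed.

Lemma expdec0_bounded {R : realType} n (f : R -> 'cV[R]_n) :
  (forall i, expdec 0 (fun t => f t i ord0)) ->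
  exists2 r, 0 <= r & forall t i, 0 <= t -> `|f t i ord0| <= r.
Proof.
move=> /expdec_mnorm2 [K K0 H]; exists (K + 1); first by rewrite addr_ge0.
move=> t i t0; have := H t t0; rewrite oppr0 mul0r expR0 mulr1.
have := sqr_entry_le (f t) i ord0; rewrite -(real_normK (num_real (f t i ord0))).
by have := sqr_ge0 (`|f t i ord0| - 1); move: `|_| (mnorm2 _) => a b; nra.
Qed.

Lemma expdec0P {R : realType} (f : R -> R) (C : R) :
  (forall t, 0 <= t -> f t ^+ 2 <= C) -> expdec 0 f.
Proof. by move=> h; exists C => t t0; rewrite oppr0 mul0r expR0 mulr1; exact: h. Qed.

(** * The observer error *)

Lemma expdec_unif {R : realType} (I : finType) (k : R) (f : I -> R -> R) :
  (forall i, expdec k (f i)) ->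
  exists2 K, 0 <= K & forall i t, 0 <= t -> f i t ^+ 2 <= K * expR (- k * t).
Proof.
move=> h; have [K hK] := choice h; exists (\sum_i `|K i|).
  by apply: sumr_ge0.
move=> i t t0; apply: (le_trans (hK i t t0)); apply: ler_wpM2r; first exact: expR_ge0.
by apply: (le_trans (ler_norm _)); rewrite (bigD1 i) //= lerDl sumr_ge0.
Qed.

Lemma pos_lower_bound {R : realType} (I : finType) (a : I -> R) : (forall i, 0 < a i) ->
  exists2 a0, 0 < a0 & forall i, a0 <= a i.
Proof.
(* The inverse of [1] plus the sum of the inverses avoids a minimum over a possibly empty set. *)
move=> ha; pose S := 1 + \sum_i (a i)^-1.
have s0 : 0 <= \sum_i (a i)^-1 by apply: sumr_ge0 => i _; rewrite invr_ge0 ltW.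
have S0 : 0 < S by rewrite ltr_pwDl.
exists S^-1; first by rewrite invr_gt0.
move=> i; rewrite -[a i]invrK lef_pV2 ?posrE ?invr_gt0 //.
rewrite /S (bigD1 i) //= addrCA lerDl addr_ge0 // sumr_ge0 // => j _.
by rewrite invr_ge0 ltW.
Qed.

Lemma diagc_mulE {R : realType} n p (a : 'cV[R]_n) (S : 'M[R]_(n, p)) i j :
  (diagc a *m S) i j = a i ord0 * S i j.
Proof. by rewrite /diagc mul_diag_mx !mxE. Qed.

Lemma diagcB {R : realType} n (a b : 'cV[R]_n) : diagc a - diagc b = diagc (a - b).
Proof. by rewrite /diagc !linearB. Qed.

Lemma sqrtr_le_sqr {R : realType} (x y : R) : 0 <= x -> Num.sqrt x <= y -> x <= y ^+ 2.
Proof.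
move=> x0 h; rewrite -(sqr_sqrtr x0); have s0 := sqrtr_ge0 x.
by rewrite ler_sqr ?nnegrE // (le_trans s0).
Qed.

Lemma classical_reg_L2R {R : realType} nX nz (X dX : R -> 'cV[R]_nX)
    (z zt zxi : R -> R -> 'cV[R]_nz) : classical_reg X dX z zt zxi ->
  forall i t, 0 <= t -> L2R (zext (fun x => z t x i ord0)) /\
    L2R (zext (fun x => zt t x i ord0)) /\ L2R (zext (fun x => zxi t x i ord0)).
Proof.
move=> [r1 [_ [_ [r4 _]]]] i t t0; have [h1 h2] := r1 t t0.
by have [[_ [h3 _]] _] := r4 t t0; split; [|split]; exact: isL2_L2R.
Qed.

Lemma classical_reg_primitive {R : realType} nX nz (X dX : R -> 'cV[R]_nX)
    (z zt zxi : R -> R -> 'cV[R]_nz) : classical_reg X dX z zt zxi ->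
  forall i t, 0 <= t -> primitive01 (fun x => z t x i ord0) (fun x => zxi t x i ord0).
Proof.
move=> [_ [_ [_ [r4 _]]]] i t t0; have [h z0] := r4 t t0.
exact: isH1_primitive01.
Qed.

Lemma classical_reg_hderiv {R : realType} nX nz (X dX : R -> 'cV[R]_nX)
    (z zt zxi : R -> R -> 'cV[R]_nz) : classical_reg X dX z zt zxi ->
  forall t, 0 <= t -> forall i, hderiv (fun s => X s i ord0) t (dX t i ord0).
Proof.
move=> [_ [r2 _]] t t0 i e e0; have [d d0 H] := r2 t t0 e e0.
exists d => // s s0 st; apply: le_trans (H s s0 st).
rewrite -sqrtr_sqr ler_wsqrtr //.
have := sqr_entry_le (X s - X t - (s - t) *: dX t) i ord0; rewrite !mxE => h.
by apply: (le_trans h); rewrite lerDl L2norm2_ge0.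
Qed.

(** The remainder of differentiability in the state space, reduced to one component: the form that
    differentiating the energy of a difference requires. *)
Lemma classical_reg_time_diff {R : realType} nX nz (X dX : R -> 'cV[R]_nX)
    (z zt zxi : R -> R -> 'cV[R]_nz) : classical_reg X dX z zt zxi ->
  forall i t, 0 <= t -> forall e : R, 0 < e -> exists2 d : R, 0 < d &
    forall s : R, 0 <= s -> `|s - t| < d ->
    itg (fun x => zext (fun w => z s w i ord0 - z t w i ord0 - (s - t) * zt t w i ord0) x ^+ 2)
      <= (e * `|s - t|) ^+ 2.
Proof.
move=> reg i t t0 e e0; have hL := classical_reg_L2R reg; move: reg => [_ [r2 _]].
have [d d0 H] := r2 t t0 e e0; exists d => // s s0 st; have := H s s0 st.
set r := fun x => z s x - z t x - (s - t) *: zt t x.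
have rE j : (fun x => r x j ord0) = (fun w => z s w j ord0 - z t w j ord0 - (s - t) * zt t w j ord0).
  by apply/funext => x; rewrite !mxE.
have hr j : L2R (zext (fun x => r x j ord0)).
  have [h1 _] := hL j s s0; have [h2 [h3 _]] := hL j t t0; rewrite rE.
  have := L2R_zext_lin (- (s - t)) (L2R_zext_lin (-1) h1 h2) h3.
  by congr L2R; congr zext; apply/funext => y; ring.
move=> /sqrtr_le_sqr h; have := h (addr_ge0 (mnorm2_ge0 _) (L2norm2_ge0 _)).
apply: le_trans; apply: (@le_trans _ _ (L2norm2 r)); last by rewrite lerDr mnorm2_ge0.
rewrite (L2norm2_itg hr) (bigD1 i) //= -rE lerDl; apply: sumr_ge0 => j _.
by apply: itg_ge0 => x; exact: sqr_ge0.
Qed.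

Lemma itg_zext_sqr_le {R : realType} (f : R -> R) C : L2R (zext f) ->
  (forall x, 0 <= x <= 1 -> f x ^+ 2 <= C) -> itg (fun x => zext f x ^+ 2) <= C.
Proof.
move=> [_ hf] hC.
have i1 : L1R (fun t => ind (0 <= t <= 1) : R).
  by apply: (@L1R_ind_itv _ true false 0 1) => t; rewrite in_itv.
have -> : C = itg (fun x => C * ind (0 <= x <= 1)).
  rewrite itgZ // (@itg_ind_itv _ true false 0 1) => [|//|t]; last by rewrite in_itv.
  by rewrite subr0 mulr1.
apply: itg_le => //; first exact: L1RZ.
move=> x; have [x01|x01] := boolP (0 <= x <= 1).
  by rewrite zext_in // /ind mulr1 hC.
by rewrite zext_out // expr0n /ind mulr0.
Qed.

(** The error satisfies [eps' = - rho * eps] exactly: [dY1] cancels against its copy in [zeta2], and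
    the unknown sum of [theta_i W_i] enters through [zeta2] and through [phi] with opposite
    signs. *)
Lemma prediction_error_decay {R : realType} n (rho : R) (theta : 'cV[R]_n)
    (W Y1 dY1 phi dphi : R -> 'cV[R]_n) (zeta1 dzeta1 zeta2 dzeta2 : R -> 'cV[R]_1) :
  0 < rho -> C1nonneg Y1 dY1 -> C1nonneg zeta1 dzeta1 -> C1nonneg zeta2 dzeta2 ->
  C1nonneg phi dphi ->
  (forall t, 0 <= t -> dzeta1 t = - rho *: (zeta1 t - (const_mx 1 : 'cV[R]_n)^T *m Y1 t)) ->
  (forall t, 0 <= t -> dzeta2 t = - rho *: zeta2 t
     + (const_mx 1 : 'cV[R]_n)^T *m (diagc theta *m W t + dY1 t)) ->
  (forall t, 0 <= t -> dphi t = - rho *: phi t + - W t) ->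
  expdec (rho / 2) (fun t => ((const_mx 1 : 'cV[R]_n)^T *m Y1 t - (zeta1 t + zeta2 t)) ord0 ord0
     - \sum_i theta i ord0 * phi t i ord0).
Proof.
move=> rho0 CY C1 C2 Cp E1 E2 Ep.
pose Z t := ((const_mx 1 : 'cV[R]_n)^T *m Y1 t) ord0 ord0.
have ZE t : Z t = \sum_j Y1 t j ord0.
  by rewrite /Z mxE; apply: eq_bigr => j _; rewrite !mxE mul1r.
pose df t := \sum_j dY1 t j ord0 - (dzeta1 t ord0 ord0 + dzeta2 t ord0 ord0)
  - \sum_i theta i ord0 * dphi t i ord0.
apply: (@linear_decay _ rho (rho / 2) _ df (fun=> 0)) => //.
- by lra.
- move=> t t0; apply: hderivB; last first.
    by apply: hderiv_sum => i; apply: hderivZ; exact: C1nonneg_hderiv.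
  have -> : (fun s => ((const_mx 1 : 'cV[R]_n)^T *m Y1 s - (zeta1 s + zeta2 s)) ord0 ord0) =
      (fun s => \sum_j Y1 s j ord0 - (zeta1 s ord0 ord0 + zeta2 s ord0 ord0)).
    by apply/funext => s; rewrite -ZE /Z [LHS]mxE [X in _ + X]mxE [X in _ - X]mxE.
  apply: hderivB; first by apply: hderiv_sum => j; exact: C1nonneg_hderiv.
  by apply: hderivD; exact: C1nonneg_hderiv.
- move=> t /ltW t0; rewrite addr0.
  have -> : ((const_mx 1 : 'cV[R]_n)^T *m Y1 t - (zeta1 t + zeta2 t)) ord0 ord0 =
     Z t - (zeta1 t ord0 ord0 + zeta2 t ord0 ord0).
    by rewrite /Z [LHS]mxE [X in _ + X]mxE [X in _ - X]mxE.
  have d1 : dzeta1 t ord0 ord0 = - rho * (zeta1 t ord0 ord0 - Z t).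
    by rewrite E1 // [LHS]mxE [X in _ * X]mxE [X in _ * (_ + X)]mxE.
  have d2 : dzeta2 t ord0 ord0 = - rho * zeta2 t ord0 ord0
      + (\sum_j theta j ord0 * W t j ord0 + \sum_j dY1 t j ord0).
    rewrite E2 // [LHS]mxE [X in X + _]mxE; congr (_ + _).
    rewrite mxE -big_split; apply: eq_bigr => j _ /=.
    by rewrite [X in X * _]mxE [X in X * _]mxE mul1r [LHS]mxE diagc_mulE.
  have d3 : \sum_i theta i ord0 * dphi t i ord0 = - rho * (\sum_i theta i ord0 * phi t i ord0)
      - \sum_j theta j ord0 * W t j ord0.
    rewrite Ep // mulr_sumr -sumrB; apply: eq_bigr => j _; rewrite !mxE; ring.
  by rewrite /df d1 d2 d3; ring.
- exact: expdec0.
Qed.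

Unset Implicit Arguments.

Theorem theorem3p3 (R : realType) (nX nz nU : nat)
  (A1 : 'M[R]_nX) (A2 : 'M[R]_(nz, nX)) (G1 : 'M[R]_(nX, nz)) (G2 : 'M[R]_(nz, nU))
  (lam theta : 'cV[R]_nz)
  (K1 K3 : R -> 'M[R]_nz) (K2 : 'M[R]_nz)
  (Sigma : 'cV[R]_nz -> 'M[R]_nz) (h1 h2 h2inv : 'cV[R]_nz -> 'cV[R]_nz)
  (U dU : R -> 'cV[R]_nU)
  (X dX : R -> 'cV[R]_nX) (z zt zxi : R -> R -> 'cV[R]_nz)
  (dY1 : R -> 'cV[R]_nz)
  (rho psi : R) (Gamma : 'M[R]_nz)
  (zeta1 dzeta1 zeta2 dzeta2 : R -> 'cV[R]_1)
  (vphi dvphi thh dthh Q dQ : R -> 'cV[R]_nz) (Rm dRm : R -> 'M[R]_nz)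
  (L1 : 'M[R]_(nX, nz))
  (Xh dXh : R -> 'cV[R]_nX) (zh zht zhxi : R -> R -> 'cV[R]_nz) :
  (* structural hypotheses *)
  (0 < nX)%N -> (0 < nz)%N -> (0 < nU)%N ->
  (forall i, 0 < lam i ord0) -> (forall i, 0 < theta i ord0) ->
  cont01 K1 -> cont01 K3 ->
  C1map Sigma -> C1map h1 -> C1map h2 ->
  cancel h2 h2inv -> cancel h2inv h2 ->
  C1nonneg U dU ->
  let Lam := diagc lam in
  let Theta := diagc theta in
  let v t := A2 *m X t + G2 *m U t in
  (* (X, z) is a classical solution of the ODE-PDE system *)
  classical_reg X dX z zt zxi ->
  (forall t, 0 < t ->
     dX t = A1 *m X t + G1 *m Kop1 K1 K2 (z t)
            + G1 *m Theta *m Sigma (v t) *m Kop2 K3 (z t)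
            + G1 *m h1 (v t)) ->
  (forall t, 0 < t -> {ae @lebesgue_measure R, forall x, 0 <= x <= 1 ->
     zt t x + Lam *m zxi t x = Theta *m Sigma (v t) *m z t x + h2 (v t)}) ->
  (* Assumption (A1) *)
  (exists M, forall t, 0 <= t -> mnorm2 (X t) + H1norm2 (z t) (zxi t) <= M) ->
  (exists M, forall t, 0 <= t -> mnorm (U t) <= M) ->
  (* Assumption (A2) *)
  detectable A1 A2 ->
  (* measurements *)
  let Y1 t := h2 (v t) in
  C1nonneg Y1 dY1 ->
  let Y2 t := Theta *m Lam *m Sigma (h2inv (Y1 t)) *m invmx Lam *m Y1 t + dY1 t in
  (* adaptive law *)
  let one := const_mx 1 : 'cV[R]_nz in
  let Z1 t := one^T *m Y1 t in
  let Z2 t := one^T *m Y2 t in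
  let phi t := - (Lam *m Sigma (h2inv (Y1 t)) *m invmx Lam *m Y1 t) in
  0 < rho -> 0 < psi -> spd Gamma ->
  C1nonneg zeta1 dzeta1 -> C1nonneg zeta2 dzeta2 -> C1nonneg vphi dvphi ->
  C1nonneg thh dthh -> C1nonneg Rm dRm -> C1nonneg Q dQ ->
  (forall t, 0 <= t -> dzeta1 t = - rho *: (zeta1 t - Z1 t)) ->
  (forall t, 0 <= t -> dzeta2 t = - rho *: zeta2 t + Z2 t) ->
  (forall t, 0 <= t -> dvphi t = - rho *: vphi t + phi t) ->
  let zeta t := zeta1 t + zeta2 t in
  (forall t, 0 <= t -> dthh t = - (Gamma *m (Rm t *m thh t + Q t))) ->
  (forall t, 0 <= t -> dRm t = - psi *: Rm t
       + (1 + mnorm2 (vphi t))^-1 *: (vphi t *m (vphi t)^T)) ->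
  (forall t, 0 <= t -> dQ t = - psi *: Q t
       - (1 + mnorm2 (vphi t))^-1 *: ((Z1 t - zeta t) ord0 ord0 *: vphi t)) ->
  let Thh t := diagc (thh t) in
  (* observer *)
  hurwitz (A1 + L1 *m A2) ->
  let Y1h t := h2 (A2 *m Xh t + G2 *m U t) in
  classical_reg Xh dXh zh zht zhxi ->
  (forall t, 0 < t ->
     dXh t = A1 *m Xh t + G1 *m Kop1 K1 K2 (zh t)
             + G1 *m Thh t *m Sigma (h2inv (Y1 t)) *m Kop2 K3 (zh t)
             + G1 *m h1 (h2inv (Y1 t))
             - L1 *m (h2inv (Y1 t) - h2inv (Y1h t))) ->
  (forall t, 0 < t -> {ae @lebesgue_measure R, forall x, 0 <= x <= 1 ->
     zht t x + Lam *m zhxi t x = Thh t *m Sigma (h2inv (Y1 t)) *m zh t x + Y1 t}) ->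
  (* observer error is a classical solution *)
  let Xe t := X t - Xh t in
  let ze t x := z t x - zh t x in
  classical_reg Xe (fun t => dX t - dXh t) ze
    (fun t x => zt t x - zht t x) (fun t x => zxi t x - zhxi t x) ->
  let Ynorm t := Num.sqrt (mnorm2 (Xe t) +
                   H1norm2 (ze t) (fun x => zxi t x - zhxi t x)) in
  (* conclusions *)
  (exists M, forall t, 0 <= t -> Ynorm t <= M) /\
  ((exists M, forall t, 0 <= t -> mnorm (vphi t) <= M) ->
   (exists T0 a0, 0 < T0 /\ 0 < a0 /\ forall t, 0 <= t ->
      forall x : 'cV[R]_nz,
        a0 * mnorm2 x <= (x^T *m mint t (t + T0) (fun s => vphi s *m (vphi s)^T) *m x) ord0 ord0) ->
   exists c kappa, 0 < c /\ 0 < kappa /\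
     forall t, 0 <= t -> Ynorm t <= kappa * expR (- c * t)).
Proof.
move=> nX0 nz0 nU0 lam_pos th_pos cK1 cK3 CS Ch1 Ch2 hK hK' CU Lam Theta v reg EX EZ
  [MA bA] [MU bU] detA Y1 CY1 Y2 one Z1 Z2 phi rho0 psi0 sG Cz1 Cz2 Cphi Cth CR CQ
  Ez1 Ez2 Ephi zeta Eth ER EQ Thh hur Y1h regh EXh EZh Xe ze rege Ynorm.
(* The measurement determines [v], so plant, filters and observer share the same [Sigma (v t)]. *)
have vE t : h2inv (Y1 t) = v t by exact: hK.
have dX0 i : expdec 0 (fun t => X t i ord0).
  apply: (expdec0P (C := MA)) => t t0; apply: (le_trans (sqr_entry_le (X t) i ord0)).
  by apply: le_trans (bA t t0); rewrite lerDl addr_ge0 // L2norm2_ge0.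
have dU0 i : expdec 0 (fun t => U t i ord0).
  apply: (expdec0P (C := MU ^+ 2)) => t t0; apply: (le_trans (sqr_entry_le (U t) i ord0)).
  by apply: sqrtr_le_sqr; [exact: mnorm2_ge0|exact: bU].
have cst0 m p (A : 'M[R]_(m, p)) i j : expdec 0 (fun=> A i j) by exact: expdec_cst.
have dv i : expdec 0 (fun t => v t i ord0).
  rewrite /v; under [X in expdec _ X]eq_fun do rewrite mxE.
  by apply: expdecD; apply: expdec_mulmx.
have [r _ hr] := expdec0_bounded dv.
(* [v] stays in a fixed box, on which the continuously differentiable [Sigma] is bounded. *)
have dS i j : expdec 0 (fun t => Sigma (v t) i j).
  have [L hL] := C1map_bounded r i j CS.
  apply: (expdec0P (C := L ^+ 2)) => t t0.
  rewrite -(real_normK (num_real (Sigma (v t) i j))) ler_sqr ?nnegrE //.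
    by apply: hL => l; exact: hr.
  by apply: le_trans (hL (v t) (fun l => hr t l t0)).
(* [phi] is [- W] and [Y2] is [Theta *m W + dY1]: the same signal feeds regressor and filter. *)
pose W t := Lam *m Sigma (v t) *m invmx Lam *m Y1 t.
have heps : expdec (rho / 2) (fun t => (Z1 t - zeta t) ord0 ord0
    - \sum_i theta i ord0 * vphi t i ord0).
  apply: (@prediction_error_decay _ _ _ _ W _ _ _ _ _ _ _ _ rho0 CY1 Cz1 Cz2 Cphi) => //.
  - by move=> t t0; rewrite Ez2 // /Z2 /Y2 vE /W !mulmxA.
  - by move=> t t0; rewrite Ephi // /phi vE.
have Ey t : 0 <= t -> (Z1 t - zeta t) ord0 ord0 = \sum_i theta i ord0 * vphi t i ord0
    + ((Z1 t - zeta t) ord0 ord0 - \sum_i theta i ord0 * vphi t i ord0).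
  by move=> _; rewrite [RHS]addrC subrK.
have rho2 : 0 < rho / 2 by rewrite divr_gt0.
have hcol (F dF : R -> 'cV[R]_nz) : C1nonneg F dF ->
   forall t, 0 <= t -> forall i, hderiv (fun s => F s i ord0) t (dF t i ord0).
  by move=> CF t t0 i; exact: C1nonneg_hderiv.
have [te0 tePE] := adaptive_error_decay sG psi0 rho2 (hcol _ _ Cphi) (hcol _ _ Cth)
  (hcol _ _ CQ) (C1nonneg_hderiv CR) Eth ER EQ Ey heps.
have dth i : expdec 0 (fun t => thh t i ord0).
  have := expdecD (expdec_cst (theta i ord0)) (expdecN (te0 i)).
  by congr expdec; apply/funext => t; ring.
pose te t : 'cV[R]_nz := theta - thh t.
have teE i t : te t i ord0 = theta i ord0 - thh t i ord0 by rewrite !mxE.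
have TE t : Theta - Thh t = diagc (te t) by rewrite /Theta /Thh diagcB.
have [lam0 lam00 lamge] := pos_lower_bound lam_pos.
have [kap kap0 Hkap] := hurwitz_decay nX0 hur.
have regL := classical_reg_L2R reg; have regeL := classical_reg_L2R rege.
have regP := classical_reg_primitive reg; have regeP := classical_reg_primitive rege.
pose gx t x := zxi t x - zhxi t x.
(* Both conclusions at once: [k = 0] is available unconditionally, [0 < k] under excitation. *)
have core k : 0 <= k -> (forall i, expdec k (fun t => theta i ord0 - thh t i ord0)) ->
  exists2 K, 0 <= K & forall t, 0 <= t ->
    mnorm2 (Xe t) + H1norm2 (ze t) (gx t) <= K * expR (- Num.min k kap * t).
  move=> k0 dte0.
  have dte i : expdec k (fun t => te t i ord0) by under eq_fun do rewrite teE; exact: dte0.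
  (* The estimate [Thh], merely bounded, multiplies the profile error; the parameter error, which
     may decay, multiplies [z], bounded by assumption. *)
  pose Mm t := Thh t *m Sigma (v t); pose Nm t := diagc (te t) *m Sigma (v t).
  have dM (ij : 'I_nz * 'I_nz) : expdec 0 (fun t => Mm t ij.1 ij.2).
    by under [X in expdec _ X]eq_fun do rewrite diagc_mulE; exact: expdecM0.
  have dN (ij : 'I_nz * 'I_nz) : expdec k (fun t => Nm t ij.1 ij.2).
    under [X in expdec _ X]eq_fun do rewrite diagc_mulE mulrC; exact: expdecM0.
  have [KM KM0 hKM] := expdec_unif dM; have [KN KN0 hKN] := expdec_unif dN.
  have [K K0 hgx] : exists2 K, 0 <= K & forall i t, 0 <= t ->
      itg (fun x => zext (fun y => gx t y i ord0) x ^+ 2) <= K * expR (- k * t).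
    (* [KM + 1] bounds the entries of [Mm] through [a <= a ^+ 2 + 1]; [MA], from the boundedness
       assumption, bounds the gradient of [z]. *)
    apply: (@transport_gradient_bound R nz (fun i t x => ze t x i ord0)
      (fun i t x => (zt t x - zht t x) i ord0) (fun i t x => gx t x i ord0)
      (fun i t x => z t x i ord0) (fun i t x => zxi t x i ord0)
      (fun i j t => Mm t i j) (fun i j t => Nm t i j) (fun i => lam i ord0)
      lam0 (KM + 1) KN k MA) => //.
    - by rewrite addr_ge0.
    - by move=> i t t0; have [q1 [_ q3]] := regL i t t0.
    - by move=> i t t0; split; [exact: regeP|exact: regP].
    - move=> i t t0; have hg j : L2R (zext (fun x => zxi t x j ord0)) by have [_ []] := regL j t t0.
      apply: le_trans (bA t t0); apply: (@le_trans _ _ (L2norm2 (zxi t))).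
        rewrite (L2norm2_itg hg) (bigD1 i) //= lerDl; apply: sumr_ge0 => j _.
        by apply: itg_ge0 => x; exact: sqr_ge0.
      by rewrite /H1norm2 addrA lerDr addr_ge0 ?mnorm2_ge0 ?L2norm2_ge0.
    - exact: classical_reg_time_diff rege.
    - move=> t t0 i.
      have F := ae_filter_ringOfSetsType (@lebesgue_measure R).
      move: (EZ t t0) (EZh t t0); apply: (@filterS2 _ _ F) => x p1 p2 x01.
      have {}p1 := p1 x01; have {}p2 := p2 x01; rewrite vE in p2.
      (* The source [h2 (v t)] occurs in both equations and cancels, leaving no term that is
         constant in space. *)
      have E : (zt t x - zht t x) + Lam *m gx t x = Mm t *m ze t x + Nm t *m z t x.
        transitivity ((zt t x + Lam *m zxi t x) - (zht t x + Lam *m zhxi t x)).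
          by rewrite /gx mulmxBr opprD addrACA.
        rewrite p1 p2 opprD addrACA /Y1 subrr addr0 /Nm -TE /Mm /ze mulmxBr !mulmxBl.
        by rewrite [RHS]addrC addrA subrK.
      have := congr1 (fun A : 'cV[R]_nz => A i ord0) E.
      by rewrite mxE diagc_mulE => ->; rewrite !mxE.
    - move=> i j t t0; have := hKM (i, j) t t0; rewrite oppr0 mul0r expR0 mulr1 /=.
      rewrite -(real_normK (num_real (Mm t i j))).
      by have := sqr_ge0 (`|Mm t i j| - 1); move: `|_| => a; nra.
    - by move=> i j t t0; exact: hKN (i, j) t t0.
  have sup i t x : 0 <= t -> 0 <= x <= 1 -> ze t x i ord0 ^+ 2 <= K * expR (- k * t).
    move=> t0 x01; have [_ [_ hg]] := regeL i t t0.
    exact: le_trans (primitive01_sup hg (regeP i t t0) x01) (hgx i t t0).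
  have hze i t : 0 <= t -> itg (fun x => zext (fun y => ze t y i ord0) x ^+ 2) <= K * expR (- k * t).
    move=> t0; have [h _] := regeL i t t0; apply: itg_zext_sqr_le => // x x01; exact: sup.
  have zeL t : 0 <= t -> forall j, L2R (zext (fun x => ze t x j ord0)).
    by move=> t0 j; have [] := regeL j t t0.
  have gxL t : 0 <= t -> forall j, L2R (zext (fun x => gx t x j ord0)).
    by move=> t0 j; have [_ []] := regeL j t t0.
  have zL t : 0 <= t -> forall j, L2R (zext (fun x => z t x j ord0)).
    by move=> t0 j; have [] := regL j t t0.
  have zhL t : 0 <= t -> forall j, L2R (zext (fun x => zh t x j ord0)).
    by move=> t0 j; have [] := classical_reg_L2R regh j t0.
  pose k1 := Num.min k kap.
  have k1k : k1 <= k by rewrite ge_min lexx.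
  have k1kap : k1 <= kap by rewrite ge_min lexx orbT.
  (* What drives [Xe] apart from its own linear dynamics; each summand contains the profile error or
     the parameter error. *)
  pose g t := G1 *m Kop1 K1 K2 (ze t) + G1 *m (Thh t *m (Sigma (v t) *m Kop2 K3 (ze t)))
     + G1 *m (diagc (te t) *m (Sigma (v t) *m Kop2 K3 (z t))).
  have dKz i : expdec 0 (fun t => Kop2 K3 (z t) i ord0).
    apply: (Kop2_decay (B := MA)) => // t t0 j; rewrite oppr0 mul0r expR0 mulr1.
    apply: le_trans (bA t t0); apply: (@le_trans _ _ (L2norm2 (z t))).
      rewrite (L2norm2_itg (zL t t0)) (bigD1 j) //= lerDl; apply: sumr_ge0 => l _.
      by apply: itg_ge0 => x; exact: sqr_ge0.
    by rewrite /H1norm2 addrCA lerDl addr_ge0 ?mnorm2_ge0 ?L2norm2_ge0.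
  have dKze (K4 : R -> 'M[R]_nz) (cK4 : cont01 K4) i : expdec k (fun t => Kop2 K4 (ze t) i ord0).
    by apply: (Kop2_decay (B := K)) => // t t0 j; exact: hze.
  have dg i : expdec k1 (fun t => g t i ord0).
    apply: (expdec_le k1k); under [X in expdec _ X]eq_fun do rewrite mxE [X in X + _]mxE.
    apply: expdecD; [apply: expdecD|]; apply: expdec_mulmx => // j.
    - under [X in expdec _ X]eq_fun do rewrite mxE.
      apply: expdecD; first exact: (dKze K1 cK1).
      (* The value at 1 is controlled by the gradient, through the pointwise bound; an [L^2] bound
         on the profile would not do. *)
      apply: expdec_mulmx => // l; exists K => t t0; apply: sup => //.
      by rewrite ler01 lexx.
    - under [X in expdec _ X]eq_fun do rewrite diagc_mulE.
      by apply: expdecM0 => //; apply: expdec_mulmx => // l; exact: dKze.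
    - under [X in expdec _ X]eq_fun do rewrite diagc_mulE mulrC.
      by apply: expdecM0 => //; apply: expdec_mulmx.
  have EXe t : 0 < t -> dX t - dXh t = (A1 + L1 *m A2) *m Xe t + g t.
    move=> t0; have t0' := ltW t0; rewrite EX // EXh // !vE /Y1h hK.
    (* The known input drops out of the injection term, which becomes [A2 *m Xe t] and completes
       [A1] to the Hurwitz matrix. *)
    have -> : v t - (A2 *m Xh t + G2 *m U t) = A2 *m Xe t.
      by rewrite /v /Xe mulmxBr opprD addrACA subrr addr0.
    rewrite /g -TE.
    have -> : Kop1 K1 K2 (ze t) = Kop1 K1 K2 (z t) - Kop1 K1 K2 (zh t).
      by rewrite /Kop1 -/(Kop2 K1 _) -/(Kop2 K1 _) -/(Kop2 K1 _) opprD addrACA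
         (Kop2B cK1 (zL t t0') (zhL t t0')) -mulmxBr.
    rewrite -(Kop2B cK3 (zL t t0') (zhL t t0')) /Xe.
    rewrite !mulmxBl !mulmxDl !mulmxBr !mulmxA.
    set a1 := A1 *m X t; set a2 := A1 *m Xh t; set b1 := L1 *m A2 *m X t; set b2 := L1 *m A2 *m Xh t.
    set c1 := G1 *m Kop1 K1 K2 (z t); set c2 := G1 *m Kop1 K1 K2 (zh t).
    set d1 := G1 *m Theta *m Sigma (v t) *m Kop2 K3 (z t); set e1 := G1 *m h1 (v t).
    set d2 := G1 *m Thh t *m Sigma (v t) *m Kop2 K3 (zh t).
    set d3 := G1 *m Thh t *m Sigma (v t) *m Kop2 K3 (z t).
    by apply/colP => i; rewrite !mxE; ring.
  have dXe := Hkap k1 k1kap Xe (fun t => dX t - dXh t) g (classical_reg_hderiv rege) EXe dg.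
  have [KX KX0 hKX] := expdec_mnorm2 dXe.
  (* Twice, for the profile and for its gradient, each summed over [nz] components. *)
  exists (KX + 2 * (nz%:R * K)); first by rewrite addr_ge0 // !mulr_ge0.
  move=> t t0; rewrite mulrDl; apply: lerD; first exact: hKX.
  have ee : expR (- k * t) <= expR (- k1 * t) by rewrite ler_expR ler_wpM2r // lerN2.
  have sumK (f : R -> 'cV[R]_nz) : (forall j, L2R (zext (fun x => f x j ord0))) ->
      (forall j, itg (fun x => zext (fun y => f y j ord0) x ^+ 2) <= K * expR (- k * t)) ->
      L2norm2 f <= nz%:R * K * expR (- k1 * t).
    move=> fL fK; rewrite (L2norm2_itg fL).
    apply: (@le_trans _ _ (\sum_(i < nz) K * expR (- k1 * t))).
      by apply: ler_sum => j _; apply: (le_trans (fK j)); rewrite ler_wpM2l.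
    by rewrite sumr_const card_ord -mulrA mulr_natl.
  rewrite /H1norm2 mulr_natl mulr2n mulrDl.
  apply: lerD; apply: sumK; [exact: zeL|by move=> j; exact: hze|exact: gxL|by move=> j; exact: hgx].
(* [core] bounds the squared norm; the root halves the rate. *)
have Ysq k K t : mnorm2 (Xe t) + H1norm2 (ze t) (gx t) <= K * expR (- k * t) ->
    Ynorm t <= Num.sqrt K * expR (- (k / 2) * t).
  move=> h; have -> : expR (- (k / 2) * t) = Num.sqrt (expR (- k * t)).
    rewrite (_ : - k * t = - (k / 2) * t + - (k / 2) * t); last by field.
    by rewrite expRD -expr2 sqrtr_sqr ger0_norm // expR_ge0.
  rewrite mulrC -sqrtrM ?expR_ge0 // mulrC; exact: ler_wsqrtr.
split.
  have [K K0 hKK] := core 0 (lexx 0) te0.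
  exists (Num.sqrt K) => t t0; have := Ysq _ _ _ (hKK t t0).
  by rewrite min_l ?(ltW kap0) // mul0r oppr0 mul0r expR0 mulr1.
move=> hM hPE; have [k kp dte] := tePE hM hPE.
have [K K0 hKK] := core k (ltW kp) dte.
(* The added 1 keeps the constant positive even for [K = 0]. *)
exists (Num.min k kap / 2), (Num.sqrt K + 1).
split; first by rewrite divr_gt0 // lt_min kp.
split; first by rewrite ltr_wpDl // sqrtr_ge0.
move=> t t0; apply: (le_trans (Ysq _ _ _ (hKK t t0))).
by rewrite ler_wpM2r ?expR_ge0 // lerDl.
Qed.
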